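(* Let $0\le k\le n$, $l\ge0$, $\mathcal U=\mathbb U_{k,l}$, and $O=|\phi\rangle\langle\phi|-\mathbb 1/d$ with $|\phi\rangle\in\mathcal H$ a pure state. Then, with $\gamma=3/4$, $$V_*(O)\le 2^{1-M_2(\phi)/2}\gamma^{kl}+\frac6d,\qquad -\frac6d<V_*(O,\phi)-2^{1-M_2(\phi)}\gamma^{kl}<\frac4d.$$
   Context: Let $n\ge1$, $d=2^n$, $\mathcal H=(\mathbb C^2)^{\otimes n}$ with computational basis $\{|\mathbf b\rangle\}$. For a unitary ensemble $\mathcal U$ with measurement channel $\mathcal M(X)=\mathbb E_{U}\sum_{\mathbf b}\langle\mathbf b|UXU^\dagger|\mathbf b\rangle U^\dagger|\mathbf b\rangle\langle\mathbf b|U$ (for a 2-design, $\mathcal M^{-1}(O)=(d+1)O-\operatorname{tr}(O)\mathbb 1$), define for a density operator $\rho$ and traceless Hermitian $O$: $V_*(O,\rho)=\mathbb E_{U}\bigl(\sum_{\mathbf b}\langle\mathbf b|U\rho U^\dagger|\mathbf b\rangle\langle\mathbf b|U\mathcal M^{-1}(O)U^\dagger|\mathbf b\rangle\bigr)^2-[\operatorname{tr}(O\rho)]^2$, $V_*(O)=\max_\rho V_*(O,\rho)$, $V_*(O,\phi)=V_*(O,|\phi\rangle\langle\phi|)$. Let $T=\mathrm{diag}(1,e^{i\pi/4})$, $\hat T_k=I^{\otimes(n-k)}\otimes T^{\otimes k}$; $\mathbb U_{k,l}$ is the distribution of $C_l\hat T_kC_{l-1}\cdots\hat T_kC_0$ with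 $C_0,\dots,C_l$ independent uniform elements of the $n$-qubit Clifford group $\mathrm{Cl}_n$. With $\overline{\mathcal P}_n=\{I,X,Y,Z\}^{\otimes n}$, the stabilizer 2-Rényi entropy of $|\phi\rangle$ is $M_2(\phi)=-\log_2\bigl(\frac1d\sum_{P\in\overline{\mathcal P}_n}\langle\phi|P|\phi\rangle^4\bigr)$. *)

(* Defs.v *)
From HB Require Import structures.
From mathcomp Require Import all_boot all_order all_algebra.
From mathcomp Require Import all_classical all_reals.
From mathcomp Require Import exp trigo.
From mathcomp.real_closed Require Import complex.
Set Implicit Arguments. Unset Strict Implicit. Unset Printing Implicit Defensive.
Import Order.TTheory GRing.Theory Num.Theory.
Local Open Scope ring_scope.

Section QInfo.
Variable R : realType.
Local Notation C := R[i].
Variable n : nat.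
Local Notation d := (2 ^ n)%N.
Local Notation Mat := 'M[C]_(2 ^ n).

Definition adj (p q : nat) (A : 'M[C]_(p, q)) : 'M[C]_(q, p) :=
  (map_mx (@conjc R) A)^T.

Definition bit (p : nat) (i : 'I_d) : 'I_2 := inord ((i %/ 2 ^ p) %% 2).

(* tensor product A_0 (x) A_1 (x) ... (x) A_{n-1} of single-qubit operators;
   tensor factor q (counted from the left) corresponds to bit n-1-q of the
   computational basis index (standard big-endian convention). *)
Definition tens (A : 'I_n -> 'M[C]_2) : Mat :=
  \matrix_(i, j) \prod_(q < n) A q (bit (n - 1 - q) i) (bit (n - 1 - q) j).

Definition pauli1 (a : 'I_4) : 'M[C]_2 :=
  \matrix_(i < 2, j < 2)
    match val a with
    | 0 => if i == j then 1 else 0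
    | 1 => if i == j then 0 else 1
    | 2 => if i == j then 0 else if val i == 0%N then - 'i%C else 'i%C
    | _ => if i == j then (if val i == 0%N then 1 else -1) else 0
    end.

Definition pauli (s : {ffun 'I_n -> 'I_4}) : Mat := tens (fun q => pauli1 (s q)).

Definition unitary (U : Mat) : Prop := adj U *m U = 1%:M.

Definition clifford (U : Mat) : Prop :=
  unitary U /\
  forall s, exists (c : C) (s' : {ffun 'I_n -> 'I_4}),
      U *m pauli s *m adj U = c *: pauli s'.

(* S : 'I_m -> Mat lists the n-qubit Clifford group Cl_n (modulo global
   phases): each S j is Clifford and every Clifford unitary equals a phase
   times exactly one S j.  The uniform distribution on Cl_n is the uniform
   distribution on the S j. *)
Definition clifford_transversal (m : nat) (S : 'I_m -> Mat) : Prop :=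
  (forall j, clifford (S j)) /\
  forall U, clifford U -> exists! j, exists c : C, U = c *: S j.

Definition omega : C := (cos (pi / 4) +i* sin (pi / 4))%C.
Definition Tgate : 'M[C]_2 :=
  \matrix_(i < 2, j < 2) if i == j then (if val i == 1%N then omega else 1) else 0.

Definition That (k : nat) : Mat :=
  tens (fun q => if (n - k <= q)%N then Tgate else 1%:M).

Definition word (m : nat) (S : 'I_m -> Mat) (W : Mat) (c0 : 'I_m) (cs : seq 'I_m)
  : Mat := foldl (fun V j => S j *m W *m V) (S c0) cs.

Definition Eens (m : nat) (S : 'I_m -> Mat) (k l : nat) (f : Mat -> C) : C :=
  (m%:R ^+ l.+1)^-1 *
  \sum_(c0 : 'I_m) \sum_(t : l.-tuple 'I_m) f (word S (That k) c0 t).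

Definition Eens_mx (m : nat) (S : 'I_m -> Mat) (k l : nat) (f : Mat -> Mat) : Mat :=
  (m%:R ^+ l.+1)^-1 *:
  \sum_(c0 : 'I_m) \sum_(t : l.-tuple 'I_m) f (word S (That k) c0 t).

Definition meas_channel (m : nat) (S : 'I_m -> Mat) (k l : nat) (X : Mat) : Mat :=
  Eens_mx S k l (fun U =>
    \sum_(b : 'I_d) (U *m X *m adj U) b b *: (adj U *m delta_mx b b *m U)).

(* V_*(O, rho), where Q = M^{-1}(O) (passed as any Q with M(Q) = O) *)
Definition Vstar_rho (m : nat) (S : 'I_m -> Mat) (k l : nat)
  (O Q rho : Mat) : R :=
  complex.Re (Eens S k l (fun U =>
        (\sum_(b : 'I_d) (U *m rho *m adj U) b b * (U *m Q *m adj U) b b) ^+ 2)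
      - (\tr (O *m rho)) ^+ 2).

Definition density (rho : Mat) : Prop :=
  adj rho = rho /\ \tr rho = 1 /\
  forall v : 'cV[C]_d, 0 <= (adj v *m rho *m v) 0 0.

Definition pure_state (phi : 'cV[C]_d) : Prop := (adj phi *m phi) 0 0 = 1.

Definition projector (phi : 'cV[C]_d) : Mat := phi *m adj phi.

Definition Ophi (phi : 'cV[C]_d) : Mat := projector phi - (d%:R)^-1 *: 1%:M.

Definition log2 (x : R) : R := ln x / ln 2.

Definition M2 (phi : 'cV[C]_d) : R :=
  - log2 ((d%:R)^-1 * \sum_(s : {ffun 'I_n -> 'I_4})
             (complex.Re ((adj phi *m pauli s *m phi) 0 0)) ^+ 4).

End QInfo.

(* Main.v *)
(** The variance is a quadratic form in the fourfold tensor product O, rho, O, rho,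
    so only the average over the ensemble of the fourfold tensor power of the
    measurement matters. A Clifford twirl sends the measurement kernel to
      ((d+1)(d+2))^-1 (1 + (12) + (34) + (12)(34) + d Pi (1 + (12))),
    where the permutations act on the four copies and Pi = d^-2 sum_P P^{(x)4}.
    The permutations are fixed by every further layer. A T layer expands Pi into
    the operators Pi_u P_b^{13} P_c^{23} with u, b, c strings of Z's; since Clifford
    unitaries act transitively on triples of Pauli labels with the same linear
    relations and commutation (Witt's theorem), the following twirl depends only
    on class sums, and it maps Pi to an explicit combination of Pi times S_3 and of
    the sum R of the Klein four-group times S_3. On Pi (1 + (12)) this map acts
    through the standard and the trivial representation of S_3, with two rates
    0 <= alpha_triv <= alpha_std <= (3/4)^k and fixed part in R S_3, so the
    variance after l layers is an explicit affine function of alpha_std^l and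
    alpha_triv^l. Its leading coefficient is a sum of squares of
    tr(P O) tr(P rho), which Cauchy-Schwarz bounds by the square root of the
    stabilizer purity of phi and which equals that purity up to O(1/d) when
    rho = phi. *)
Require Import Defs.
From HB Require Import structures.
From mathcomp Require Import all_boot all_order all_algebra.
From mathcomp Require Import reals ring lra zify.
From mathcomp.real_closed Require Import complex mxtens.
Set Implicit Arguments. Unset Strict Implicit. Unset Printing Implicit Defensive.
Import Order.TTheory GRing.Theory Num.Theory.
Local Open Scope ring_scope.

(** * Witt's theorem over GF(2) *)

Section Symplectic.
Variable n : nat.

(** Two facts keep the group theory small. Every operator on four copies that occurs carries each
    Pauli factor an even number of times, so the signs of a Clifford conjugation cancel and only its
    permutation of labels matters. And only pairwise commuting triples ever matter: strings of Z
    commute, and R times the sum of the two 3-cycles weights a triple of labels by a product of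
    three factors 1 + chi, which kills every anticommuting pair. A linear functional of the twirl is
    then given by finitely many values, and an equation between operators becomes a comparison of
    six coefficients. The counts behind it contain the factors d^2 - 4 and d^2 - 16, so d = 2 and d
    = 4 need coefficients of their own. The base 3/4 is 1 - 1/4: the weight with which one T gate
    keeps the trivial triple u = b = c = 0. In the upper bound, 6 arises as 4/3 + 14/3 from the part
    that survives many layers; for rho = phi the constants 4 and 6 come from the two ends of an
    affine function of a power of the trivial rate. *)

Definition vec := {ffun 'I_n -> bool * bool}.
HB.instance Definition _ := Finite.on vec.
HB.instance Definition _ := GRing.Zmodule.on vec.
Implicit Types u v w c : vec.

(* The bits (x, z) of a qubit stand for the Pauli operator X^x Z^z up to a phase. *)
Definition sf1 (a b : bool * bool) : bool := (a.1 && b.2) (+) (a.2 && b.1).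
Definition sf v w : bool := \sum_q sf1 (v q) (w q).

Lemma addvecc v : v + v = 0.
Proof. by apply/ffunP => q; rewrite !ffunE; case: (v q) => [[] []]. Qed.

Lemma addvecK v w : v + w + w = v. Proof. by rewrite -addrA addvecc addr0. Qed.

Lemma addKvec v w : v + (v + w) = w. Proof. by rewrite addrA addvecc add0r. Qed.

Lemma addvec_eq0 v w : (v + w == 0) = (v == w).
Proof.
apply/eqP/eqP => [h|->]; last exact: addvecc.
by rewrite -[v](addvecK _ w) h add0r.
Qed.

Lemma sfC v w : sf v w = sf w v.
Proof. by apply: eq_bigr => q _; case: (v q) (w q) => [[] []] [[] []]. Qed.

Lemma sfDl u v w : sf (u + v) w = sf u w (+) sf v w.
Proof.
rewrite /sf -[RHS]/(_ + _)%R -big_split; apply: eq_bigr => q _; rewrite ffunE.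
by case: (u q) (v q) (w q) => [[] []] [[] []] [[] []].
Qed.

Lemma sfDr u v w : sf w (u + v) = sf w u (+) sf w v.
Proof. by rewrite sfC sfDl !(sfC w). Qed.

Lemma sfvv v : sf v v = false.
Proof. by apply: big1 => q _; case: (v q) => [[] []]. Qed.

Lemma sf0v v : sf 0 v = false.
Proof. by apply: big1 => q _; rewrite ffunE. Qed.

Lemma sfv0 v : sf v 0 = false. Proof. by rewrite sfC sf0v. Qed.

Lemma sf_sumr (I : finType) (m : pred I) (w : I -> vec) c :
  sf c (\sum_(i | m i) w i) = \sum_(i | m i) (sf c (w i) : bool).
Proof. by apply: (big_morph _ _ (sfv0 c)) => u v; rewrite sfDr. Qed.

Definition symp_sign (R : pzRingType) v w : R := (-1) ^+ sf v w.

Lemma chiC (R : pzRingType) v w : symp_sign R v w = symp_sign R w v.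
Proof. by rewrite /symp_sign sfC. Qed.

Lemma chiDl (R : pzRingType) u v w : symp_sign R (u + v) w = symp_sign R u w * symp_sign R v w.
Proof. by rewrite /symp_sign sfDl signr_addb. Qed.

Lemma chiDr (R : pzRingType) u v w : symp_sign R w (u + v) = symp_sign R w u * symp_sign R w v.
Proof. by rewrite /symp_sign sfDr signr_addb. Qed.

Lemma chi0v (R : pzRingType) v : symp_sign R 0 v = 1. Proof. by rewrite /symp_sign sf0v. Qed.
Lemma chiv0 (R : pzRingType) v : symp_sign R v 0 = 1. Proof. by rewrite /symp_sign sfv0. Qed.
Lemma chivv (R : pzRingType) v : symp_sign R v v = 1. Proof. by rewrite /symp_sign sfvv. Qed.

Lemma chi_sqr (R : pzRingType) v w : symp_sign R v w * symp_sign R v w = 1.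
Proof. by rewrite /symp_sign -signr_addb addbb. Qed.

Lemma sign_sum (R : pzRingType) (I : finType) (m : pred I) (t : I -> bool) :
  (-1) ^+ (\sum_(i | m i) t i : bool)%R = \prod_(i | m i) (-1) ^+ t i :> R.
Proof.
by apply: (big_morph (fun b : bool => (-1) ^+ b)) => // a b; rewrite signr_addb.
Qed.

Lemma chi_prod (R : comPzRingType) v w :
  symp_sign R v w = \prod_q (-1) ^+ sf1 (v q) (w q).
Proof.
exact: sign_sum.
Qed.

(** Orthogonality of characters. The sum factors over the qubits, and a qubit with a nonzero label
    sees two signs of each kind. *)
Lemma sum_chi (R : comPzRingType) w :
  \sum_c symp_sign R c w = (4 ^ n)%:R *+ (w == 0).
Proof.
under eq_bigr do rewrite chi_prod.
rewrite -(bigA_distr_bigA (fun q a => (-1) ^+ sf1 a (w q))).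
have H (b : bool * bool) : \sum_a (-1) ^+ sf1 a b = 4%:R *+ (b == 0) :> R.
  rewrite (eq_bigr (fun p => (-1) ^+ sf1 (p.1, p.2) b)) => [|[] //].
  rewrite -(pair_big predT predT (fun x y => (-1) ^+ sf1 (x, y) b)) /= !big_bool.
  have E0 : 1 + 1 + (-1 - 1) = 0 :> R by rewrite -opprD subrr.
  by case: b => [[] []]; rewrite /= ?expr0 ?expr1 ?mulr0n ?mulr1n
    ?subrr ?addNr ?addr0 ?E0 //; first [by rewrite addrC E0 | by rewrite -addrA].
transitivity (\prod_q (4%:R *+ (w q == 0)) : R); first by apply: eq_bigr => q _; exact: H.
case: (altP (w =P 0)) => [->|w0].
  rewrite (eq_bigr (fun=> 4%:R)) => [|q _]; last by rewrite ffunE.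
  by rewrite prodr_const card_ord natrX mulr1n.
have [q wq] : exists q, w q != 0.
  apply/existsP; apply: contraR w0 => /existsPn h; apply/eqP/ffunP => q.
  by rewrite ffunE; apply/eqP; rewrite -[_ == _]negbK h.
by rewrite (bigD1 q) //= (negbTE wq) mulr0n mul0r.
Qed.

(* The number of solutions is computed by character sums; compatibility makes
   every surviving term positive. *)
Lemma sf_solve (I : finType) (w : I -> vec) (t : I -> bool) :
  (forall m : {set I}, \sum_(i in m) w i = 0 -> \sum_(i in m) t i = false) ->
  exists c, forall i, sf c (w i) = t i.
Proof.
move=> compat.
have [/existsP [c /forallP hc]|/existsPn none] :=
  boolP [exists c, [forall i, sf c (w i) == t i]].
  by exists c => i; apply/eqP.
exfalso.
have : \sum_c \prod_i (1 + (-1) ^+ (sf c (w i) (+) t i)) = 0 :> int.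
  apply: big1 => c _; have /forallPn [i hi] := none c.
  rewrite (bigD1 i) //=; suff -> : sf c (w i) (+) t i = true by rewrite mul0r.
  by move: hi; case: (sf _ _); case: (t i).
under eq_bigr => c _ do rewrite bigA_distr.
rewrite exchange_big /=.
have E (m : {set I}) : \sum_c \prod_i (if i \in m then 1 else (-1) ^+ (sf c (w i) (+) t i))
    = ((4 ^ n)%:R : int) *+ (\sum_(i in ~: m) w i == 0).
  have -> : \sum_c \prod_i (if i \in m then 1 else (-1) ^+ (sf c (w i) (+) t i))
     = \sum_c symp_sign int c (\sum_(i in ~: m) w i) * (-1) ^+ (\sum_(i in ~: m) t i : bool)%R.
    apply: eq_bigr => c _; rewrite /symp_sign sf_sumr !sign_sum -big_split /=.
    rewrite [RHS]big_mkcond /=; apply: eq_bigr => i _; rewrite in_setC signr_addb.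
    by case: (i \in m).
  rewrite -mulr_suml sum_chi; case: eqP => [/compat ->|_]; last by rewrite mulr0n mul0r.
  by rewrite mulr1.
under eq_bigr => m _ do rewrite E.
apply/eqP; rewrite gt_eqF // (bigD1 setT) //= setCT big_set0 eqxx mulr1n.
rewrite ltr_pwDl ?sumr_ge0 // => [|m _]; last by rewrite mulrn_wge0 // ler0n.
by rewrite ltr0n expn_gt0.
Qed.

(* Symplectic transvections; they are implemented by the Clifford unitaries [Utv]. *)
Definition transvect c v : vec := if sf v c then v + c else v.

Lemma transvectK c : involutive (transvect c).
Proof.
move=> v; rewrite /transvect; case h : (sf v c); last by rewrite h.
by rewrite sfDl sfvv addbF h addvecK.
Qed.

Lemma sf_transvect c v w : sf (transvect c v) (transvect c w) = sf v w.
Proof.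
rewrite /transvect; case hv : (sf v c); case hw : (sf w c);
rewrite ?sfDl ?sfDr ?sfvv ?hv ?hw ?(sfC c) ?hv ?hw //= ?addbF //.
by case: (sf v w).
Qed.

Lemma transvectD c v w : transvect c (v + w) = transvect c v + transvect c w.
Proof.
rewrite /transvect sfDl; case hv : (sf v c); case hw : (sf w c) => //=.
- by rewrite addrACA addvecc addr0.
- by rewrite addrAC.
- by rewrite addrA.
Qed.

Lemma transvect0 c : transvect c 0 = 0. Proof. by rewrite /transvect sf0v. Qed.

Definition transvects (cs : seq vec) v := foldl (fun v c => transvect c v) v cs.

Lemma act_cat cs1 cs2 v : transvects (cs1 ++ cs2) v = transvects cs2 (transvects cs1 v).
Proof. exact: foldl_cat. Qed.

Lemma sf_act cs v w : sf (transvects cs v) (transvects cs w) = sf v w.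
Proof. by elim: cs v w => //= c cs IH v w; rewrite IH sf_transvect. Qed.

Lemma act0 cs : transvects cs 0 = 0.
Proof. by elim: cs => //= c cs IH; rewrite transvect0. Qed.

Lemma actD cs v w : transvects cs (v + w) = transvects cs v + transvects cs w.
Proof. by elim: cs v w => //= c cs IH v w; rewrite transvectD IH. Qed.

Lemma act_inj cs : injective (transvects cs).
Proof. by elim: cs => //= c cs IH v w /IH /(can_inj (transvectK c)). Qed.

Lemma act_sum cs (I : finType) (m : pred I) (w : I -> vec) :
  transvects cs (\sum_(i | m i) w i) = \sum_(i | m i) transvects cs (w i).
Proof. exact: (big_morph _ (actD cs) (act0 cs)). Qed.

(** If a and b anticommute, the transvection along a + b suffices. Otherwise a is sent to b through
    some c that anticommutes with both and has the same products with the family as a. Such a c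
    exists because the only relations to check contain both a and b or neither: a relation with just
    one of them would put it in the span of the family. *)
Lemma witt_step (I : finType) (F : I -> vec) a b :
  (forall i, sf a (F i) = sf b (F i)) ->
  (forall m : {set I}, \sum_(i in m) F i != a) ->
  (forall m : {set I}, \sum_(i in m) F i != b) ->
  exists cs, (forall i, transvects cs (F i) = F i) /\ transvects cs a = b.
Proof.
move=> hF ha hb; case hab : (sf a b).
  exists [:: a + b]; split=> [i|]; rewrite /= /transvect sfDr.
    by rewrite !(sfC (F i)) hF addbb.
  by rewrite sfvv hab /= addKvec.
pose w (i : I + bool) := match i with inl i => F i | inr x => if x then a else b end.
pose t (i : I + bool) := match i with inl i => sf a (F i) | inr x => true end.
have [m|c hc] := @sf_solve _ w t.
  rewrite !big_sumType /= [X in _ + X]big_mkcond [X in _ -> _ + X = _]big_mkcond.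
  rewrite !big_bool /=.
  pose m' := [set i | inl i \in m].
  have E : \sum_(i | inl i \in m) F i = \sum_(i in m') F i.
    by apply: eq_bigl => i; rewrite inE.
  have E' : \sum_(i | inl i \in m) sf a (F i) = sf a (\sum_(i in m') F i) :> bool.
    by rewrite sf_sumr; apply: eq_bigl => i; rewrite inE.
  rewrite E' E.
  case: (inr true \in m); case: (inr false \in m); rewrite ?addr0 ?add0r.
  - move/eqP; rewrite addrA -addrA addvec_eq0 => /eqP ->.
    by rewrite sfDr sfvv hab.
  - by move/eqP; rewrite addvec_eq0 (negbTE (ha _)).
  - by move/eqP; rewrite addvec_eq0 (negbTE (hb _)).
  - by move->; rewrite sfv0.
exists [:: a + c; b + c]; split=> [i|] /=.
  have hi := hc (inl i); rewrite /= in hi.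
  have h1 : transvect (a + c) (F i) = F i by rewrite /transvect sfDr !(sfC (F i)) hi addbb.
  by rewrite h1 /transvect sfDr !(sfC (F i)) hi -hF addbb.
have h1 : transvect (a + c) a = c.
  by rewrite /transvect sfDr sfvv (sfC a) (hc (inr true)) /= addKvec.
by rewrite h1 /transvect sfDr sfvv (hc (inr false)) /= (addrC b) addKvec.
Qed.

(** Linear independence over GF(2), where linear combinations are subset sums. *)
Definition free_fam r (w : 'I_r -> vec) :=
  forall m : {set 'I_r}, \sum_(i in m) w i = 0 -> m = set0.

(** Induction on the size: the tail is moved first, and the image of the head is then corrected by
    transvections that fix the tail. *)
Theorem witt r (w w' : 'I_r -> vec) :
  (forall i j, sf (w i) (w j) = sf (w' i) (w' j)) ->
  free_fam w -> free_fam w' -> exists cs, forall i, transvects cs (w i) = w' i.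
Proof.
elim: r w w' => [|r IH] w w' hg fw fw'; first by exists [::]; case.
have sub (x : 'I_r.+1 -> vec) : free_fam x -> free_fam (fun i => x (lift ord0 i)).
  move=> fx m hm; have := fx [set lift ord0 i | i in m].
  rewrite big_imset /=; last by move=> i j _ _ /lift_inj.
  by move/(_ hm)/eqP; rewrite imset_eq0 => /eqP.
have nsp (x : 'I_r.+1 -> vec) : free_fam x ->
    forall m : {set 'I_r}, \sum_(i in m) x (lift ord0 i) != x ord0.
  move=> fx m; apply/negP => /eqP hm.
  have := fx (ord0 |: [set lift ord0 i | i in m]).
  rewrite big_setU1 /=; last by apply/imsetP => -[i _ /eqP]; rewrite (negbTE (neq_lift _ _)).
  rewrite big_imset /=; last by move=> i j _ _ /lift_inj.
  rewrite hm addvecc => /(_ erefl) /setP /(_ ord0); by rewrite !inE eqxx.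
have [cs hcs] := IH (fun i => w (lift ord0 i)) (fun i => w' (lift ord0 i))
  (fun i j => hg _ _) (sub _ fw) (sub _ fw').
have [i|m|m|cs' [h1 h2]] := @witt_step _ (fun i => w' (lift ord0 i)) (transvects cs (w ord0)) (w' ord0).
- by rewrite -hcs sf_act hg hcs.
- under eq_bigr => i _ do rewrite -hcs.
  by rewrite -act_sum (inj_eq (@act_inj cs)) nsp.
- exact: nsp.
exists (cs ++ cs') => i; rewrite act_cat.
by case: (unliftP ord0 i) => [j ->|-> //]; rewrite hcs h1.
Qed.

End Symplectic.

Lemma ord2P (P : 'I_2 -> Prop) : P ord0 -> P ord_max -> forall i, P i.
Proof.
move=> h0 h1 [[|[|i]] hi] //.
  by have -> : Ordinal hi = ord0 by exact: val_inj.
by have -> : Ordinal hi = ord_max by exact: val_inj.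
Qed.

Lemma big_bool2 (T : Type) (idx : T) (op : Monoid.com_law idx) (F : bool * bool -> T) :
  \big[op/idx]_a F a = op (op (F (true, true)) (F (true, false)))
                          (op (F (false, true)) (F (false, false))).
Proof.
rewrite (eq_bigr (fun p => F (p.1, p.2))) => [|[] //].
by rewrite -(pair_big predT predT (fun x y => F (x, y))) /= !big_bool.
Qed.

(** * Basis indices as bit strings *)

Section Bits.
Variable n : nat.

Definition bits (i : 'I_(2 ^ n)) : {ffun 'I_n -> 'I_2} :=
  [ffun q : 'I_n => bit (n - 1 - q) i].

Lemma bits_inj : injective bits.
Proof.
move=> i j /ffunP hij; apply: val_inj => /=.
have dig p : (p < n)%N -> ((i %/ 2 ^ p) %% 2 = (j %/ 2 ^ p) %% 2)%N.
  move=> hp; have hq : (n - 1 - p < n)%N by rewrite -subnDA ltn_subrL (leq_ltn_trans _ hp).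
  have := hij (Ordinal hq); rewrite !ffunE /bit /=.
  rewrite subKn; last by rewrite subn1 -ltnS prednK // (leq_ltn_trans _ hp).
  by move/(congr1 val); rewrite /= !inordK ?ltn_pmod.
have step x p : (x %% 2 ^ p.+1 = ((x %/ 2 ^ p) %% 2 * 2 ^ p + x %% 2 ^ p))%N.
  rewrite {1}(divn_eq x (2 ^ p)) {1}(divn_eq (x %/ 2 ^ p) 2) mulnDl -mulnA -expnS -addnA modnMDl modn_small //.
  have h1 : ((x %/ 2 ^ p) %% 2 <= 1)%N by rewrite -ltnS ltn_pmod.
  apply: (@leq_ltn_trans (1 * 2 ^ p + x %% 2 ^ p)%N); first by rewrite leq_add2r leq_mul2r h1 orbT.
  by rewrite expnS mul2n -addnn mul1n ltn_add2l ltn_pmod // expn_gt0.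
have main p : (p <= n)%N -> (i %% 2 ^ p = j %% 2 ^ p)%N.
  elim: p => [|p IH] hp; first by rewrite !modn1.
  by rewrite !step dig // IH // ltnW.
by have := main n (leqnn n); rewrite !modn_small.
Qed.

Lemma bits_bij : bijective bits.
Proof.
by apply: (inj_card_bij bits_inj); rewrite card_ffun !card_ord.
Qed.

(** Reduces products and traces of tensor products to single qubits. *)
Lemma sum_bits (T : comPzRingType) (f : 'I_n -> 'I_2 -> T) :
  \sum_(i < 2 ^ n) \prod_q f q (bit (n - 1 - q) i) = \prod_q \sum_b f q b.
Proof.
rewrite bigA_distr_bigA /= (reindex bits); last exact: onW_bij bits_bij.
by apply: eq_bigr => i _; apply: eq_bigr => q _; rewrite ffunE.
Qed.

Lemma bits_eq (T : comPzRingType) (i j : 'I_(2 ^ n)) :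
  \prod_(q < n) (bit (n - 1 - q) i == bit (n - 1 - q) j)%:R = (i == j)%:R :> T.
Proof.
have [->|/eqP hij] := eqVneq i j; first by apply: big1 => q _; rewrite eqxx.
have [q hq|h] := pickP (fun q => bits i q != bits j q); last first.
  by case: hij; apply: bits_inj; apply/ffunP => q; apply/eqP/negbFE/h.
by rewrite (bigD1 q) //=; move: hq; rewrite !ffunE => /negbTE ->; rewrite mul0r.
Qed.

End Bits.

(** * Pauli operators *)

Section Pauli.
Variable R : realType.
Local Notation C := R[i].
Local Notation iC := ('i%C : C).

Lemma iCiC : iC * iC = -1. Proof. by rewrite -expr2 sqr_i. Qed.

(** Translates the bits (x, z) into the numbering I, X, Y, Z of [pauli1]; [sigE] shows that the
    operator is i^(xz) X^x Z^z. *)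
Definition enc1 (a : bool * bool) : 'I_4 :=
  match a with
  | (false, false) => @Ordinal 4 0 isT | (true, false) => @Ordinal 4 1 isT
  | (true, true) => @Ordinal 4 2 isT | (false, true) => @Ordinal 4 3 isT
  end.

Lemma enc1_bij : bijective enc1.
Proof.
apply: inj_card_bij; last by rewrite card_prod !card_bool card_ord.
by move=> [[] []] [[] []].
Qed.

Definition sig (a : bool * bool) : 'M[C]_2 := pauli1 R (enc1 a).

Lemma sigE a i j : sig a i j =
  if (i == j) == a.1 then 0 else iC ^+ (a.1 && a.2) * (-1) ^+ (a.2 && (j == ord_max)).
Proof.
rewrite mxE; case: a => [[] []]; elim/ord2P: i; elim/ord2P: j;
by rewrite /= ?expr0 ?expr1 ?mul1r ?mulr1 ?mulrN1.
Qed.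

(** The cocycle of the projective representation by Pauli operators: a factor i for each Y on the
    left, a factor -i for a Y in the product, and a sign for moving Z past X. *)
Definition kap1 (a b : bool * bool) : C :=
  iC ^+ (a.1 && a.2) * iC ^+ (b.1 && b.2)
  * (- iC) ^+ ((a.1 (+) b.1) && (a.2 (+) b.2)) * (-1) ^+ (a.2 && b.1).

Lemma sig_mul a b : sig a *m sig b = kap1 a b *: sig (a + b).
Proof.
apply/matrixP => i j; rewrite mxE !big_ord_recl big_ord0 addr0 [RHS]mxE !sigE /kap1.
have -> : lift ord0 ord0 = ord_max :> 'I_2 by exact: val_inj.
case: a b => [[] []] [[] []]; elim/ord2P: i; elim/ord2P: j;
by rewrite /= ?(expr0, expr1, mul1r, mulr1, mul0r, mulr0, add0r, addr0, mulrN, mulNr, opprK, iCiC, mulrA, oppr0).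
Qed.

(** The phase is 1 or -1 for commuting labels and i or -i for anticommuting ones. On four copies the
    phases appear in pairs, so only this square survives. *)
Lemma kap1_sqr a b : kap1 a b * kap1 a b = (-1) ^+ sf1 a b.
Proof.
rewrite /kap1; case: a b => [[] []] [[] []];
by rewrite /= ?(expr0, expr1, mul1r, mulr1, mul0r, mulr0, add0r, addr0, mulrN, mulNr, opprK, iCiC, mulrA).
Qed.

Lemma sig_adj a : adj (sig a) = sig a.
Proof.
apply/matrixP => i j; rewrite !mxE.
case: a => [[] []]; elim/ord2P: i; elim/ord2P: j; rewrite /= ?rmorph0 ?rmorph1 ?rmorphN1 //;
by apply/eqP; rewrite eq_complex /= ?oppr0 ?opprK !eqxx.
Qed.

Lemma sig_tr a : \tr (sig a) = 2%:R *+ (a == 0).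
Proof.
rewrite /mxtrace !big_ord_recl big_ord0 addr0 !sigE.
by case: a => [[] []]; rewrite /= ?(expr0, expr1, mul1r, mulr1, addr0, add0r, subrr).
Qed.

Lemma sig_complete i j k l :
  \sum_a sig a i j * sig a k l = 2%:R * (i == l)%:R * (j == k)%:R.
Proof.
rewrite big_bool2 !sigE.
elim/ord2P: i; elim/ord2P: j; elim/ord2P: k; elim/ord2P: l;
by rewrite /= ?(expr0, expr1, mul1r, mulr1, mul0r, mulr0, add0r, addr0, mulrN, mulNr, opprK, iCiC, mulrA, subrr, addNr, oppr0).
Qed.

Lemma sig0 : sig 0 = 1%:M.
Proof.
by apply/matrixP => i j; rewrite !mxE /=; case: (i == j).
Qed.

Variable n : nat.
Local Notation d := (2 ^ n)%N.

Lemma tens_mul (A B : 'I_n -> 'M[C]_2) :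
  tens A *m tens B = tens (fun q => A q *m B q).
Proof.
apply/matrixP => i j; rewrite !mxE.
under eq_bigr => k _ do rewrite !mxE -big_split /=.
rewrite (sum_bits (fun q b => A q (bit (n - 1 - q) i) b * B q b (bit (n - 1 - q) j))).
by apply: eq_bigr => q _; rewrite ?mxE.
Qed.

Lemma tens_tr (A : 'I_n -> 'M[C]_2) : \tr (tens A) = \prod_q \tr (A q).
Proof.
rewrite /mxtrace; rewrite (eq_bigr _ (fun i _ => mxE _ _ i i)).
exact: (sum_bits (fun q b => A q b b)).
Qed.

Lemma tens_scale (c : 'I_n -> C) (A : 'I_n -> 'M[C]_2) :
  tens (fun q => c q *: A q) = (\prod_q c q) *: tens A.
Proof.
apply/matrixP => i j; rewrite !mxE -big_split /=.
by apply: eq_bigr => q _; rewrite mxE.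
Qed.

Lemma tens_adj (A : 'I_n -> 'M[C]_2) : adj (tens A) = tens (fun q => adj (A q)).
Proof.
apply/matrixP => i j; rewrite !mxE rmorph_prod.
by apply: eq_bigr => q _; rewrite !mxE.
Qed.

Lemma eq_tens (A B : 'I_n -> 'M[C]_2) : A =1 B -> tens A = tens B.
Proof.
by move=> h; apply/matrixP => i j; rewrite !mxE; apply: eq_bigr => q _; rewrite h.
Qed.

Lemma tens1 : tens (fun _ : 'I_n => 1%:M : 'M[C]_2) = 1%:M.
Proof.
apply/matrixP => i j; rewrite !mxE -bits_eq.
by apply: eq_bigr => q _; rewrite mxE.
Qed.

(* Sealed behind a [Fact], like the four-copy operators below: unification
   would otherwise unfold the tensor products. *)
Fact pauli_vec_spec (v : vec n) : {M : 'M[C]_d | M = tens (fun q => sig (v q))}.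
Proof. by eexists. Qed.
Definition pauli_vec (v : vec n) : 'M[C]_d := sval (pauli_vec_spec v).
Lemma pauli_vecE v : pauli_vec v = tens (fun q => sig (v q)).
Proof. exact: svalP (pauli_vec_spec v). Qed.

Definition kap (v w : vec n) : C := \prod_q kap1 (v q) (w q).

Definition enc (v : vec n) : {ffun 'I_n -> 'I_4} := [ffun q => enc1 (v q)].

Lemma enc_bij : bijective enc.
Proof.
apply: inj_card_bij; last by rewrite !card_ffun card_prod !card_bool !card_ord.
move=> v w /ffunP h; apply/ffunP => q; apply: (bij_inj enc1_bij).
by have := h q; rewrite !ffunE.
Qed.

Lemma pauli_enc v : pauli R (enc v) = pauli_vec v.
Proof. by rewrite pauli_vecE; apply: eq_tens => q; rewrite ffunE. Qed.

Lemma pauli_mul v w : pauli_vec v *m pauli_vec w = kap v w *: pauli_vec (v + w).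
Proof.
rewrite !pauli_vecE tens_mul -tens_scale; apply: eq_tens => q.
by rewrite sig_mul ffunE.
Qed.

Lemma kap_sqr v w : kap v w * kap v w = symp_sign _ v w.
Proof.
by rewrite chi_prod -big_split; apply: eq_bigr => q _; exact: kap1_sqr.
Qed.

Lemma pauli_adj v : adj (pauli_vec v) = pauli_vec v.
Proof. by rewrite pauli_vecE tens_adj; apply: eq_tens => q; rewrite sig_adj. Qed.

Lemma pauli_vec0 : pauli_vec 0 = 1%:M.
Proof. by rewrite pauli_vecE -tens1; apply: eq_tens => q; rewrite ffunE sig0. Qed.

Lemma mxtrace_pauli v : \tr (pauli_vec v) = d%:R *+ (v == 0).
Proof.
have [->|hv] := eqVneq v 0; first by rewrite pauli_vec0 mxtrace1.
rewrite pauli_vecE tens_tr; have [q hq|h] := pickP (fun q => v q != 0); last first.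
  by case/eqP: hv; apply/ffunP => q; rewrite ffunE; apply/eqP/negbFE/h.
by rewrite (bigD1 q) //= sig_tr (negbTE hq) mulr0n mul0r.
Qed.

(** The right side is d times the swap of two copies; this is why every transposition below is
    encoded as a sum of P tensor P. *)
Lemma pauli_complete i j k l :
  \sum_v pauli_vec v i j * pauli_vec v k l = d%:R * (i == l)%:R * (j == k)%:R.
Proof.
under eq_bigr => v _ do rewrite !pauli_vecE !mxE -big_split /=.
rewrite -(bigA_distr_bigA (fun (q : 'I_n) a => sig a (bit (n - 1 - q) i) (bit (n - 1 - q) j) *
   sig a (bit (n - 1 - q) k) (bit (n - 1 - q) l))).
under eq_bigr => q _ do rewrite sig_complete.
by rewrite !big_split /= !bits_eq prodr_const card_ord natrX.
Qed.

Lemma pauli_sqr v : pauli_vec v *m pauli_vec v = 1%:M.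
Proof.
have h : kap v v = 1.
  apply: big1 => q _; rewrite /kap1; case: (v q) => [[] []] /=;
  by rewrite ?(expr0, expr1, mul1r, mulr1, mulrN, mulNr, opprK, iCiC).
by rewrite pauli_mul addvecc pauli_vec0 h scale1r.
Qed.

Lemma pauli_comm v w : pauli_vec v *m pauli_vec w = symp_sign _ v w *: (pauli_vec w *m pauli_vec v).
Proof.
have E : kap v w * kap v w = symp_sign C v w * (kap w v * kap v w).
  rewrite kap_sqr -[LHS]mulr1; congr (_ * _); rewrite /kap -big_split.
  symmetry; apply: big1 => q _; rewrite /kap1; case: (v q) (w q) => [[] []] [[] []] /=;
  by rewrite ?(expr0, expr1, mul1r, mulr1, mulrN, mulNr, opprK, iCiC, mulrA).
have nz : kap v w != 0.
  apply/eqP => h; have := kap_sqr v w; rewrite h mul0r /symp_sign => /esym/eqP.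
  by rewrite signr_eq0.
rewrite !pauli_mul (addrC w) scalerA; congr (_ *: _); apply: (mulIf nz).
by rewrite E mulrA.
Qed.

End Pauli.

Lemma sum_mxtens (T : nmodType) (p q : nat) (f : 'I_(p * q) -> T) :
  \sum_i f i = \sum_i \sum_j f (mxtens_index (i, j)).
Proof.
rewrite pair_big /= (reindex (@mxtens_index p q)) /=; last first.
  by exists (@mxtens_unindex p q) => i _; rewrite ?mxtens_indexK ?mxtens_unindexK.
by apply: eq_bigr => -[].
Qed.

Lemma mxtrace_tens (T : pzRingType) (p q : nat) (A : 'M[T]_p) (B : 'M[T]_q) :
  \tr (A *t B) = \tr A * \tr B.
Proof.
rewrite /mxtrace sum_mxtens mulr_suml; apply: eq_bigr => i _.
by rewrite mulr_sumr; apply: eq_bigr => j _; rewrite tensmxE.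
Qed.

(** * Operators on four copies *)

Section FourCopies.
Variable R : realType.
Local Notation C := R[i].
Variable n : nat.
Local Notation d := (2 ^ n)%N.
Local Notation Mat := 'M[C]_d.
Local Notation Mat4 := 'M[C]_(d * d * (d * d)).
Local Notation P := (@pauli_vec R n).
Local Notation chi := (@symp_sign n C).
Local Notation vec := (vec n).
Local Notation D := (d%:R : C).
Implicit Types (X Y U : Mat) (M : Mat4) (u v w a b c : vec).

Lemma D_neq0 : D != 0. Proof. by rewrite pnatr_eq0 expn_eq0. Qed.

Lemma dim_sqr : D * D = (4 ^ n)%:R.
Proof. by rewrite -natrM -expnMn. Qed.

Lemma adjcM p q r (A : 'M[C]_(p, q)) (B : 'M[C]_(q, r)) : adj (A *m B) = adj B *m adj A.
Proof. by rewrite /adj map_mxM trmx_mul. Qed.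

Lemma adjcK p q (A : 'M[C]_(p, q)) : adj (adj A) = A.
Proof. by apply/matrixP => i j; rewrite !mxE conjcK. Qed.

Lemma adjc1 p : adj (1%:M : 'M[C]_p) = 1%:M.
Proof. by rewrite /adj map_mx1 trmx1. Qed.

Lemma adjcD p q (A B : 'M[C]_(p, q)) : adj (A + B) = adj A + adj B.
Proof. by apply/matrixP => i j; rewrite !mxE rmorphD. Qed.

Lemma adjcZ p q (x : C) (A : 'M[C]_(p, q)) : adj (x *: A) = conjc x *: adj A.
Proof. by apply/matrixP => i j; rewrite !mxE rmorphM. Qed.

Fact t4_spec X1 X2 X3 X4 : {M : Mat4 | M = (X1 *t X2) *t (X3 *t X4)}.
Proof. by eexists. Qed.
Definition t4 X1 X2 X3 X4 : Mat4 := sval (t4_spec X1 X2 X3 X4).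

Lemma t4_tens X1 X2 X3 X4 : t4 X1 X2 X3 X4 = (X1 *t X2) *t (X3 *t X4).
Proof. exact: svalP (t4_spec X1 X2 X3 X4). Qed.

Lemma t4_mul X1 X2 X3 X4 Y1 Y2 Y3 Y4 :
  t4 X1 X2 X3 X4 *m t4 Y1 Y2 Y3 Y4 = t4 (X1 *m Y1) (X2 *m Y2) (X3 *m Y3) (X4 *m Y4).
Proof. by rewrite !t4_tens !tensmx_mul. Qed.

Lemma t4_tr X1 X2 X3 X4 : \tr (t4 X1 X2 X3 X4) = \tr X1 * \tr X2 * \tr X3 * \tr X4.
Proof. by rewrite !t4_tens !mxtrace_tens mulrA. Qed.

Lemma t4_1 : t4 1%:M 1%:M 1%:M 1%:M = 1%:M.
Proof.
have H p q : (1%:M : 'M[C]_p) *t (1%:M : 'M[C]_q) = 1%:M.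
  apply/matrixP => i j; case: (mxtens_indexP i) => i1 i2; case: (mxtens_indexP j) => j1 j2.
  rewrite tensmxE !mxE -natrM mulnb; congr ((nat_of_bool _)%:R).
  by rewrite (can_eq (@mxtens_indexK _ _)).
by rewrite !t4_tens !H.
Qed.

Lemma t4_adj X1 X2 X3 X4 : adj (t4 X1 X2 X3 X4) = t4 (adj X1) (adj X2) (adj X3) (adj X4).
Proof. by rewrite /adj !t4_tens !map_mxT !trmx_tens. Qed.

Definition idx4 (i1 i2 i3 i4 : 'I_d) : 'I_(d * d * (d * d)) :=
  mxtens_index (mxtens_index (i1, i2), mxtens_index (i3, i4)).

Lemma t4E X1 X2 X3 X4 i1 i2 i3 i4 j1 j2 j3 j4 :
  t4 X1 X2 X3 X4 (idx4 i1 i2 i3 i4) (idx4 j1 j2 j3 j4)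
    = X1 i1 j1 * X2 i2 j2 * X3 i3 j3 * X4 i4 j4.
Proof. by rewrite !t4_tens /idx4 !tensmxE mulrA. Qed.

Lemma mat4P M M' :
  (forall i1 i2 i3 i4 j1 j2 j3 j4, M (idx4 i1 i2 i3 i4) (idx4 j1 j2 j3 j4)
     = M' (idx4 i1 i2 i3 i4) (idx4 j1 j2 j3 j4)) -> M = M'.
Proof.
move=> h; apply/matrixP => i j.
case: (mxtens_indexP i) => i12 i34; case: (mxtens_indexP j) => j12 j34.
case: (mxtens_indexP i12) => i1 i2; case: (mxtens_indexP i34) => i3 i4.
case: (mxtens_indexP j12) => j1 j2; case: (mxtens_indexP j34) => j3 j4.
exact: h.
Qed.

Lemma t4Z x1 x2 x3 x4 X1 X2 X3 X4 :
  t4 (x1 *: X1) (x2 *: X2) (x3 *: X3) (x4 *: X4) = (x1 * x2 * x3 * x4) *: t4 X1 X2 X3 X4.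
Proof. by apply: mat4P => *; rewrite [RHS]mxE !t4E !mxE; ring. Qed.

(** The trace pairing of a kernel with a product operator; second moments of the estimator are
    values of this form. *)
Definition ev M X1 X2 X3 X4 : C := \tr (M *m t4 X1 X2 X3 X4).

Lemma evD M M' X1 X2 X3 X4 : ev (M + M') X1 X2 X3 X4 = ev M X1 X2 X3 X4 + ev M' X1 X2 X3 X4.
Proof. by rewrite /ev mulmxDl mxtraceD. Qed.

Lemma evZ x M X1 X2 X3 X4 : ev (x *: M) X1 X2 X3 X4 = x * ev M X1 X2 X3 X4.
Proof. by rewrite /ev -scalemxAl mxtraceZ. Qed.

Lemma ev_sum I r (p : pred I) (F : I -> Mat4) X1 X2 X3 X4 :
  ev (\sum_(i <- r | p i) F i) X1 X2 X3 X4 = \sum_(i <- r | p i) ev (F i) X1 X2 X3 X4.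
Proof. by rewrite /ev mulmx_suml raddf_sum. Qed.

Lemma ev_t4 M Y1 Y2 Y3 Y4 X1 X2 X3 X4 :
  ev (M *m t4 Y1 Y2 Y3 Y4) X1 X2 X3 X4 = ev M (Y1 *m X1) (Y2 *m X2) (Y3 *m X3) (Y4 *m X4).
Proof. by rewrite /ev -mulmxA t4_mul. Qed.

Lemma ev_t4_base Y1 Y2 Y3 Y4 X1 X2 X3 X4 :
  ev (t4 Y1 Y2 Y3 Y4) X1 X2 X3 X4
    = \tr (Y1 *m X1) * \tr (Y2 *m X2) * \tr (Y3 *m X3) * \tr (Y4 *m X4).
Proof. by rewrite /ev t4_mul t4_tr. Qed.

(** Heisenberg picture: acting on the kernel this way conjugates the arguments by U in the usual
    direction, as [ev_Ad] shows. *)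
Definition Ad U M := adj (t4 U U U U) *m M *m t4 U U U U.

Lemma ev_Ad U M X1 X2 X3 X4 : ev (Ad U M) X1 X2 X3 X4 =
  ev M (U *m X1 *m adj U) (U *m X2 *m adj U) (U *m X3 *m adj U) (U *m X4 *m adj U).
Proof. by rewrite /ev /Ad -!mulmxA mxtrace_mulC -!mulmxA t4_adj !t4_mul !mulmxA. Qed.

Lemma Ad_comp U V M : Ad V (Ad U M) = Ad (U *m V) M.
Proof. by rewrite /Ad -t4_mul adjcM !mulmxA. Qed.

Lemma AdD U M M' : Ad U (M + M') = Ad U M + Ad U M'.
Proof. by rewrite /Ad mulmxDr mulmxDl. Qed.

Lemma AdZ U x M : Ad U (x *: M) = x *: Ad U M.
Proof. by rewrite /Ad -scalemxAr -scalemxAl. Qed.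

Lemma Ad_sum I r (p : pred I) (F : I -> Mat4) U :
  Ad U (\sum_(i <- r | p i) F i) = \sum_(i <- r | p i) Ad U (F i).
Proof. by rewrite /Ad mulmx_sumr mulmx_suml. Qed.

Lemma unitaryC p (U : 'M[C]_p) : adj U *m U = 1%:M -> U *m adj U = 1%:M.
Proof. exact: mulmx1C. Qed.

Lemma t4_unitary U : unitary U -> adj (t4 U U U U) *m t4 U U U U = 1%:M.
Proof. by rewrite /unitary => h; rewrite t4_adj t4_mul h t4_1. Qed.

Lemma Ad_mul U M M' : unitary U -> Ad U (M *m M') = Ad U M *m Ad U M'.
Proof.
move=> /t4_unitary /unitaryC h; rewrite /Ad !mulmxA; congr (_ *m _).
by rewrite -[_ *m t4 U U U U *m _]mulmxA h mulmx1.
Qed.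

Lemma Ad1 U : unitary U -> Ad U 1%:M = 1%:M.
Proof. by move=> h; rewrite /Ad mulmx1 t4_unitary. Qed.

Lemma Ad_t4 U X1 X2 X3 X4 : Ad U (t4 X1 X2 X3 X4) =
  t4 (adj U *m X1 *m U) (adj U *m X2 *m U) (adj U *m X3 *m U) (adj U *m X4 *m U).
Proof. by rewrite /Ad t4_adj !t4_mul. Qed.

Lemma mulE p q r (A : 'M[C]_(p, q)) (B : 'M[C]_(q, r)) i j :
  (A *m B) i j = \sum_k A i k * B k j.
Proof. by rewrite mxE. Qed.

(** Completeness with operators attached on all sides. It yields the trace identities, the
    invariance of the swap, and the rule for moving the swap past a tensor product. *)
Lemma pauli_swap (A B A' B' : Mat) i j k l :
  \sum_v (A *m P v *m A') i j * (B *m P v *m B') k l = D * (A *m B') i l * (B *m A') k j.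
Proof.
pose F i1 i2 i3 i4 v := A i i1 * A' i2 j * (B k i3 * B' i4 l) * (P v i1 i2 * P v i3 i4).
transitivity (\sum_v \sum_i1 \sum_i2 \sum_i3 \sum_i4 F i1 i2 i3 i4 v).
  apply: eq_bigr => v _; rewrite mulE mulr_suml exchange_big /=.
  apply: eq_bigr => i2 _; rewrite mulE !mulr_suml; apply: eq_bigr => i1 _.
  rewrite mulE mulr_sumr exchange_big; apply: eq_bigr => i4 _ /=.
  rewrite mulE mulr_suml mulr_sumr; apply: eq_bigr => i3 _; rewrite /F; ring.
rewrite exchange_big [(A *m B') i l]mulE mulr_sumr mulr_suml /=; apply: eq_bigr => i1 _.
rewrite exchange_big [(B *m A') k j]mulE mulr_sumr /=.
under eq_bigr => i2 _ do [rewrite exchange_big; under eq_bigr => i3 _ do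
  [rewrite exchange_big; under eq_bigr => i4 _ do rewrite -mulr_sumr pauli_complete]].
apply: eq_bigr => i2 _.
rewrite (bigD1 i2) //= (bigD1 i1) //= !eqxx !big1 ?addr0 => [|i3 hi|i4 hi]; first by rewrite !mulr1; ring.
- by apply: big1 => i4 _; rewrite [i2 == _]eq_sym (negbTE hi) !mulr0.
- by rewrite [i1 == _]eq_sym (negbTE hi) mulr0 mul0r mulr0.
Qed.

Lemma sum_tr_pauli2 X Y : \sum_v \tr (P v *m X) * \tr (P v *m Y) = D * \tr (X *m Y).
Proof.
transitivity (\sum_i \sum_k \sum_v (1%:M *m P v *m X) i i * (1%:M *m P v *m Y) k k).
  under eq_bigr => v _ do rewrite mulr_suml; rewrite exchange_big; apply: eq_bigr => i _.
  under eq_bigr => v _ do rewrite mulr_sumr; rewrite exchange_big; apply: eq_bigr => k _.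
  by apply: eq_bigr => v _; rewrite !mul1mx.
rewrite mxtrace_mulC [in RHS]/mxtrace mulr_sumr; apply: eq_bigr => i _.
rewrite [(Y *m X) i i]mulE mulr_sumr; apply: eq_bigr => k _.
by rewrite pauli_swap !mul1mx -mulrA.
Qed.

(** The average over Pauli conjugations is the completely depolarizing map. *)
Lemma sum_tr_pauli11 X Y : \sum_v \tr (P v *m X *m P v *m Y) = D * \tr X * \tr Y.
Proof.
transitivity (\sum_i \sum_k \sum_v (1%:M *m P v *m X) i k * (1%:M *m P v *m Y) k i).
  under eq_bigr => v _ do rewrite /mxtrace; rewrite exchange_big; apply: eq_bigr => i _.
  rewrite exchange_big; apply: eq_bigr => v _ /=.
  by rewrite -mulmxA mulE; apply: eq_bigr => k _; rewrite !mul1mx.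
rewrite [\tr X]/mxtrace -mulrA mulr_suml mulr_sumr exchange_big; apply: eq_bigr => k _ /=.
rewrite [\tr Y]/mxtrace !mulr_sumr; apply: eq_bigr => i _.
by rewrite pauli_swap !mul1mx; ring.
Qed.

(** The swap commutes with U tensor U for every unitary, Clifford or not; hence permutations of
    copies also survive T layers. *)
Lemma pauli_swapU U i j k l : unitary U ->
  \sum_v (adj U *m P v *m U) i j * (adj U *m P v *m U) k l = \sum_v P v i j * P v k l.
Proof. by move=> h; rewrite pauli_swap h pauli_complete !mxE [k == j]eq_sym. Qed.

Fact p4_spec a : {M : Mat4 | M = t4 (P a) (P a) (P a) (P a)}.
Proof. by eexists. Qed.
Definition p4 a : Mat4 := sval (p4_spec a).
Fact p12_spec b : {M : Mat4 | M = t4 (P b) (P b) 1%:M 1%:M}.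
Proof. by eexists. Qed.
Definition p12 b : Mat4 := sval (p12_spec b).
Fact p13_spec b : {M : Mat4 | M = t4 (P b) 1%:M (P b) 1%:M}.
Proof. by eexists. Qed.
Definition p13 b : Mat4 := sval (p13_spec b).
Fact p23_spec b : {M : Mat4 | M = t4 1%:M (P b) (P b) 1%:M}.
Proof. by eexists. Qed.
Definition p23 b : Mat4 := sval (p23_spec b).

Lemma p4E a : p4 a = t4 (P a) (P a) (P a) (P a). Proof. exact: svalP (p4_spec a). Qed.
Lemma p12E b : p12 b = t4 (P b) (P b) 1%:M 1%:M. Proof. exact: svalP (p12_spec b). Qed.
Lemma p13E b : p13 b = t4 (P b) 1%:M (P b) 1%:M. Proof. exact: svalP (p13_spec b). Qed.
Lemma p23E b : p23 b = t4 1%:M (P b) (P b) 1%:M. Proof. exact: svalP (p23_spec b). Qed.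

Let t4Z13 x y X1 X2 X3 X4 : t4 (x *: X1) X2 (y *: X3) X4 = (x * y) *: t4 X1 X2 X3 X4.
Proof. by apply: mat4P => *; rewrite [RHS]mxE !t4E !mxE; ring. Qed.
Let t4Z23 x y X1 X2 X3 X4 : t4 X1 (x *: X2) (y *: X3) X4 = (x * y) *: t4 X1 X2 X3 X4.
Proof. by apply: mat4P => *; rewrite [RHS]mxE !t4E !mxE; ring. Qed.

Lemma p13M a b : p13 a *m p13 b = chi a b *: p13 (a + b).
Proof. by rewrite !p13E t4_mul !pauli_mul !mulmx1 t4Z13 kap_sqr. Qed.
Lemma p23M a b : p23 a *m p23 b = chi a b *: p23 (a + b).
Proof. by rewrite !p23E t4_mul !pauli_mul !mulmx1 t4Z23 kap_sqr. Qed.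
Lemma p23_13 c b : p23 c *m p13 b = chi c b *: (p13 b *m p23 c).
Proof.
rewrite !p13E !p23E !t4_mul !mulmx1 !mul1mx (pauli_comm R c b).
by apply: mat4P => *; rewrite [RHS]mxE !t4E [in LHS]mxE; ring.
Qed.
Lemma p13_23 b : p13 b *m p23 b = p12 b.
Proof. by rewrite !p13E !p23E p12E !t4_mul !mulmx1 !mul1mx pauli_sqr. Qed.

Lemma p4_0 : p4 0 = 1%:M. Proof. by rewrite !p4E pauli_vec0 t4_1. Qed.
Lemma p12_0 : p12 0 = 1%:M. Proof. by rewrite !p12E pauli_vec0 t4_1. Qed.
Lemma p13_0 : p13 0 = 1%:M. Proof. by rewrite !p13E pauli_vec0 t4_1. Qed.
Lemma p23_0 : p23 0 = 1%:M. Proof. by rewrite !p23E pauli_vec0 t4_1. Qed.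

Lemma sumt4E (F1 F2 F3 F4 : vec -> Mat) i1 i2 i3 i4 j1 j2 j3 j4 :
  (\sum_v t4 (F1 v) (F2 v) (F3 v) (F4 v)) (idx4 i1 i2 i3 i4) (idx4 j1 j2 j3 j4)
  = \sum_v F1 v i1 j1 * F2 v i2 j2 * F3 v i3 j3 * F4 v i4 j4.
Proof. by rewrite summxE; apply: eq_bigr => v _; rewrite t4E. Qed.

End FourCopies.

(** * Sector operators and the group S_4 *)

Section Sectors.
Variables (F : numFieldType) (V : finZmodType) (N : nat).
Variables (chi : V -> V -> F) (D : F) (p4 p13 p23 : V -> 'M[F]_N).
Implicit Types (M : 'M[F]_N) (u v w a b c e : V).
Hypothesis D_neq0 : D != 0.
Hypothesis addvecc : forall v, v + v = 0.
Hypothesis chiC : forall v w, chi v w = chi w v.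
Hypothesis chiDr : forall w u v, chi w (u + v) = chi w u * chi w v.
Hypothesis chi_sqr : forall v w, chi v w * chi v w = 1.
Hypothesis chivv : forall v, chi v v = 1.
Hypothesis sum_chi : forall b, \sum_u chi u b = (D * D) *+ (b == 0).
Hypothesis p4_0 : p4 0 = 1%:M.
Hypothesis p13_0 : p13 0 = 1%:M.
Hypothesis p23_0 : p23 0 = 1%:M.
Hypothesis p13M : forall a b, p13 a *m p13 b = chi a b *: p13 (a + b).
Hypothesis p23M : forall a b, p23 a *m p23 b = chi a b *: p23 (a + b).
Hypothesis p23_13 : forall c b, p23 c *m p13 b = chi c b *: (p13 b *m p23 c).

Let chiDl u v w : chi (u + v) w = chi u w * chi v w.
Proof. by rewrite chiC chiDr !(chiC w). Qed.
Let chi0v v : chi 0 v = 1.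
Proof. by rewrite -(addvecc v) chiDl chivv mulr1. Qed.
Let chiv0 v : chi v 0 = 1. Proof. by rewrite chiC chi0v. Qed.
Let addKvec v w : v + (v + w) = w. Proof. by rewrite addrA addvecc add0r. Qed.

(** In the application the two Pauli factors on copy 3 cancel, which leaves the pair on copies 1 and
    2. *)
Definition pp12 b := p13 b *m p23 b.
Definition sw12 := D^-1 *: \sum_b pp12 b.
Definition sw13 := D^-1 *: \sum_b p13 b.
Definition sw23 := D^-1 *: \sum_b p23 b.

(* In the application p4 a is a fourfold tensor power of a Pauli operator and
   sproj u projects onto the joint eigenspace where each p4 a equals chi a u. *)
Definition sproj u := (D * D)^-1 *: \sum_a chi a u *: p4 a.
(** The spanning set of the whole computation: a T layer produces these operators with strings of Z,
    and right multiplication by a transposition of the first three copies stays in their span, with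
    signs given by chi. *)
Definition sect u b c := sproj u *m p13 b *m p23 c.

Lemma sect_000 : sect 0 0 0 = sproj 0.
Proof. by rewrite /sect p13_0 p23_0 !mulmx1. Qed.

Lemma sect_p13 u b c e : sect u b c *m p13 e = chi (b + c) e *: sect u (b + e) c.
Proof.
rewrite /sect -mulmxA p23_13 -scalemxAr mulmxA -[_ *m p13 b *m p13 e]mulmxA p13M.
by rewrite -scalemxAr -scalemxAl scalerA -chiDl (addrC c).
Qed.

Lemma sect_p23 u b c e : sect u b c *m p23 e = chi c e *: sect u b (c + e).
Proof. by rewrite /sect -mulmxA p23M -scalemxAr. Qed.

Lemma sect_p12 u b c e : sect u b c *m pp12 e = chi b e *: sect u (b + e) (c + e).
Proof.
rewrite /pp12 mulmxA sect_p13 -scalemxAl sect_p23 scalerA chiDl -mulrA chi_sqr mulr1 //.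
Qed.

Lemma sect_s13 u b c : sect u b c *m sw13 = D^-1 *: \sum_e chi (b + c) (e + b) *: sect u e c.
Proof.
rewrite -scalemxAr mulmx_sumr (reindex_inj (addrI b)); congr (_ *: _).
by apply: eq_bigr => e _; rewrite sect_p13 addKvec (addrC e).
Qed.

Lemma sect_s23 u b c : sect u b c *m sw23 = D^-1 *: \sum_e chi c e *: sect u b e.
Proof.
rewrite -scalemxAr mulmx_sumr (reindex_inj (addrI c)); congr (_ *: _).
by apply: eq_bigr => e _; rewrite sect_p23 addKvec chiDr chivv mul1r.
Qed.

Lemma sect_s12 u b c : sect u b c *m sw12 = D^-1 *: \sum_e chi b e *: sect u (b + e) (c + e).
Proof.
by rewrite -scalemxAr mulmx_sumr; congr (_ *: _); apply: eq_bigr => e _; rewrite sect_p12.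
Qed.

(** The Klein four-group in sector coordinates: by [klein4_perms] the four sums are 1, (13)(24),
    (14)(23) and (12)(34). *)
Definition klein4 := \sum_u (sect u 0 0 + sect u u 0 + sect u 0 u + sect u u u).

Lemma klein4_s13 : klein4 *m sw13 = D^-1 *: \sum_u \sum_b (1 + chi u b) *: (sect u b 0 + sect u b u).
Proof.
rewrite mulmx_suml scaler_sumr; apply: eq_bigr => u _.
rewrite !mulmxDl !sect_s13 !addr0 !add0r !addvecc -!scalerDr -!big_split; congr (_ *: _).
apply: eq_bigr => e _ /=; rewrite !chi0v chiDr chivv mulr1 !scale1r scalerDl !scalerDr !scale1r.
by rewrite addr0 -!addrA; congr (_ + _); rewrite [RHS]addrC -addrA.
Qed.

Lemma klein4_s23 : klein4 *m sw23 = D^-1 *: \sum_u \sum_c (1 + chi u c) *: (sect u 0 c + sect u u c).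
Proof.
rewrite mulmx_suml scaler_sumr; apply: eq_bigr => u _.
rewrite !mulmxDl !sect_s23 -!scalerDr -!big_split; congr (_ *: _).
apply: eq_bigr => e _ /=; rewrite !chi0v !scale1r scalerDl !scalerDr !scale1r.
by rewrite -!addrA.
Qed.

Lemma klein4_s12 : klein4 *m sw12 = D^-1 *: \sum_u \sum_b (1 + chi u b) *: (sect u b b + sect u (u + b) b).
Proof.
rewrite mulmx_suml scaler_sumr; apply: eq_bigr => u _.
rewrite !mulmxDl !sect_s12 -!scalerDr; congr (_ *: _).
rewrite [X in _ + _ + X + _](reindex_inj (addrI u)) [X in _ + X](reindex_inj (addrI u)).
rewrite -!big_split.
apply: eq_bigr => e _ /=; rewrite !chi0v !chiDr !chivv !mul1r !scale1r !add0r !addKvec.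
rewrite scalerDl !scalerDr !scale1r -!addrA; congr (_ + _).
by rewrite addrC -addrA.
Qed.

(** One 3-cycle gives (1 + chi u b)(1 + chi u c), the other the same times chi b c. Only their sum
    has a weight that vanishes off the pairwise commuting triples, where it is 8. *)
Lemma klein4_cycles : klein4 *m (sw13 *m sw23 + sw23 *m sw13) = (D * D)^-1 *:
  \sum_u \sum_b \sum_c ((1 + chi u b) * (1 + chi u c) * (1 + chi b c)) *: sect u b c.
Proof.
have E1 u b x : (x *: (sect u b 0 + sect u b u)) *m sw23
    = D^-1 *: \sum_c (x * (1 + chi u c)) *: sect u b c.
  rewrite -scalemxAl mulmxDl !sect_s23 -scalerDr -big_split /= scalerA mulrC -scalerA scaler_sumr.
  by congr (_ *: _); apply: eq_bigr => c _; rewrite chi0v scale1r -scalerA scalerDl scale1r.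
have E2 u c x : (x *: (sect u 0 c + sect u u c)) *m sw13
    = D^-1 *: \sum_b (x * (chi b c * (1 + chi u b * chi u c))) *: sect u b c.
  rewrite -scalemxAl mulmxDl !sect_s13 -!scalerDr -!big_split /= scalerA mulrC -scalerA scaler_sumr.
  congr (_ *: _); apply: eq_bigr => b _; rewrite -!scalerDl scalerA; congr (_ *: _).
  rewrite add0r addr0 !(chiDl, chiDr) chivv (chiC c b) (chiC c u); ring.
rewrite mulmxDr !mulmxA klein4_s13 klein4_s23 -!scalemxAl !mulmx_suml -scalerDr invfM -scalerA.
congr (_ *: _); rewrite -big_split scaler_sumr; apply: eq_bigr => u _ /=.
rewrite !mulmx_suml (eq_bigr _ (fun b _ => E1 u b _)) (eq_bigr _ (fun c _ => E2 u c _)).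
rewrite -!scaler_sumr -!scalerDr; congr (_ *: _).
rewrite [X in _ + X]exchange_big -!big_split; apply: eq_bigr => b _ /=.
rewrite -!big_split; apply: eq_bigr => c _ /=.
rewrite -!scalerDl; congr (_ *: _).
have h := chi_sqr u c; move: (chi u b) (chi b c) h; move: (chi u c) => z y t h.
have -> : (1 + z) * (t * (1 + y * z)) = t * (1 + z + y * z + y * (z * z)) by ring.
by rewrite h; ring.
Qed.

Let addvec_eq0 v w : (v + w == 0) = (w == v).
Proof.
apply/eqP/eqP => [h|->]; last exact: addvecc.
by rewrite -[w]add0r -(addvecc v) -addrA h addr0.
Qed.

Notation N2 := (D * D).
Notation dl b c := ((b == c)%:R : F).

Lemma sum_dl b (f : V -> F) : \sum_c dl c b * f c = f b.
Proof.
rewrite (bigD1 b) //= eqxx mul1r big1 ?addr0 // => c /negbTE ->.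
by rewrite mul0r.
Qed.

Lemma sum_dl1 b : \sum_c dl c b = 1.
Proof. by rewrite -[RHS](sum_dl b (fun=> 1)); apply: eq_bigr => c _; rewrite mulr1. Qed.

Lemma sum_one : \sum_(u : V) (1 : F) = N2.
Proof. by have := sum_chi 0; rewrite eqxx mulr1n => <-; apply: eq_bigr => u _; rewrite chiv0. Qed.

Lemma sum_const (x : F) : \sum_(u : V) x = N2 * x.
Proof. by rewrite -sum_one mulr_suml; apply: eq_bigr => u _; rewrite mul1r. Qed.

Lemma sum_1chi u : u != 0 -> \sum_b (1 + chi u b) = N2.
Proof.
move=> /negbTE hu; rewrite big_split /= sum_one (eq_bigr (fun b => chi b u)) => [|b _]; last exact: chiC.
by rewrite sum_chi hu mulr0n addr0.
Qed.

Lemma chi_pm v w : chi v w = 1 \/ chi v w = -1.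
Proof.
have /eqP := chi_sqr v w; rewrite -expr2 sqrf_eq1 => /orP [] /eqP ->; by [left|right].
Qed.

(** Under such a weight an identity has to be checked on commuting labels only, where the class
    values are known. *)
Lemma half_chi v w (x y : F) : (chi v w = 1 -> x = y) -> (1 + chi v w) * x = (1 + chi v w) * y.
Proof. by case: (chi_pm v w) => ->; [move=> ->|rewrite subrr !mul0r]. Qed.

Lemma sum_split0 (f : V -> F) x : (forall u, u != 0 -> f u = x) -> \sum_u f u = f 0 + (N2 - 1) * x.
Proof.
move=> h; rewrite (bigD1 0) //=; congr (_ + _).
rewrite (eq_bigr (fun=> x)) => [|u]; last exact: h.
have := sum_const x; rewrite (bigD1 0) //= => /(canRL (addKr _)) ->; ring.
Qed.

Section ClassSums.
Variables (t : V -> V -> V -> F) (a0 ab ac abc a2 : F).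
Variables (c00 cu0 c0u cuu d0 du e0 eu f0 fu c2 : F).
(** A function of the linear relations among the labels, interpolated by indicators: a2 is the
    generic value, ab, ac, abc belong to the lines c = 0, b = 0, c = b, and a0 to the origin. In
    [tY] the generic value is c2, the d's, e's and f's belong to six lines, and c00, cu0, c0u, cuu
    to the four points in which the lines meet, three at a time. *)
Hypothesis tX : forall b c, chi b c = 1 -> t 0 b c =
  a2 + (ab - a2) * dl c 0 + (ac - a2) * dl b 0 + (abc - a2) * dl c b
  + (a0 - ab - ac - abc + a2 + a2) * (dl b 0 * dl c 0).
Hypothesis tY : forall u b c, u != 0 -> chi u b = 1 -> chi u c = 1 -> chi b c = 1 ->
  t u b c = c2 + (d0 - c2) * dl c 0 + (du - c2) * dl c u + (e0 - c2) * dl b 0 + (eu - c2) * dl b u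
  + (f0 - c2) * dl c b + (fu - c2) * dl c (b + u)
  + (c00 - d0 - e0 - f0 + c2 + c2) * (dl b 0 * dl c 0)
  + (cu0 - d0 - eu - fu + c2 + c2) * (dl b u * dl c 0)
  + (c0u - du - e0 - fu + c2 + c2) * (dl b 0 * dl c u)
  + (cuu - du - eu - f0 + c2 + c2) * (dl b u * dl c u).

Let c6 := d0 + du + e0 + eu + f0 + fu.
Let c4 := c00 + cu0 + c0u + cuu.

Lemma sum_t0b0 : \sum_b t 0 b 0 = a0 + (N2 - 1) * ab.
Proof.
rewrite (eq_bigr (fun b => ab + (a0 - ab) * dl b 0)) => [|b _].
  by rewrite big_split /= sum_const -mulr_sumr sum_dl1; ring.
by rewrite tX ?chiv0 // eqxx (eq_sym 0 b); case: eqP => _ /=; ring.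
Qed.

Lemma sum_t00c : \sum_c t 0 0 c = a0 + (N2 - 1) * ac.
Proof.
rewrite (eq_bigr (fun b => ac + (a0 - ac) * dl b 0)) => [|b _].
  by rewrite big_split /= sum_const -mulr_sumr sum_dl1; ring.
by rewrite tX ?chi0v // eqxx; case: eqP => _ /=; ring.
Qed.

Lemma sum_t0bb : \sum_b t 0 b b = a0 + (N2 - 1) * abc.
Proof.
rewrite (eq_bigr (fun b => abc + (a0 - abc) * dl b 0)) => [|b _].
  by rewrite big_split /= sum_const -mulr_sumr sum_dl1; ring.
by rewrite tX ?chivv // eqxx; case: eqP => _ /=; ring.
Qed.

(** Each of the N2 - 1 nonzero b commutes with N2/2 labels, of which 0 and b are special; the weight
    2 turns N2/2 - 2 into N2 - 4. *)
Lemma sum_t0bc : \sum_b \sum_c (1 + chi b c) * t 0 b c =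
  2 * a0 + 2 * (N2 - 1) * (ab + ac + abc) + (N2 - 1) * (N2 - 4) * a2.
Proof.
pose k := a0 - ab - ac - abc + a2 + a2.
have E b : \sum_c (1 + chi b c) * t 0 b c =
    a2 * (N2 + N2 * dl b 0) + (ab - a2) * 2 + (ac - a2) * (dl b 0 * (N2 + N2 * dl b 0))
    + (abc - a2) * 2 + k * 2 * dl b 0.
  rewrite (eq_bigr (fun c => a2 * (1 + chi b c) + (ab - a2) * (dl c 0 * (1 + chi b c))
    + (ac - a2) * (dl b 0 * (1 + chi b c)) + (abc - a2) * (dl c b * (1 + chi b c))
    + k * (dl b 0 * (dl c 0 * (1 + chi b c))))) => [|c _].
    rewrite !big_split /= -!mulr_sumr !sum_dl chiv0 chivv.
    have -> : \sum_c (1 + chi b c) = N2 + N2 * dl b 0.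
      case: (eqVneq b 0) => [->|hb]; last by rewrite sum_1chi // mulr0 addr0.
      by rewrite (eq_bigr (fun=> 1 + 1)) ?sum_const => [|c _]; [rewrite mulr1; ring|rewrite chi0v].
    by rewrite /k; ring.
  transitivity ((1 + chi b c) * (a2 + (ab - a2) * dl c 0 + (ac - a2) * dl b 0 + (abc - a2) * dl c b
    + k * (dl b 0 * dl c 0))); last by ring.
  by apply: half_chi => h; rewrite tX.
rewrite (eq_bigr _ (fun b _ => E b)).
rewrite (eq_bigr (fun b => (a2 * N2 + (ab - a2) * 2 + (abc - a2) * 2)
  + (a2 * N2 + (ac - a2) * (N2 + N2) + k * 2) * dl b 0)) => [|b _].
  by rewrite big_split /= sum_const -mulr_sumr sum_dl1 /k; ring.
by case: eqP => _ /=; ring.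
Qed.

Lemma sum_tu4 u : u != 0 -> t u 0 0 + t u u 0 + t u 0 u + t u u u = c4.
Proof.
move=> hu; rewrite !tY ?chi0v ?chiv0 ?chivv // !addvecc !add0r !eqxx (eq_sym 0 u) (negbTE hu).
by rewrite /c4 /=; ring.
Qed.

(** Half of all labels commute with u, and 0 and u are among them; the weight is 2. *)
Let line u (d x y : F) (f : V -> F) : u != 0 ->
  (forall b, chi u b = 1 -> f b = d + (x - d) * dl b 0 + (y - d) * dl b u) ->
  \sum_b (1 + chi u b) * f b = (N2 - 4) * d + 2 * (x + y).
Proof.
move=> hu hf.
rewrite (eq_bigr (fun b => d * (1 + chi u b) + (x - d) * (dl b 0 * (1 + chi u b))
  + (y - d) * (dl b u * (1 + chi u b)))) => [|b _].
  by rewrite !big_split /= -!mulr_sumr !sum_dl sum_1chi // chiv0 chivv; ring.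
by rewrite (half_chi (hf b)); ring.
Qed.

(** The six terms are the six lines. Each of the four points lies on three of them and is counted
    with weight 2, hence 6. *)
Lemma sum_tu_lines u : u != 0 ->
  \sum_b (1 + chi u b) * (t u b 0 + t u b u + t u 0 b + t u u b + t u b b + t u (u + b) b)
   = (N2 - 4) * c6 + 6 * c4.
Proof.
move=> hu; have hu' : (0 == u) = false by rewrite eq_sym (negbTE hu).
have duu b : (u + b == 0) = (b == u) by rewrite addvec_eq0.
have dub b : (u + b == u) = (b == 0) by rewrite -{2}[u]addr0 (inj_eq (addrI u)).
have dbu b : (0 == b + u) = (b == u) by rewrite eq_sym addrC duu.
have dbu' b : (u == b + u) = (b == 0) by rewrite eq_sym addrC dub.
have dbb b : (b == b + u) = false by rewrite -{1}[b]addr0 (inj_eq (addrI b)) hu'.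
have dbub b : (b == u + b) = false by rewrite addrC dbb.
have ubu b : u + b + u = b by rewrite addrC addrA addvecc add0r.
under eq_bigr => b _ do rewrite !mulrDr.
rewrite !big_split /=.
rewrite (line (d := d0) (x := c00) (y := cu0) hu) => [|b hb]; last first.
  rewrite tY ?chiv0 // eqxx !hu' (eq_sym 0 b) dbu; case: (eqVneq b 0) => [->|_]; rewrite ?hu' /=; last case: eqP => _ /=; ring.
rewrite (line (d := du) (x := c0u) (y := cuu) hu) => [|b hb]; last first.
  rewrite tY ?chivv // ?[chi b u]chiC // eqxx (negbTE hu) (eq_sym u b) dbu'.
  case: (eqVneq b 0) => [->|_]; rewrite ?hu' /=; last case: eqP => _ /=; ring.
rewrite (line (d := e0) (x := c00) (y := c0u) hu) => [|b hb]; last first.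
  rewrite tY ?chi0v ?chiv0 // eqxx hu' add0r; case: (eqVneq b 0) => [->|_]; rewrite ?hu' /=; last case: eqP => _ /=; ring.
rewrite (line (d := eu) (x := cu0) (y := cuu) hu) => [|b hb]; last first.
  rewrite tY ?chivv // eqxx (negbTE hu) addvecc; case: (eqVneq b 0) => [->|_]; rewrite ?hu' /=; last case: eqP => _ /=; ring.
rewrite (line (d := f0) (x := c00) (y := cuu) hu) => [|b hb]; last first.
  rewrite tY ?chivv // eqxx dbb; case: (eqVneq b 0) => [->|_]; rewrite ?hu' /=; last case: eqP => _ /=; ring.
rewrite (line (d := fu) (x := cu0) (y := c0u) hu) => [|b hb]; last first.
  rewrite tY ?chiDr ?chiDl ?chivv ?mul1r ?hb ?mulr1 // duu dub ubu eqxx dbub.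
  case: (eqVneq b 0) => [->|_]; rewrite ?hu' /=; last case: eqP => _ /=; ring.
by rewrite /c6 /c4; ring.
Qed.

(** With weight 8 on commuting triples there remain N2/2 - 2 choices of b outside {0, u} and N2/4 -
    4 choices of c outside the span of u and b, which gives (N2 - 4)(N2 - 16). *)
Lemma sum_tu_all u : u != 0 ->
  \sum_b \sum_c ((1 + chi u b) * (1 + chi u c) * (1 + chi b c)) * t u b c
   = (N2 - 4) * (N2 - 16) * c2 + 4 * (N2 - 4) * c6 + 8 * c4.
Proof.
move=> hu.
pose W b c := (1 + chi u b) * (1 + chi u c) * (1 + chi b c).
have sq b : (1 + chi u b) * (1 + chi u b) = 2 * (1 + chi u b).
  by have h := chi_sqr u b; rewrite mulrDl mul1r mulrDr mulr1 h; ring.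
have duu b : dl (b + u) 0 = dl b u by rewrite addrC addvec_eq0.
have sum_chi' b : \sum_c chi b c = N2 * dl b 0.
  by rewrite (eq_bigr (fun c => chi c b)) ?sum_chi ?mulr_natr // => c _; rewrite chiC.
have W1 b : \sum_c W b c = (1 + chi u b) * (N2 + N2 * dl b 0 + N2 * dl b u).
  rewrite (eq_bigr (fun c => (1 + chi u b) * (1 + chi u c + chi b c + chi (b + u) c))) => [|c _]; last first.
    by rewrite /W chiDl; ring.
  by rewrite -mulr_sumr !big_split /= !sum_chi' sum_one (negbTE hu) duu /=; ring.
have W0 b : W b 0 = 4 * (1 + chi u b) by rewrite /W !chiv0; ring.
have Wu b : W b u = 4 * (1 + chi u b).
  by rewrite /W chivv (chiC b u) -mulrA (mulrC (1 + 1)) mulrA sq; ring.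
have Wb b : W b b = 4 * (1 + chi u b) by rewrite /W chivv sq; ring.
have Wbu b : W b (b + u) = 4 * (1 + chi u b).
  by rewrite /W !chiDr !chivv mulr1 mul1r (chiC b u) sq -mulrA sq; ring.
have E b : \sum_c W b c * t u b c =
    c2 * ((1 + chi u b) * (N2 + N2 * dl b 0 + N2 * dl b u)) + ((d0 - c2) + (du - c2) + (f0 - c2) + (fu - c2)) * (4 * (1 + chi u b))
    + (e0 - c2) * (dl b 0 * ((1 + chi u b) * (N2 + N2 * dl b 0 + N2 * dl b u)))
    + (eu - c2) * (dl b u * ((1 + chi u b) * (N2 + N2 * dl b 0 + N2 * dl b u)))
    + ((c00 - d0 - e0 - f0 + c2 + c2) + (c0u - du - e0 - fu + c2 + c2)) * (dl b 0 * (4 * (1 + chi u b)))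
    + ((cu0 - d0 - eu - fu + c2 + c2) + (cuu - du - eu - f0 + c2 + c2)) * (dl b u * (4 * (1 + chi u b))).
  rewrite (eq_bigr (fun c => c2 * W b c + (d0 - c2) * (dl c 0 * W b c) + (du - c2) * (dl c u * W b c)
    + (e0 - c2) * (dl b 0 * W b c) + (eu - c2) * (dl b u * W b c) + (f0 - c2) * (dl c b * W b c)
    + (fu - c2) * (dl c (b + u) * W b c)
    + (c00 - d0 - e0 - f0 + c2 + c2) * (dl b 0 * (dl c 0 * W b c))
    + (cu0 - d0 - eu - fu + c2 + c2) * (dl b u * (dl c 0 * W b c))
    + (c0u - du - e0 - fu + c2 + c2) * (dl b 0 * (dl c u * W b c))
    + (cuu - du - eu - f0 + c2 + c2) * (dl b u * (dl c u * W b c)))) => [|c _].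
    by rewrite !big_split /= -!mulr_sumr !sum_dl W1 W0 Wu Wb Wbu; ring.
  transitivity (W b c * (c2 + (d0 - c2) * dl c 0 + (du - c2) * dl c u + (e0 - c2) * dl b 0 + (eu - c2) * dl b u
  + (f0 - c2) * dl c b + (fu - c2) * dl c (b + u)
  + (c00 - d0 - e0 - f0 + c2 + c2) * (dl b 0 * dl c 0)
  + (cu0 - d0 - eu - fu + c2 + c2) * (dl b u * dl c 0)
  + (c0u - du - e0 - fu + c2 + c2) * (dl b 0 * dl c u)
  + (cuu - du - eu - f0 + c2 + c2) * (dl b u * dl c u))); last by ring.
  rewrite /W -[LHS]mulrA -[RHS]mulrA -[LHS]mulrA -[RHS]mulrA.
  by apply: half_chi => h1; apply: half_chi => h2; apply: half_chi => h3; exact: tY.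
rewrite (eq_bigr _ (fun b _ => E b)).
pose G := (c2 * N2 + ((d0 - c2) + (du - c2) + (f0 - c2) + (fu - c2)) * 4).
pose G0 := c2 * N2 + (e0 - c2) * (N2 + N2) + ((c00 - d0 - e0 - f0 + c2 + c2) + (c0u - du - e0 - fu + c2 + c2)) * 4.
pose G1 := c2 * N2 + (eu - c2) * (N2 + N2) + ((cu0 - d0 - eu - fu + c2 + c2) + (cuu - du - eu - f0 + c2 + c2)) * 4.
rewrite (eq_bigr (fun b => G * (1 + chi u b) + G0 * (dl b 0 * (1 + chi u b)) + G1 * (dl b u * (1 + chi u b)))) => [|b _].
  rewrite !big_split /= -!mulr_sumr !sum_dl sum_1chi // chiv0 chivv /G /G0 /G1 /c6 /c4; ring.
rewrite /G /G0 /G1; case: (eqVneq b 0) => [->|_]; rewrite ?(eq_sym 0 u) ?(negbTE hu) /=; last case: eqP => _ /=; ring.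
Qed.

End ClassSums.

Section SectorSum.
Notation Pi := (sproj 0).
Notation tra := (sw12 + sw13 + sw23).
Notation cyc := (sw13 *m sw23 + sw23 *m sw13).

(** In the application L is a matrix entry of the twirl, so its values on sector operators are class
    functions. *)
Variable L : 'M[F]_N -> F.
Hypothesis LD : forall M M', L (M + M') = L M + L M'.
Hypothesis LZ : forall x M, L (x *: M) = x * L M.

Let L_sum (I : finType) (f : I -> 'M[F]_N) : L (\sum_i f i) = \sum_i L (f i).
Proof. by apply: (big_morph _ LD); have := LZ 0 0; rewrite scale0r mul0r. Qed.

Let t u b c := L (sect u b c).

Variables (ab ac abc a2 c00 cu0 c0u cuu d0 du e0 eu f0 fu c2 : F).
Let a0 := t 0 0 0.
Hypothesis tX : forall b c, chi b c = 1 -> t 0 b c =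
  a2 + (ab - a2) * dl c 0 + (ac - a2) * dl b 0 + (abc - a2) * dl c b
  + (a0 - ab - ac - abc + a2 + a2) * (dl b 0 * dl c 0).
Hypothesis tY : forall u b c, u != 0 -> chi u b = 1 -> chi u c = 1 -> chi b c = 1 ->
  t u b c = c2 + (d0 - c2) * dl c 0 + (du - c2) * dl c u + (e0 - c2) * dl b 0 + (eu - c2) * dl b u
  + (f0 - c2) * dl c b + (fu - c2) * dl c (b + u)
  + (c00 - d0 - e0 - f0 + c2 + c2) * (dl b 0 * dl c 0)
  + (cu0 - d0 - eu - fu + c2 + c2) * (dl b u * dl c 0)
  + (c0u - du - e0 - fu + c2 + c2) * (dl b 0 * dl c u)
  + (cuu - du - eu - f0 + c2 + c2) * (dl b u * dl c u).

Let c6 := d0 + du + e0 + eu + f0 + fu.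
Let c4 := c00 + cu0 + c0u + cuu.
Let a3 := ab + ac + abc.

Lemma L_Pi : L Pi = a0. Proof. by rewrite -(sect_000). Qed.

Lemma L_Pi_tra : L (Pi *m tra) = D^-1 * (3 * a0 + (N2 - 1) * a3).
Proof.
rewrite -(sect_000) !mulmxDr.
rewrite (sect_s12) (sect_s13) (sect_s23).
rewrite !LD !LZ !L_sum.
transitivity (D^-1 * (\sum_e t 0 e e) + D^-1 * (\sum_e t 0 e 0) + D^-1 * (\sum_e t 0 0 e)).
  congr (_ * _ + _ * _ + _ * _); apply: eq_bigr => e _.
  - by rewrite chi0v scale1r !add0r.
  - by rewrite !addr0 chi0v scale1r.
  - by rewrite chi0v scale1r.
rewrite (sum_t0bb tX) (sum_t0b0 tX).
by rewrite (sum_t00c tX) /a3; ring.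
Qed.

Lemma L_Pi_cyc : L (Pi *m cyc) = N2^-1 * (2 * a0 + 2 * (N2 - 1) * a3 + (N2 - 1) * (N2 - 4) * a2).
Proof.
rewrite -(sum_t0bc tX) -(sect_000).
rewrite mulmxDr !mulmxA (sect_s13) (sect_s23).
rewrite LD -!scalemxAl !LZ !mulmx_suml !L_sum -mulrDr invfM -mulrA; congr (_ * _).
transitivity (\sum_b D^-1 * \sum_c t 0 b c + \sum_c D^-1 * \sum_b chi b c * t 0 b c).
  congr (_ + _).
    apply: eq_bigr => b _; rewrite !addr0 chi0v scale1r (sect_s23) LZ L_sum.
    by congr (_ * _); apply: eq_bigr => c _; rewrite chi0v scale1r.
  apply: eq_bigr => c _; rewrite chi0v scale1r (sect_s13) LZ L_sum.
  by congr (_ * _); apply: eq_bigr => b _; rewrite add0r addr0 LZ (chiC c b).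
rewrite -!mulr_sumr -mulrDr; congr (_ * _); rewrite [X in _ + X]exchange_big -big_split.
by apply: eq_bigr => b _; rewrite -big_split; apply: eq_bigr => c _; rewrite /= mulrDl mul1r.
Qed.

Lemma L_klein4 : L klein4 = 4 * a0 + (N2 - 1) * c4.
Proof.
rewrite L_sum (sum_split0 (x := c4)) => [|u hu]; rewrite !LD.
  by rewrite /a0 /t; ring.
exact: (sum_tu4 tY).
Qed.

Lemma L_klein4_tra : L (klein4 *m tra) = D^-1 * (4 * (3 * a0 + (N2 - 1) * a3) + (N2 - 1) * ((N2 - 4) * c6 + 6 * c4)).
Proof.
rewrite !mulmxDr (klein4_s12).
rewrite (klein4_s13) (klein4_s23).
rewrite !LD !LZ -!mulrDr !L_sum -!big_split; congr (_ * _) => /=.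
pose f u := \sum_b (1 + chi u b) * (t u b 0 + t u b u + t u 0 b + t u u b + t u b b + t u (u + b) b).
rewrite (eq_bigr f) => [|u _]; last first.
  rewrite !L_sum -!big_split; apply: eq_bigr => b _ /=; rewrite !LZ !LD /t; ring.
rewrite (sum_split0 (x := (N2 - 4) * c6 + 6 * c4)) => [|u hu]; last first.
  exact: (sum_tu_lines tY).
congr (_ + _); rewrite /f (eq_bigr (fun b => 4 * (t 0 b 0 + t 0 0 b + t 0 b b))) => [|b _].
  rewrite -mulr_sumr !big_split /= (sum_t0bb tX) (sum_t0b0 tX).
  by rewrite (sum_t00c tX) /a3; ring.
by rewrite chi0v add0r; ring.
Qed.

Lemma L_klein4_cyc : L (klein4 *m cyc) = N2^-1 * (4 * (2 * a0 + 2 * (N2 - 1) * a3 + (N2 - 1) * (N2 - 4) * a2)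
  + (N2 - 1) * ((N2 - 4) * (N2 - 16) * c2 + 4 * (N2 - 4) * c6 + 8 * c4)).
Proof.
rewrite (klein4_cycles) LZ L_sum; congr (_ * _).
rewrite (sum_split0 (x := (N2 - 4) * (N2 - 16) * c2 + 4 * (N2 - 4) * c6 + 8 * c4)) => [|u hu]; last first.
  rewrite -(sum_tu_all tY hu) L_sum.
  by apply: eq_bigr => b _; rewrite L_sum; apply: eq_bigr => c _; rewrite LZ.
congr (_ + _); rewrite -(sum_t0bc tX) L_sum mulr_sumr.
apply: eq_bigr => b _; rewrite L_sum mulr_sumr; apply: eq_bigr => c _.
by rewrite LZ !chi0v /t; ring.
Qed.

Let L_comb y1 y2 y3 y0 z1 z2 z3 M1 M2 M3 K1 K2 K3 :
  L (y1 *: M1 + y2 *: M2 + y3 *: M3 + y0 *: (z1 *: K1 + z2 *: K2 + z3 *: K3))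
  = y1 * L M1 + y2 * L M2 + y3 * L M3 + y0 * (z1 * L K1 + z2 * L K2 + z3 * L K3).
Proof. by rewrite !LD !LZ !LD !LZ. Qed.

(** The sector u = 0 of R is four times Pi. The differences x - y and the factor 1/4 are chosen so
    that the sector u = 0 sees only the x coefficients and all other sectors only the y
    coefficients; the two systems of equations decouple. *)
Lemma L_layer_image xe xt xc ye yt yc :
  L ((xe - ye) *: Pi + (xt - yt) *: (Pi *m tra) + (xc - yc) *: (Pi *m cyc)
     + 4^-1 *: (ye *: klein4 + yt *: (klein4 *m tra) + yc *: (klein4 *m cyc)))
  = xe * a0 + xt * D^-1 * (3 * a0 + (N2 - 1) * a3)
    + xc * N2^-1 * (2 * a0 + 2 * (N2 - 1) * a3 + (N2 - 1) * (N2 - 4) * a2)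
    + (N2 - 1) * 4^-1 * (ye * c4 + yt * D^-1 * ((N2 - 4) * c6 + 6 * c4)
      + yc * N2^-1 * ((N2 - 4) * (N2 - 16) * c2 + 4 * (N2 - 4) * c6 + 8 * c4)).
Proof.
rewrite L_comb L_Pi L_Pi_tra L_Pi_cyc L_klein4 L_klein4_tra L_klein4_cyc invfM; field.
exact: D_neq0.
Qed.

End SectorSum.

End Sectors.

(** * Clifford twirl *)

Section CliffordAction.
Variable R : realType.
Local Notation C := R[i].
Variable n : nat.
Local Notation d := (2 ^ n)%N.
Local Notation Mat := 'M[C]_d.
Local Notation Mat4 := 'M[C]_(d * d * (d * d)).
Local Notation P := (@pauli_vec R n).
Local Notation chi := (@symp_sign n C).
Local Notation vec := (vec n).
Local Notation D := (d%:R : C).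
Implicit Types (X Y U : Mat) (M : Mat4) (u v w a b c e : vec).
Local Notation p4 := (@p4 R n).
Local Notation p13 := (@p13 R n).
Local Notation p23 := (@p23 R n).
Local Notation g := (sect chi D p4 p13 p23).
Local Notation iC := ('i%C : C).

Let x1 : C := (2^-1 +i* 2^-1)%C.
Let x2 : C := (2^-1 -i* 2^-1)%C.

Let x12 : x1 * x2 + x1 * x2 = 1.
Proof. by apply/eqP; rewrite eq_complex /=; apply/andP; split; apply/eqP; field. Qed.
Let x11 : x1 * x1 + x2 * x2 = 0.
Proof. by apply/eqP; rewrite eq_complex /=; apply/andP; split; apply/eqP; field. Qed.
Let x22 : x1 * x1 - x2 * x2 = iC.
Proof. by apply/eqP; rewrite eq_complex /=; apply/andP; split; apply/eqP; field. Qed.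
Let conj_x1 : conjc x1 = x2. Proof. by []. Qed.
Let conj_x2 : conjc x2 = x1. Proof. by rewrite -conj_x1 conjcK. Qed.

(** This is exp(-i pi/4 P c) times the phase exp(i pi/4), which removes the square root of 2. A
    Pauli operator that anticommutes with P c is sent to a product with P c, which is the
    transvection on labels. *)
Definition Utv c : Mat := x1 *: 1%:M + x2 *: P c.

Let Utv_adj c : adj (Utv c) = x2 *: 1%:M + x1 *: P c.
Proof. by rewrite /Utv adjcD !adjcZ adjc1 pauli_adj conj_x1 conj_x2. Qed.

Let mul_ab (y1 y2 z1 z2 : C) c : (y1 *: 1%:M + y2 *: P c) *m (z1 *: 1%:M + z2 *: P c)
  = (y1 * z1 + y2 * z2) *: 1%:M + (y1 * z2 + y2 * z1) *: P c.
Proof.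
rewrite mulmxDl !mulmxDr -!scalemxAl -!scalemxAr !mul1mx mulmx1 pauli_sqr !scalerA.
by rewrite [X in _ + X]addrC addrACA -!scalerDl.
Qed.

Lemma Utv_unitary c : unitary (Utv c).
Proof.
rewrite /unitary Utv_adj mul_ab (mulrC x2) x12 scale1r addrC.
by rewrite addrC (addrC (x2 * x2)) x11 scale0r addr0.
Qed.

Let comm_ab (y1 y2 z1 z2 : C) c v :
  (y1 *: 1%:M + y2 *: P c) *m P v *m (z1 *: 1%:M + z2 *: P c)
  = P v *m ((y1 * z1 + chi c v * y2 * z2) *: 1%:M + (y1 * z2 + chi c v * y2 * z1) *: P c).
Proof.
rewrite mulmxDl -!scalemxAl mul1mx (pauli_comm R c v) scalerA.
have -> : y1 *: P v + (y2 * chi c v) *: (P v *m P c) = P v *m (y1 *: 1%:M + (chi c v * y2) *: P c).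
  by rewrite mulmxDr -!scalemxAr mulmx1 (mulrC y2).
by rewrite -mulmxA mul_ab.
Qed.

Let eps (z : C) v c : C := if sf v c then z * kap R v c else 1.

Let eps_sqr z v c : z * z = -1 -> eps z v c * eps z v c = 1.
Proof.
move=> hz; rewrite /eps; case h : (sf v c); last by rewrite mulr1.
by rewrite mulrACA hz kap_sqr /symp_sign h expr1 mulrNN mulr1.
Qed.

Let conjE (y1 y2 z1 z2 z : C) c v : y1 * z1 + y2 * z2 = 1 -> y1 * z1 = y2 * z2 ->
  y1 * z2 + y2 * z1 = 0 -> y1 * z2 - y2 * z1 = z ->
  (y1 *: 1%:M + y2 *: P c) *m P v *m (z1 *: 1%:M + z2 *: P c) = eps z v c *: P (transvect c v).
Proof.
move=> h1 h2 h3 h4; rewrite comm_ab /eps /transvect chiC /symp_sign; case: (sf v c).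
  rewrite expr1 !mulN1r !mulNr h4 h2 subrr scale0r add0r -scalemxAr pauli_mul scalerA //.
by rewrite expr0 !mul1r h1 h3 scale0r addr0 !scale1r mulmx1.
Qed.

Lemma Utv_conj c v : exists2 x, x * x = 1 & adj (Utv c) *m P v *m Utv c = x *: P (transvect c v).
Proof.
exists (eps (- iC) v c); first by rewrite eps_sqr // mulrNN iCiC.
rewrite Utv_adj; apply: conjE; first by rewrite (mulrC x2) x12.
- by rewrite mulrC.
- by rewrite addrC x11.
- by rewrite -x22 opprB.
Qed.

Lemma Utv_conj' c v : exists2 x, x * x = 1 & Utv c *m P v *m adj (Utv c) = x *: P (transvect c v).
Proof.
exists (eps iC v c); first by rewrite eps_sqr // iCiC.
rewrite Utv_adj; apply: conjE; first by rewrite (mulrC x2) x12.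
- by rewrite mulrC.
- exact: x11.
- exact: x22.
Qed.

Lemma Utv_clifford c : clifford (Utv c).
Proof.
split=> [|s]; first exact: Utv_unitary.
have [dec encK decK] := enc_bij n; have [x _ hx] := Utv_conj' c (dec s).
by exists x, (enc (transvect c (dec s))); rewrite pauli_enc -hx -pauli_enc decK.
Qed.

Section Action.
Variables (U : Mat) (tau : vec -> vec).
Hypothesis Uu : unitary U.
Hypothesis Uconj : forall v, exists2 x, x * x = 1 & adj U *m P v *m U = x *: P (tau v).

Let U1 : adj U *m 1%:M *m U = 1%:M. Proof. by rewrite mulmx1. Qed.

(** The unknown sign occurs four times here and twice in the next two lemmas; x * x = 1 is all that
    has to be known about it. *)
Lemma Ad_p4 a : Ad U (p4 a) = p4 (tau a).
Proof.
have [x hx ha] := Uconj a.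
by rewrite !p4E Ad_t4 ha t4Z hx mul1r hx scale1r.
Qed.

Lemma Ad_p13 a : Ad U (p13 a) = p13 (tau a).
Proof.
have [x hx ha] := Uconj a.
rewrite !p13E Ad_t4 ha U1 -{1}[1%:M]scale1r -{2}[1%:M]scale1r t4Z !mulr1 hx scale1r //.
Qed.

Lemma Ad_p23 a : Ad U (p23 a) = p23 (tau a).
Proof.
have [x hx ha] := Uconj a.
rewrite !p23E Ad_t4 ha U1 -{1}[1%:M]scale1r -{2}[1%:M]scale1r t4Z mul1r mulr1 hx scale1r //.
Qed.

Hypothesis tau_chi : forall v w, chi (tau v) (tau w) = chi v w.
Hypothesis tau_inv : involutive tau.

Lemma Ad_sect u b c : Ad U (g u b c) = g (tau u) (tau b) (tau c).
Proof.
have e : Ad U (sproj chi D p4 u) = sproj chi D p4 (tau u).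
  rewrite /sproj AdZ Ad_sum; congr (_ *: _); rewrite [RHS](reindex_inj (can_inj tau_inv)).
  by apply: eq_bigr => a _; rewrite AdZ Ad_p4 tau_chi.
have -> : Ad U (g u b c) = Ad U (sproj chi D p4 u) *m Ad U (p13 b) *m Ad U (p23 c).
  by rewrite -!Ad_mul.
exact: (f_equal2 mulmx (f_equal2 mulmx e (Ad_p13 b)) (Ad_p23 c)).
Qed.

End Action.

Lemma chi_transvect c v w : chi (transvect c v) (transvect c w) = chi v w.
Proof. by rewrite /symp_sign sf_transvect. Qed.

Section Twirl.
Variables (m : nat) (S : 'I_m -> Mat).
Hypothesis HS : clifford_transversal S.

Definition twirl M : Mat4 := m%:R^-1 *: \sum_j Ad (S j) M.

Lemma twirlD M M' : twirl (M + M') = twirl M + twirl M'.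
Proof.
rewrite /twirl -scalerDr -big_split; congr (_ *: _); apply: eq_bigr => j _; exact: AdD.
Qed.

Lemma twirlZ x M : twirl (x *: M) = x *: twirl M.
Proof.
rewrite /twirl scalerA mulrC -scalerA; congr (_ *: _); rewrite scaler_sumr.
by apply: eq_bigr => j _; exact: AdZ.
Qed.

Lemma cliffordM U V : clifford U -> clifford V -> clifford (U *m V).
Proof.
move=> [uU cU] [uV cV]; split=> [|s].
  by rewrite /unitary adjcM mulmxA -[_ *m adj U *m U]mulmxA uU mulmx1.
have [x [s' h]] := cV s; have [y [s'' h']] := cU s'.
exists (x * y), s''; rewrite adjcM !mulmxA -[U *m V *m _]mulmxA -[U *m _ *m adj V]mulmxA h.
by rewrite -scalemxAr -scalemxAl h' scalerA.
Qed.

Lemma clifford1 : clifford (1%:M : Mat).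
Proof.
split=> [|s]; first by rewrite /unitary adjc1 mulmx1.
by exists 1, s; rewrite adjc1 mulmx1 mul1mx scale1r.
Qed.

Lemma transversal_gt0 : (0 < m)%N.
Proof. by have [_ /(_ _ clifford1) [j _]] := HS; apply: leq_ltn_trans (ltn_ord j). Qed.

Lemma S_unitary j : unitary (S j). Proof. by have [/(_ j) []] := HS. Qed.

Lemma Ad_phase x U M : x * conjc x = 1 -> Ad (x *: U) M = Ad U M.
Proof.
move=> hx; rewrite /Ad t4Z adjcZ -scalemxAl -scalemxAl -scalemxAr scalerA.
have -> : conjc (x * x * x * x) * (x * x * x * x) = (x * conjc x) ^+ 4.
  by rewrite !rmorphM /=; ring.
by rewrite hx expr1n scale1r.
Qed.

Lemma phase_norm x U V : unitary U -> unitary V -> U = x *: V -> x * conjc x = 1.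
Proof.
move=> hU hV e; have := hU; rewrite e /unitary adjcZ -scalemxAl -scalemxAr scalerA hV => h.
have hd : (0 < d)%N by rewrite expn_gt0.
have /matrixP /(_ (Ordinal hd) (Ordinal hd)) := h.
by rewrite !mxE eqxx mulr1 mulrC.
Qed.

(** Left multiplication by U permutes the transversal up to phases, and [Ad] does not see phases. *)
Lemma twirl_Ad U M : clifford U -> twirl (Ad U M) = twirl M.
Proof.
move=> cU; have [cS uS] := HS; rewrite /twirl; congr (_ *: _).
have ex j : exists k x, U *m S j = x *: S k.
  by have [k [[x hx] _]] := uS _ (cliffordM cU (cS j)); exists k, x.
have [f hf] := fin_all_exists ex.
have f_inj : injective f.
  move=> j k e; have [x hx] := hf j; have [y hy] := hf k.
  have [l [_ ul]] := uS _ (cS j).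
  have uU : U *m adj U = 1%:M by apply: unitaryC; case: cU.
  have nx : x * conjc x = 1.
    apply: (phase_norm _ _ hx); last exact: S_unitary.
    by have [] := cliffordM cU (cS j).
  have ny : y * conjc y = 1.
    apply: (phase_norm _ _ hy); last exact: S_unitary.
    by have [] := cliffordM cU (cS k).
  have adjU V : adj U *m (U *m V) = V by rewrite mulmxA (proj1 cU) mul1mx.
  have <- : l = j by apply: ul; exists 1; rewrite scale1r.
  apply: ul; exists (x * conjc y).
  have -> : S j = x *: (adj U *m S (f k)) by rewrite -{1}[S j]adjU hx e -scalemxAr.
  have -> : S k = y *: (adj U *m S (f k)) by rewrite -{1}[S k]adjU hy -scalemxAr.
  by rewrite scalerA -mulrA (mulrC _ y) ny mulr1.
rewrite [RHS](reindex_inj f_inj); apply: eq_bigr => j _.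
rewrite Ad_comp; have [x hx] := hf j; rewrite hx Ad_phase //.
apply: (phase_norm _ _ hx); last exact: S_unitary.
by have [] := cliffordM cU (cS j).
Qed.

Lemma twirl_fix M : (forall U, unitary U -> Ad U M = M) -> twirl M = M.
Proof.
move=> h; rewrite /twirl (eq_bigr (fun=> M)) => [|j _]; last exact/h/S_unitary.
rewrite sumr_const card_ord -[M *+ m]scaler_nat scalerA mulVf ?scale1r //.
by rewrite pnatr_eq0 -lt0n transversal_gt0.
Qed.

Lemma twirl_mulr M M' : (forall U, unitary U -> Ad U M' = M') -> twirl (M *m M') = twirl M *m M'.
Proof.
move=> h; rewrite /twirl -scalemxAl mulmx_suml; congr (_ *: _); apply: eq_bigr => j _.
by rewrite Ad_mul ?h //; exact: S_unitary.
Qed.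

(** Every matrix entry of the twirl is therefore invariant under transvections of the three labels,
    which is the hypothesis of [class3]. *)
Lemma twirl_sect c u b e : twirl (g (transvect c u) (transvect c b) (transvect c e)) = twirl (g u b e).
Proof.
rewrite -(Ad_sect (Utv_unitary c) (Utv_conj c) (@chi_transvect c) (@transvectK n c)).
by apply: twirl_Ad; exact: Utv_clifford.
Qed.

End Twirl.
End CliffordAction.

(** * Class functions on commuting triples of labels *)

Section ClassFunctions.
Variables (n : nat) (F : numFieldType).
Local Notation vec := (vec n).
Local Notation chi := (@symp_sign n F).
Implicit Types (u b c : vec).

Lemma chi_eq1 u b : chi u b = 1 -> sf u b = false.
Proof.
rewrite /symp_sign; case: (sf u b) => //; rewrite expr1 => /esym/eqP.
by rewrite -subr_eq0 opprK -mulr2n pnatr_eq0.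
Qed.

Lemma set_ord0P r (m : {set 'I_r}) : (forall i, i \notin m) -> m = set0.
Proof. by move=> h; apply/setP => i; rewrite inE; apply/negbTE/h. Qed.

Definition fam (s : seq vec) r (i : 'I_r) : vec := nth 0 s i.

Lemma free1 u : u != 0 -> free_fam (@fam [:: u] 1).
Proof.
move=> hu m; rewrite big_mkcond big_ord1 /=; case: ifP => [_ /eqP|hm _]; first by rewrite (negbTE hu).
by apply: set_ord0P => i; rewrite (ord1 i) hm.
Qed.

Lemma free2 u b : u != 0 -> b != 0 -> b != u -> free_fam (@fam [:: u; b] 2).
Proof.
move=> hu hb hub m; rewrite big_mkcond !big_ord_recl big_ord0 /= addr0 /fam /=.
case: ifP => h0; case: ifP => h1; rewrite ?addr0 ?add0r => /eqP.
- by rewrite addvec_eq0 eq_sym (negbTE hub).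
- by rewrite (negbTE hu).
- by rewrite (negbTE hb).
move=> _; apply: set_ord0P => i; case: (unliftP ord0 i) => [j ->|->]; last by rewrite h0.
by rewrite (ord1 j) h1.
Qed.

Lemma free3 u b c : u != 0 -> b != 0 -> b != u -> c != 0 -> c != u -> c != b ->
  c != b + u -> free_fam (@fam [:: u; b; c] 3).
Proof.
move=> hu hb hub hc hcu hcb hcbu m; rewrite big_mkcond !big_ord_recl big_ord0 /= addr0 /fam /=.
case: ifP => h0; case: ifP => h1; case: ifP => h2; rewrite ?addr0 ?add0r => /eqP.
- by rewrite addrA addvec_eq0 (addrC u) eq_sym (negbTE hcbu).
- by rewrite addvec_eq0 eq_sym (negbTE hub).
- by rewrite addvec_eq0 eq_sym (negbTE hcu).
- by rewrite (negbTE hu).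
- by rewrite addvec_eq0 eq_sym (negbTE hcb).
- by rewrite (negbTE hb).
- by rewrite (negbTE hc).
move=> _; apply: set_ord0P => i; case: (unliftP ord0 i) => [j ->|->]; last by rewrite h0.
case: (unliftP ord0 j) => [k ->|->]; last by rewrite h1.
by rewrite (ord1 k) h2.
Qed.

(** By Witt's theorem the nonzero labels form a single orbit of the transvections. The next two
    lemmas do the same for independent commuting pairs and triples. *)
Lemma const1 (f : vec -> F) : (forall e u, f (transvect e u) = f u) ->
  exists k, forall u, u != 0 -> f u = k.
Proof.
move=> finv; have fact cs u : f (transvects cs u) = f u by elim: cs u => //= e cs IH u; rewrite IH finv.
have [u0 hu0|none] := pickP (fun u : vec => u != 0); last first.
  by exists 0 => u hu; have := none u; rewrite /= hu.
exists (f u0) => u hu.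
have [i j|cs hcs] := witt _ (free1 hu) (free1 hu0); first by rewrite !(ord1 i) !(ord1 j) !sfvv.
by rewrite -(fact cs) (hcs ord0).
Qed.

Lemma const2 (f : vec -> vec -> F) : (forall e u b, f (transvect e u) (transvect e b) = f u b) ->
  exists k, forall u b, u != 0 -> b != 0 -> b != u -> chi u b = 1 -> f u b = k.
Proof.
move=> finv.
have fact cs u b : f (transvects cs u) (transvects cs b) = f u b by elim: cs u b => //= e cs IH u b; rewrite IH finv.
have [[u0 b0] /and4P /= [h1 h2 h3 /eqP /chi_eq1 h4]|none] :=
  pickP (fun p : vec * vec => [&& p.1 != 0, p.2 != 0, p.2 != p.1 & chi p.1 p.2 == 1]); last first.
  by exists 0 => u b hu hb hub hc; have := none (u, b); rewrite /= hu hb hub hc eqxx.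
exists (f u0 b0) => u b hu hb hub /chi_eq1 hc.
have [i j|cs hcs] := witt _ (free2 hu hb hub) (free2 h1 h2 h3).
  by case: i => [[|[|i]] hi]; case: j => [[|[|j]] hj]; rewrite /fam //= ?sfvv ?hc ?h4 // sfC ?hc sfC h4.
rewrite -(fact cs); have := hcs ord0; have := hcs ord_max; rewrite /fam /=.
by move=> -> ->.
Qed.

Lemma const3 (f : vec -> vec -> vec -> F) :
  (forall e u b c, f (transvect e u) (transvect e b) (transvect e c) = f u b c) ->
  exists k, forall u b c, u != 0 -> b != 0 -> b != u -> c != 0 -> c != u -> c != b ->
    c != b + u -> chi u b = 1 -> chi u c = 1 -> chi b c = 1 -> f u b c = k.
Proof.
move=> finv.
have fact cs u b c : f (transvects cs u) (transvects cs b) (transvects cs c) = f u b c.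
  by elim: cs u b c => //= e cs IH u b c; rewrite IH finv.
pose ok u b c := [&& u != 0, b != 0, b != u, c != 0, c != u, c != b, c != b + u,
  chi u b == 1, chi u c == 1 & chi b c == 1].
have [[[u0 b0] c0]|none] := pickP (fun p : vec * vec * vec => ok p.1.1 p.1.2 p.2); last first.
  (* Three independent commuting labels exist only for n at least 3; otherwise the class is empty
     and 0 is a dummy value. *)
  exists 0 => u b c k1 k2 k3 k4 k5 k6 k7 k8 k9 k10; have := none (u, b, c).
  by rewrite /ok /= k1 k2 k3 k4 k5 k6 k7 k8 k9 k10 !eqxx.
rewrite /ok /= => /and5P [h1 h2 h3 h4 /and5P [h5 h6 h7 /eqP /chi_eq1 h8 /andP [/eqP /chi_eq1 h9 /eqP /chi_eq1 h10]]].
exists (f u0 b0 c0) => u b c k1 k2 k3 k4 k5 k6 k7 /chi_eq1 k8 /chi_eq1 k9 /chi_eq1 k10.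
have [i j|cs hcs] := witt _ (free3 k1 k2 k3 k4 k5 k6 k7) (free3 h1 h2 h3 h4 h5 h6 h7).
  by case: i => [[|[|[|i]]] hi]; case: j => [[|[|[|j]]] hj]; rewrite /fam //= ?sfvv ?h8 ?h9 ?h10 ?k8 ?k9 ?k10 //
    sfC ?k8 ?k9 ?k10 sfC ?h8 ?h9 ?h10.
rewrite -(fact cs); have := hcs ord0; have := hcs ord_max; have := hcs (lift ord0 ord0); rewrite /fam /=.
by move=> -> -> ->.
Qed.

Notation dl b c := ((b == c)%:R : F).

(** Commuting pairs fall into five classes, according to which of b, c and b + c vanish; the right
    side interpolates the five values. *)
Lemma class2 (f : vec -> vec -> F) : (forall e u b, f (transvect e u) (transvect e b) = f u b) ->
  exists ab ac abc a2, forall b c, chi b c = 1 -> f b c =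
  a2 + (ab - a2) * dl c 0 + (ac - a2) * dl b 0 + (abc - a2) * dl c b
  + (f 0 0 - ab - ac - abc + a2 + a2) * (dl b 0 * dl c 0).
Proof.
move=> finv.
have [ab hab] := const1 (f := fun b => f b 0) (fun e b => etrans (congr1 _ (esym (transvect0 e))) (finv e b 0)).
have [ac hac] := const1 (f := fun b => f 0 b) (fun e b => etrans (congr1 (f^~ _) (esym (transvect0 e))) (finv e 0 b)).
have [abc habc] := const1 (f := fun b => f b b) (fun e b => finv e b b).
have [a2 ha2] := const2 finv.
exists ab, ac, abc, a2 => b c hbc.
have [hb|hb] := eqVneq b 0; have [hc|hc] := eqVneq c 0; rewrite ?hb ?hc /=.
- by rewrite eqxx /=; ring.
- by rewrite (negbTE hc) /= hac //; ring.
- by rewrite eq_sym (negbTE hb) /= hab //; ring.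
have [->|hcb] := eqVneq c b => /=; first by rewrite habc //; ring.
by rewrite ha2 //; ring.
Qed.

(* A Clifford-invariant function on pairwise commuting triples depends only on
   the linear relations among them, by Witt's theorem. *)
Lemma class3 (t : vec -> vec -> vec -> F) :
  (forall e u b c, t (transvect e u) (transvect e b) (transvect e c) = t u b c) ->
  exists (ab ac abc a2 c00 cu0 c0u cuu d0 du e0 eu f0 fu c2 : F),
  (forall b c, chi b c = 1 -> t 0 b c =
  a2 + (ab - a2) * dl c 0 + (ac - a2) * dl b 0 + (abc - a2) * dl c b
  + (t 0 0 0 - ab - ac - abc + a2 + a2) * (dl b 0 * dl c 0)) /\
  (forall u b c, u != 0 -> chi u b = 1 -> chi u c = 1 -> chi b c = 1 ->
  t u b c = c2 + (d0 - c2) * dl c 0 + (du - c2) * dl c u + (e0 - c2) * dl b 0 + (eu - c2) * dl b u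
  + (f0 - c2) * dl c b + (fu - c2) * dl c (b + u)
  + (c00 - d0 - e0 - f0 + c2 + c2) * (dl b 0 * dl c 0)
  + (cu0 - d0 - eu - fu + c2 + c2) * (dl b u * dl c 0)
  + (c0u - du - e0 - fu + c2 + c2) * (dl b 0 * dl c u)
  + (cuu - du - eu - f0 + c2 + c2) * (dl b u * dl c u)).
Proof.
move=> finv.
have [|ab [ac [abc [a2 h0]]]] := class2 (f := t 0).
  by move=> e b c; rewrite -{1}(transvect0 e) finv.
have finv0 e u b : t (transvect e u) 0 (transvect e b) = t u 0 b by rewrite -{1}(transvect0 e) finv.
have finv0' e u b : t (transvect e u) (transvect e b) 0 = t u b 0 by rewrite -{1}(transvect0 e) finv.
have [c00 h1] := const1 (f := fun u => t u 0 0) (fun e u => etrans (congr1 _ (esym (transvect0 e))) (finv0 e u 0)).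
have [cu0 h2] := const1 (f := fun u => t u u 0) (fun e u => finv0' e u u).
have [c0u h3] := const1 (f := fun u => t u 0 u) (fun e u => finv0 e u u).
have [cuu h4] := const1 (f := fun u => t u u u) (fun e u => finv e u u u).
have [d0 h5] := const2 (f := fun u b => t u b 0) finv0'.
have [du h6] := const2 (f := fun u b => t u b u) (fun e u b => finv e u b u).
have [e0 h7] := const2 (f := fun u b => t u 0 b) finv0.
have [eu h8] := const2 (f := fun u b => t u u b) (fun e u b => finv e u u b).
have [f0 h9] := const2 (f := fun u b => t u b b) (fun e u b => finv e u b b).
have [|fu h10] := const2 (f := fun u b => t u b (b + u)).
  by move=> e u b; rewrite -transvectD finv.
have [c2 h11] := const3 finv.
exists ab, ac, abc, a2, c00, cu0, c0u, cuu, d0, du, e0, eu, f0, fu, c2; split=> // u b c hu ub uc bc.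
have hu' : (0 == u) = false by rewrite eq_sym (negbTE hu).
have [hb|hb] := eqVneq b 0.
  rewrite hb add0r hu'; have [->|hc] := eqVneq c 0; first by rewrite hu' h1 //=; ring.
  have [->|hcu] := eqVneq c u; first by rewrite h3 //=; ring.
  by rewrite h7 //=; ring.
have [hbu|hbu] := eqVneq b u.
  rewrite hbu addvecc; have [->|hc] := eqVneq c 0; first by rewrite hu' h2 //=; ring.
  have [->|hcu] := eqVneq c u; first by rewrite h4 //=; ring.
  by rewrite h8 //=; ring.
have hb' : (0 == b) = false by rewrite eq_sym (negbTE hb).
have [->|hc] := eqVneq c 0.
  by rewrite hu' hb' eq_sym addvec_eq0 (negbTE hbu) h5 //=; ring.
have [hcu|hcu] := eqVneq c u.
  have dbu : (u == b + u) = false.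
    by rewrite eq_sym addrC -{2}[u]addr0 (inj_eq (addrI u)) (negbTE hb).
  by rewrite hcu dbu eq_sym (negbTE hbu) h6 //=; ring.
have [hcb|hcb] := eqVneq c b.
  have dbu : (b == b + u) = false by rewrite -{1}[b]addr0 (inj_eq (addrI b)) hu'.
  by rewrite hcb dbu h9 //=; ring.
have [->|hcbu] := eqVneq c (b + u); first by rewrite h10 //=; ring.
by rewrite h11 //=; ring.
Qed.

End ClassFunctions.

From mathcomp Require Import exp trigo.

(** * One layer of T gates *)

Section OneQubit.
Variable R : realType.
Local Notation C := R[i].
Local Notation iC := ('i%C : C).
Local Notation w := (omega R).
Local Notation sig := (@sig R).

Lemma omega2 : w * w = iC.
Proof.
have h : pi / 4 + pi / 4 = pi / 2 :> R by field.
apply/eqP; rewrite eq_complex /= -cosD h cos_pihalf eqxx /=.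
by rewrite addrC -sinD h sin_pihalf.
Qed.

Lemma omega4 : w * w * w * w = -1.
Proof. by rewrite -mulrA !omega2 iCiC. Qed.

Lemma omega_conj : w * conjc w = 1.
Proof.
apply/eqP; rewrite eq_complex /= mulrN opprK -!expr2 cos2Dsin2 eqxx /=.
by rewrite mulrN mulrC addNr.
Qed.

(* Coefficients of the expansion, on one qubit, of the fourth tensor power of
   the T gate acting on the sector projector into products with Z operators. *)
Definition tau1 (isT : bool) (x : bool * bool * bool) : C :=
  (x == 0)%:R - (if isT then 4^-1 * (-1) ^+ x.1.1 else 0).

Let tq (isT : bool) (j : 'I_2) : C := if isT && (j == ord_max) then w else 1.
Definition Tq (isT : bool) : 'M[C]_2 := if isT then Tgate R else 1%:M.

Lemma TqE isT i j : Tq isT i j = if i == j then tq isT j else 0.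
Proof.
rewrite /Tq /tq; case: isT; rewrite mxE /=; case: (altP (i =P j)) => //= <-.
by elim/ord2P: i.
Qed.

Lemma Tq_conj isT a i j : (adj (Tq isT) *m sig a *m Tq isT) i j
  = conjc (tq isT i) * sig a i j * tq isT j.
Proof.
rewrite mxE (bigD1 j) //= big1 ?addr0 => [|k /negbTE hk]; last by rewrite TqE hk mulr0.
rewrite mxE (bigD1 i) //= big1 ?addr0 => [|k /negbTE hk]; last first.
  by rewrite !mxE TqE hk rmorph0 mul0r.
by rewrite !mxE !TqE !eqxx.
Qed.

Let tq_eq isT j : conjc (tq isT j) * tq isT j = 1.
Proof. by rewrite /tq; case: ifP => _; rewrite ?rmorph1 ?mulr1 // mulrC omega_conj. Qed.

Lemma Tq_unitary isT : adj (Tq isT) *m Tq isT = 1%:M.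
Proof.
apply/matrixP => i j; rewrite -[adj _]mulmx1 -(sig0 R) Tq_conj sig0 !mxE.
case: (altP (i =P j)) => [->|_]; first by rewrite mulr1 tq_eq.
by rewrite mulr0 mul0r.
Qed.

Let tq_ne isT i j : i != j -> conjc (tq isT i) * tq isT j
  = if isT then (if j == ord_max then w else conjc w) else 1.
Proof.
rewrite /tq (fun_if (@conjc R)) rmorph1.
by elim/ord2P: i; elim/ord2P: j; case: isT => //=; rewrite ?mul1r ?mulr1.
Qed.

Let zs (z : bool) (j : 'I_2) : C := (-1) ^+ (z && (j == ord_max)).

Lemma sig_z a z i j : (sig a *m sig (false, z)) i j = sig a i j * zs z j.
Proof.
rewrite mxE (bigD1 j) //= big1 ?addr0 => [|k /negbTE hk]; last by rewrite [X in _ * X]sigE hk mulr0.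
by rewrite [X in _ * X]sigE eqxx /= mul1r.
Qed.

Lemma sig_zz a z z' i j : (sig a *m sig (false, z) *m sig (false, z')) i j = sig a i j * zs z j * zs z' j.
Proof.
rewrite mxE (bigD1 j) //= big1 ?addr0 => [|k /negbTE hk]; last by rewrite [X in _ * X]sigE hk mulr0.
by rewrite sig_z [X in _ * X]sigE eqxx /= mul1r.
Qed.

(** T commutes with I and Z and multiplies the entries of X and Y by omega or its conjugate. The X
    and Y terms cancel unless an even number of the columns j is 1; the total phase is then -1 if
    all four columns agree and 1 if they split two and two. On the right, the sum over b and c
    produces this indicator of equal columns, and the sum over the sign bit removes its effect on I
    and Z. *)
Lemma one_qubit isT i1 i2 i3 i4 j1 j2 j3 j4 :
  \sum_a (adj (Tq isT) *m sig a *m Tq isT) i1 j1 * (adj (Tq isT) *m sig a *m Tq isT) i2 j2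
    * (adj (Tq isT) *m sig a *m Tq isT) i3 j3 * (adj (Tq isT) *m sig a *m Tq isT) i4 j4
  = \sum_x \sum_a tau1 isT x * ((-1) ^+ sf1 a (false, x.1.1) *
     ((sig a *m sig (false, x.1.2)) i1 j1 * (sig a *m sig (false, x.2)) i2 j2
     * (sig a *m sig (false, x.1.2) *m sig (false, x.2)) i3 j3 * sig a i4 j4)).
Proof.
pose E a := sig a i1 j1 * sig a i2 j2 * sig a i3 j3 * sig a i4 j4.
pose ph := conjc (tq isT i1) * tq isT j1 * (conjc (tq isT i2) * tq isT j2)
  * (conjc (tq isT i3) * tq isT j3) * (conjc (tq isT i4) * tq isT j4).
pose S0 := E (false, true) + E (false, false).
pose S1 := E (true, true) + E (true, false).
transitivity (ph * (S0 + S1)).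
  rewrite /S0 /S1 addrC -(big_bool2 _ E) mulr_sumr; apply: eq_bigr => a _.
  by rewrite !Tq_conj /ph /E; ring.
transitivity (\sum_x tau1 isT x * (S0 + (-1) ^+ x.1.1 * S1)
    * (zs x.1.2 j1 * zs x.1.2 j3 * (zs x.2 j2 * zs x.2 j3))); last first.
  apply: eq_bigr => -[[m b] c] _ /=.
  have Ea a : (-1) ^+ sf1 a (false, m) * ((sig a *m sig (false, b)) i1 j1
      * (sig a *m sig (false, c)) i2 j2 * (sig a *m sig (false, b) *m sig (false, c)) i3 j3 * sig a i4 j4)
    = (-1) ^+ sf1 a (false, m) * E a * (zs b j1 * zs b j3 * (zs c j2 * zs c j3)).
    by rewrite sig_zz !sig_z /E; ring.
  rewrite -mulr_sumr (eq_bigr _ (fun a _ => Ea a)) big_bool2 /S0 /S1 /sf1 /=.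
  by case: m {Ea}; rewrite /= ?expr0 ?expr1; ring.
rewrite (eq_bigr (fun p => tau1 isT (p.1, p.2) * (S0 + (-1) ^+ p.1.1 * S1)
    * (zs p.1.2 j1 * zs p.1.2 j3 * (zs p.2 j2 * zs p.2 j3)))) => [|[] //].
rewrite -(pair_big predT predT (fun y c => tau1 isT (y, c) * (S0 + (-1) ^+ y.1 * S1)
    * (zs y.2 j1 * zs y.2 j3 * (zs c j2 * zs c j3)))) big_bool2 !big_bool.
have zs0 j : zs false j = 1 by [].
rewrite !zs0 /tau1 /= !mulr1 !mul1r ?expr0 ?expr1.
have S0E : S0 = if [&& i1 == j1, i2 == j2, i3 == j3 & i4 == j4]
    then 1 + zs true j1 * zs true j2 * zs true j3 * zs true j4 else 0.
  rewrite /S0 /E !sigE /= /zs /=.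
  by case: (i1 == j1); case: (i2 == j2); case: (i3 == j3); case: (i4 == j4) => /=; rewrite ?expr0; ring.
have S1E : S1 = if [&& i1 != j1, i2 != j2, i3 != j3 & i4 != j4]
    then 1 + zs true j1 * zs true j2 * zs true j3 * zs true j4 else 0.
  have h4 (x y z t : C) : iC ^+ 1 * x * (iC ^+ 1 * y) * (iC ^+ 1 * z) * (iC ^+ 1 * t) = x * y * z * t.
    have h := iCiC R; transitivity ((iC * iC) * (iC * iC) * (x * y * z * t)); first by rewrite expr1; ring.
    by rewrite h mulrNN !mul1r.
  rewrite /S1 /E !sigE /= /zs /=.
  by case: (i1 == j1); case: (i2 == j2); case: (i3 == j3); case: (i4 == j4) => /=; rewrite ?h4 ?expr0; ring.
case: (boolP [&& i1 == j1, i2 == j2, i3 == j3 & i4 == j4]) S0E => [hh|_] S0E.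
  case/and4P: hh => /eqP h1 /eqP h2 /eqP h3 /eqP h4.
  rewrite h1 eqxx /= in S1E; rewrite S1E /ph h1 h2 h3 h4.
  by rewrite !tq_eq; clear; case: isT; field.
case: (boolP [&& i1 != j1, i2 != j2, i3 != j3 & i4 != j4]) S1E => [hh|_] S1E; last first.
  by rewrite S0E S1E; move: (ph) => p; clear; case: isT; ring.
case/and4P: hh => h1 h2 h3 h4; rewrite S0E S1E /ph.
rewrite !tq_ne // /zs; clear S0E S1E S0 S1 E ph h1 h2 h3 h4; case: isT; last by ring.
have o4 := omega4.
(* Every pattern of columns becomes a polynomial identity modulo w^4 = -1. *)
have -> : conjc w = - (w * w * w).
  by rewrite -[LHS]mul1r -[1]opprK -omega4 mulNr -!mulrA omega_conj mulr1.
move: w o4 => W o4.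
elim/ord2P: j1; elim/ord2P: j2; elim/ord2P: j3; elim/ord2P: j4;
  rewrite /= ?expr0 ?expr1;
  first [ by field
        | transitivity (2%:R * (W * W * W * W)); [ring | rewrite o4; by field]
        | transitivity (2%:R * (W * W * W * W) * (W * W * W * W)); [ring | rewrite o4; by field]
        | transitivity (2%:R * (W * W * W * W) * (W * W * W * W) * (W * W * W * W)); [ring | rewrite o4; by field]].
Qed.

End OneQubit.

Section TLayer.
Variable R : realType.
Local Notation C := R[i].
Variables n k : nat.
Local Notation d := (2 ^ n)%N.
Local Notation Mat := 'M[C]_d.
Local Notation Mat4 := 'M[C]_(d * d * (d * d)).
Local Notation P := (@pauli_vec R n).
Local Notation chi := (@symp_sign n C).
Local Notation vec := (vec n).
Local Notation D := (d%:R : C).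
Local Notation p4 := (@p4 R n).
Local Notation p13 := (@p13 R n).
Local Notation p23 := (@p23 R n).
Local Notation g := (sect chi D p4 p13 p23).
Local Notation Pi := (sproj chi D p4 0).

Lemma sectE (u b c : vec) : g u b c = (D * D)^-1 *: \sum_a chi a u *:
  t4 (P a *m P b) (P a *m P c) (P a *m P b *m P c) (P a).
Proof.
rewrite /sect /sproj -scalemxAl -scalemxAl; congr (_ *: _).
rewrite mulmx_suml mulmx_suml; apply: eq_bigr => a _.
by rewrite -scalemxAl -scalemxAl p4E p13E p23E !t4_mul !mulmx1.
Qed.

Definition isT (q : 'I_n) : bool := (n - k <= q)%N.

Lemma ThatE : That R n k = tens (fun q => Tq R (isT q)).
Proof. by []. Qed.

Definition tau (w : {ffun 'I_n -> bool * bool * bool}) : C := \prod_q tau1 R (isT q) (w q).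
Definition wu (w : {ffun 'I_n -> bool * bool * bool}) : vec := [ffun q => (false, (w q).1.1)].
Definition wb (w : {ffun 'I_n -> bool * bool * bool}) : vec := [ffun q => (false, (w q).1.2)].
Definition wc (w : {ffun 'I_n -> bool * bool * bool}) : vec := [ffun q => (false, (w q).2)].

(** The one-qubit identity multiplied over the qubits; on a qubit without a gate only the index 0
    survives. *)
Lemma T_identity : Ad (That R n k) Pi = \sum_w tau w *: g (wu w) (wb w) (wc w).
Proof.
have -> : Pi = (D * D)^-1 *: \sum_a p4 a.
  by rewrite /sproj; congr (_ *: _); apply: eq_bigr => a _; rewrite chiv0 scale1r.
rewrite AdZ Ad_sum.
have -> : \sum_w tau w *: g (wu w) (wb w) (wc w) = (D * D)^-1 *: \sum_w \sum_a (tau w * chi a (wu w)) *: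
  t4 (P a *m P (wb w)) (P a *m P (wc w)) (P a *m P (wb w) *m P (wc w)) (P a).
  rewrite scaler_sumr; apply: eq_bigr => w _; rewrite sectE scalerA mulrC -scalerA scaler_sumr.
  by congr (_ *: _); apply: eq_bigr => a _; rewrite scalerA.
congr (_ *: _); apply: mat4P => i1 i2 i3 i4 j1 j2 j3 j4.
pose bt (i : 'I_d) (q : 'I_n) := bit (n - 1 - q) i.
pose F q a := (adj (Tq R (isT q)) *m sig R a *m Tq R (isT q)).
have Fa (a : vec) i j : (adj (That R n k) *m P a *m That R n k) i j = \prod_q F q (a q) (bt i q) (bt j q).
  by rewrite ThatE pauli_vecE tens_adj !tens_mul mxE.
rewrite summxE.
transitivity (\sum_(a : vec) \prod_q (F q (a q) (bt i1 q) (bt j1 q) * F q (a q) (bt i2 q) (bt j2 q)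
   * F q (a q) (bt i3 q) (bt j3 q) * F q (a q) (bt i4 q) (bt j4 q))).
  by apply: eq_bigr => a _; rewrite p4E Ad_t4 t4E !Fa !big_split.
rewrite -(bigA_distr_bigA (fun q a => F q a (bt i1 q) (bt j1 q) * F q a (bt i2 q) (bt j2 q)
   * F q a (bt i3 q) (bt j3 q) * F q a (bt i4 q) (bt j4 q))).
pose H q (x : bool * bool * bool) a := tau1 R (isT q) x * ((-1) ^+ sf1 a (false, x.1.1) *
     ((sig R a *m sig R (false, x.1.2)) (bt i1 q) (bt j1 q) * (sig R a *m sig R (false, x.2)) (bt i2 q) (bt j2 q)
     * (sig R a *m sig R (false, x.1.2) *m sig R (false, x.2)) (bt i3 q) (bt j3 q) * sig R a (bt i4 q) (bt j4 q))).
rewrite (eq_bigr (fun q => \sum_x \sum_a H q x a)) => [|q _]; last exact: one_qubit.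
rewrite bigA_distr_bigA summxE; apply: eq_bigr => w _.
rewrite bigA_distr_bigA summxE; apply: eq_bigr => a _.
rewrite mxE t4E !pauli_vecE !tens_mul !mxE chi_prod /tau -!big_split; apply: eq_bigr => q _ /=.
by rewrite /H !ffunE /bt -[RHS]mulrA.
Qed.

(** A linear relation between strings of Z holds qubit by qubit, so the sum factors. The n - k
    qubits without a gate contribute 1, because their only index 0 satisfies the pattern. *)
Lemma sum_tau (pat : bool * bool * bool -> bool) : (k <= n)%N -> pat 0 ->
  \sum_w tau w * [forall q, pat (w q)]%:R
   = (1 - 4^-1 * \sum_(x | pat x) (-1) ^+ x.1.1) ^+ k.
Proof.
move=> hk pat0.
transitivity (\sum_(w : {ffun 'I_n -> bool * bool * bool}) \prod_q (tau1 R (isT q) (w q) * (pat (w q))%:R)).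
  apply: eq_bigr => w _; rewrite big_split; congr (_ * _).
  case: (boolP [forall q, pat (w q)]) => [/forallP h|/forallPn [q /negbTE h]].
    by rewrite big1 // => q _; rewrite h.
  by rewrite (bigD1 q) //= h mul0r.
rewrite -(bigA_distr_bigA (fun q x => tau1 R (isT q) x * (pat x)%:R)).
have E q : \sum_x tau1 R (isT q) x * (pat x)%:R =
    if isT q then 1 - 4^-1 * \sum_(x | pat x) (-1) ^+ x.1.1 else 1.
  rewrite /tau1; under eq_bigr => x _ do rewrite mulrBl.
  rewrite sumrB (bigD1 (0 : bool * bool * bool)) //= pat0 ?eqxx mulr1 big1 => [|x /negbTE ->]; last by rewrite mul0r.
  rewrite addr0; case: (isT q); last by rewrite big1 ?subr0 // => x _; rewrite mul0r.
  congr (_ - _); rewrite mulr_sumr [RHS]big_mkcond; apply: eq_bigr => x _.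
  by case: (pat x); rewrite ?mulr1 ?mulr0.
rewrite (eq_bigr _ (fun q _ => E q)) -big_mkcond.
set x := 1 - _.
have := big_geq_mkord (n - k) n xpredT (fun=> x) (idx := 1) (op := *%R).
by rewrite /isT /= => <-; rewrite prodr_const_nat subKn.
Qed.

End TLayer.

(** * Permutation operators and their invariance *)

Section Invariance.
Variable R : realType.
Local Notation C := R[i].
Variable n : nat.
Local Notation d := (2 ^ n)%N.
Local Notation Mat := 'M[C]_d.
Local Notation Mat4 := 'M[C]_(d * d * (d * d)).
Local Notation P := (@pauli_vec R n).
Local Notation chi := (@symp_sign n C).
Local Notation vec := (vec n).
Local Notation D := (d%:R : C).
Local Notation p4 := (@p4 R n).
Local Notation p13 := (@p13 R n).
Local Notation p23 := (@p23 R n).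
Local Notation g := (sect chi D p4 p13 p23).
Local Notation Pi := (sproj chi D p4 0).
Local Notation s12 := (sw12 D p13 p23).
Local Notation s13 := (sw13 D p13).
Local Notation s23 := (sw23 D p23).
Local Notation R4 := (klein4 chi D p4 p13 p23).
Implicit Types (X Y U : Mat) (M : Mat4) (u v w a b c e : vec).

(** All six transpositions are treated, because the Klein four-group consists of products of two
    disjoint ones. *)
Lemma Ad_sum12 U : unitary U -> Ad U (\sum_b t4 (P b) (P b) 1%:M 1%:M) = \sum_b t4 (P b) (P b) 1%:M 1%:M.
Proof.
move=> hU; rewrite Ad_sum (eq_bigr _ (fun b _ => Ad_t4 _ _ _ _ _)) mulmx1 hU.
apply: mat4P => *; rewrite !sumt4E -!mulr_suml; congr (_ * _ * _); exact: pauli_swapU.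
Qed.

Lemma Ad_sum34 U : unitary U -> Ad U (\sum_b t4 1%:M 1%:M (P b) (P b)) = \sum_b t4 1%:M 1%:M (P b) (P b).
Proof.
move=> hU; rewrite Ad_sum (eq_bigr _ (fun b _ => Ad_t4 _ _ _ _ _)) mulmx1 hU.
apply: mat4P => *; rewrite !sumt4E.
under eq_bigr do rewrite -!mulrA; under [RHS]eq_bigr do rewrite -!mulrA.
rewrite -!mulr_sumr; congr (_ * (_ * _)); exact: pauli_swapU.
Qed.

Lemma Ad_sum13 U : unitary U -> Ad U (\sum_b t4 (P b) 1%:M (P b) 1%:M) = \sum_b t4 (P b) 1%:M (P b) 1%:M.
Proof.
move=> hU; rewrite Ad_sum (eq_bigr _ (fun b _ => Ad_t4 _ _ _ _ _)) mulmx1 hU.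
apply: mat4P => *; rewrite !sumt4E -!mulr_suml; congr (_ * _).
under eq_bigr do rewrite mulrAC; under [RHS]eq_bigr do rewrite mulrAC.
by rewrite -!mulr_suml; congr (_ * _); exact: pauli_swapU.
Qed.

Lemma Ad_sum24 U : unitary U -> Ad U (\sum_b t4 1%:M (P b) 1%:M (P b)) = \sum_b t4 1%:M (P b) 1%:M (P b).
Proof.
move=> hU; rewrite Ad_sum (eq_bigr _ (fun b _ => Ad_t4 _ _ _ _ _)) mulmx1 hU.
apply: mat4P => *; rewrite !sumt4E.
under eq_bigr do rewrite mulrAC -!mulrA; under [RHS]eq_bigr do rewrite mulrAC -!mulrA.
rewrite -!mulr_sumr; congr (_ * _).
under eq_bigr do rewrite mulrA; under [RHS]eq_bigr do rewrite mulrA.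
by rewrite -!mulr_suml; congr (_ * _); exact: pauli_swapU.
Qed.

Lemma Ad_sum23 U : unitary U -> Ad U (\sum_b t4 1%:M (P b) (P b) 1%:M) = \sum_b t4 1%:M (P b) (P b) 1%:M.
Proof.
move=> hU; rewrite Ad_sum (eq_bigr _ (fun b _ => Ad_t4 _ _ _ _ _)) mulmx1 hU.
apply: mat4P => *; rewrite !sumt4E -!mulr_suml; congr (_ * _).
under eq_bigr do rewrite -!mulrA; under [RHS]eq_bigr do rewrite -!mulrA.
by rewrite -!mulr_sumr; congr (_ * _); exact: pauli_swapU.
Qed.

Lemma Ad_sum14 U : unitary U -> Ad U (\sum_b t4 (P b) 1%:M 1%:M (P b)) = \sum_b t4 (P b) 1%:M 1%:M (P b).
Proof.
move=> hU; rewrite Ad_sum (eq_bigr _ (fun b _ => Ad_t4 _ _ _ _ _)) mulmx1 hU.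
apply: mat4P => *; rewrite !sumt4E.
under eq_bigr do rewrite mulrAC; under [RHS]eq_bigr do rewrite mulrAC.
rewrite -!mulr_suml; congr (_ * _).
under eq_bigr do rewrite mulrAC; under [RHS]eq_bigr do rewrite mulrAC.
by rewrite -!mulr_suml; congr (_ * _); exact: pauli_swapU.
Qed.

Lemma s12E : s12 = D^-1 *: \sum_b t4 (P b) (P b) 1%:M 1%:M.
Proof. by congr (_ *: _); apply: eq_bigr => b _; rewrite /pp12 p13_23 p12E. Qed.
Lemma s13E : s13 = D^-1 *: \sum_b t4 (P b) 1%:M (P b) 1%:M.
Proof. by congr (_ *: _); apply: eq_bigr => b _; rewrite p13E. Qed.
Lemma s23E : s23 = D^-1 *: \sum_b t4 1%:M (P b) (P b) 1%:M.
Proof. by congr (_ *: _); apply: eq_bigr => b _; rewrite p23E. Qed.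

Lemma Ad_s12 U : unitary U -> Ad U s12 = s12.
Proof. by move=> hU; rewrite s12E AdZ Ad_sum12. Qed.
Lemma Ad_s13 U : unitary U -> Ad U s13 = s13.
Proof. by move=> hU; rewrite s13E AdZ Ad_sum13. Qed.
Lemma Ad_s23 U : unitary U -> Ad U s23 = s23.
Proof. by move=> hU; rewrite s23E AdZ Ad_sum23. Qed.

(** The first sum is the completeness of the sector projectors. In the other three the shift of u by
    a makes the two phases of P a P (a + u) combine to a sign, which cancels the character in the
    projector. *)
Lemma klein4_perms : R4 = 1%:M
  + (D * D)^-1 *: ((\sum_b t4 (P b) 1%:M (P b) 1%:M) *m (\sum_b t4 1%:M (P b) 1%:M (P b)))
  + (D * D)^-1 *: ((\sum_b t4 1%:M (P b) (P b) 1%:M) *m (\sum_b t4 (P b) 1%:M 1%:M (P b)))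
  + (D * D)^-1 *: ((\sum_b t4 (P b) (P b) 1%:M 1%:M) *m (\sum_b t4 1%:M 1%:M (P b) (P b))).
Proof.
have DDn : D * D != 0 by rewrite mulf_neq0 ?D_neq0.
rewrite /klein4 !big_split /=.
have E0 : \sum_u g u 0 0 = 1%:M.
  rewrite (eq_bigr _ (fun u _ => sectE R _ _ _)) -scaler_sumr exchange_big (bigD1 0) //=.
  rewrite [X in _ + X]big1 ?addr0 => [|a ha].
    rewrite -scaler_suml (eq_bigr (fun=> 1)) => [|u _]; last by rewrite chi0v.
    rewrite sumr_const card_ffun card_prod card_bool card_ord !pauli_vec0 !mulmx1 t4_1.
    by rewrite scalerA -dim_sqr mulVf ?scale1r.
  rewrite -scaler_suml (eq_bigr (fun u => chi u a)) => [|u _]; last by rewrite chiC.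
  by rewrite sum_chi (negbTE ha) mulr0n scale0r.
have E (F1 F2 : vec -> Mat4) (G : vec -> vec -> Mat4) :
    (forall a u, chi a (a + u) *: G a (a + u) = F1 u *m F2 a) ->
    \sum_u (D * D)^-1 *: \sum_a chi a u *: G a u = (D * D)^-1 *: ((\sum_b F1 b) *m (\sum_b F2 b)).
  move=> h; rewrite -scaler_sumr; congr (_ *: _); rewrite exchange_big mulmx_sumr; apply: eq_bigr => a _ /=.
  by rewrite mulmx_suml (reindex_inj (addrI a)); apply: eq_bigr => u _; rewrite h.
have hk a u : chi a (a + u) * (kap R a (a + u) * kap R a (a + u)) = 1.
  by rewrite kap_sqr chi_sqr.
have E1 : \sum_u g u u 0 = (D * D)^-1 *: ((\sum_b t4 (P b) 1%:M (P b) 1%:M) *m (\sum_b t4 1%:M (P b) 1%:M (P b))).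
  rewrite -(E _ _ (fun a u => t4 (P a *m P u) (P a *m P 0) (P a *m P u *m P 0) (P a))) => [|a u].
    by apply: eq_bigr => u _; exact: sectE.
  rewrite pauli_vec0 !mulmx1 !pauli_mul addKvec t4_mul !mulmx1 !mul1mx.
  by apply: mat4P => *; rewrite mxE !t4E !mxE -[RHS]mul1r -(hk a u); ring.
have E2 : \sum_u g u 0 u = (D * D)^-1 *: ((\sum_b t4 1%:M (P b) (P b) 1%:M) *m (\sum_b t4 (P b) 1%:M 1%:M (P b))).
  rewrite -(E _ _ (fun a u => t4 (P a *m P 0) (P a *m P u) (P a *m P 0 *m P u) (P a))) => [|a u].
    by apply: eq_bigr => u _; exact: sectE.
  rewrite pauli_vec0 !mulmx1 !pauli_mul addKvec t4_mul !mulmx1 !mul1mx.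
  by apply: mat4P => *; rewrite mxE !t4E !mxE -[RHS]mul1r -(hk a u); ring.
have E3 : \sum_u g u u u = (D * D)^-1 *: ((\sum_b t4 (P b) (P b) 1%:M 1%:M) *m (\sum_b t4 1%:M 1%:M (P b) (P b))).
  rewrite -(E _ _ (fun a u => t4 (P a *m P u) (P a *m P u) (P a *m P u *m P u) (P a))) => [|a u].
    by apply: eq_bigr => u _; exact: sectE.
  rewrite -[P a *m P (a + u) *m P _]mulmxA pauli_sqr !mulmx1 !pauli_mul addKvec t4_mul !mulmx1 !mul1mx.
  by apply: mat4P => *; rewrite mxE !t4E !mxE -[RHS]mul1r -(hk a u); ring.
exact: (f_equal2 +%R (f_equal2 +%R (f_equal2 +%R E0 E1) E2) E3).
Qed.

Lemma Ad_klein4 U : unitary U -> Ad U R4 = R4.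
Proof.
move=> hU.
have inv2 (A B : Mat4) : Ad U A = A -> Ad U B = B ->
    Ad U ((D * D)^-1 *: (A *m B)) = (D * D)^-1 *: (A *m B).
  by move=> hA hB; rewrite AdZ (Ad_mul _ _ hU) hA hB.
have inv4 (A B B' B'' : Mat4) : Ad U A = A -> Ad U B = B -> Ad U B' = B' -> Ad U B'' = B'' ->
    Ad U (A + B + B' + B'') = A + B + B' + B''.
  by move=> h1 h2 h3 h4; rewrite !AdD h1 h2 h3 h4.
rewrite klein4_perms; apply: inv4; first exact: Ad1.
- by apply: inv2; [exact: Ad_sum13 | exact: Ad_sum24].
- by apply: inv2; [exact: Ad_sum23 | exact: Ad_sum14].
- by apply: inv2; [exact: Ad_sum12 | exact: Ad_sum34].
Qed.

Lemma PiE : Pi = (D * D)^-1 *: \sum_a p4 a.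
Proof. by congr (_ *: _); apply: eq_bigr => a _; rewrite chiv0 scale1r. Qed.

Lemma Ad_Pi U : clifford U -> Ad U Pi = Pi.
Proof.
move=> [uU cU]; have uU' := unitaryC uU.
have ex v : exists w x, x * x = 1 /\ U *m P v *m adj U = x *: P w.
  have [x [s' h]] := cU (enc v); rewrite pauli_enc in h.
  have [dec encK decK] := enc_bij n.
  exists (dec s'), x; rewrite -(pauli_enc R (dec s')) decK; split=> //.
  have hd : (0 < d)%N by rewrite expn_gt0.
  have : (x * x) *: 1%:M = 1%:M :> Mat.
    rewrite -(pauli_sqr R (dec s')) -(pauli_enc R (dec s')) decK -scalerA scalemxAr scalemxAl -h.
    rewrite -!mulmxA (mulmxA (adj U)) uU mul1mx (mulmxA (P v)) pauli_sqr mul1mx uU'.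
    by rewrite -(decK s') pauli_enc pauli_sqr.
  move/matrixP/(_ (Ordinal hd) (Ordinal hd)); by rewrite !mxE eqxx mulr1.
have [tau htau] := fin_all_exists ex.
have Uconj v : exists2 x, x * x = 1 & adj (adj U) *m P v *m adj U = x *: P (tau v).
  by have [x [h1 h2]] := htau v; exists x => //; rewrite adjcK.
(* Equal images would make P v a multiple of P w, so P (v + w) would be a nonzero multiple of the
   identity; but it is traceless for v different from w. *)
have tau_inj : injective tau.
  move=> v w e; have [x [hx hv]] := htau v; have [y [hy hw]] := htau w.
  apply/eqP; rewrite -addvec_eq0; apply/negPn/negP => hvw.
  have hP : P v = (x * y) *: P w.
    have back X : adj U *m (U *m X *m adj U) *m U = X.
      by rewrite !mulmxA uU mul1mx -mulmxA uU mulmx1.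
    rewrite -[P v]back hv e -[P w]back hw -!scalemxAr -!scalemxAl scalerA.
    by rewrite -mulrA hy mulr1.
  have := mxtrace_pauli R (v + w); rewrite (negbTE hvw) mulr0n.
  have hk : kap R v w != 0.
    by apply/eqP => k0; have := kap_sqr R v w; rewrite k0 mul0r /symp_sign => /esym/eqP; rewrite signr_eq0.
  have -> : P (v + w) = (kap R v w)^-1 *: (P v *m P w) by rewrite pauli_mul scalerA mulVf ?scale1r.
  rewrite hP -scalemxAl pauli_sqr scalerA mxtraceZ mxtrace1 => /eqP.
  rewrite !mulf_eq0 invr_eq0 (negbTE hk) (negbTE (D_neq0 R n)) orbF /=.
  by case/orP => /eqP z; [move: hx | move: hy]; rewrite z mul0r => /eqP; rewrite eq_sym oner_eq0.
have AdU' : Ad (adj U) Pi = Pi.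
  rewrite PiE AdZ Ad_sum; congr (_ *: _); rewrite [RHS](reindex_inj tau_inj).
  by apply: eq_bigr => a _; apply: Ad_p4.
by rewrite -[in LHS]AdU' Ad_comp uU /Ad t4_1 adjc1 mulmx1 mul1mx.
Qed.

End Invariance.

(** * Class sums of a T layer *)

Section PatternSums.
Variable R : realType.
Local Notation C := R[i].
Variables n k : nat.
Hypothesis hk : (k <= n)%N.
Local Notation chi := (@symp_sign n C).
Local Notation vec := (vec n).
Local Notation pattern := (bool * bool * bool -> bool).
Local Notation tau := (@tau R n k).
Implicit Types (w : {ffun 'I_n -> bool * bool * bool}) (p : pattern).

Let I p w : C := [forall q, p (w q)]%:R.
Let cnt p : C := \sum_(x | p x) (-1) ^+ x.1.1.

Let cntE p : cnt p = \sum_y \sum_c (if p (y, c) then (-1) ^+ y.1 else 0).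
Proof. by rewrite /cnt big_mkcond (pair_big predT predT) /=; apply: eq_bigr => -[]. Qed.

Let J p v : p 0 -> cnt p = v -> \sum_w tau w * I p w = (1 - 4^-1 * v) ^+ k.
Proof. by move=> p0 <-; rewrite sum_tau. Qed.

Let II p p' w : I p w * I p' w = I (fun x => p x && p' x) w.
Proof.
rewrite /I -natrM mulnb; congr ((nat_of_bool _)%:R); apply/andP/forallP => [[/forallP h /forallP h'] q|h].
  by rewrite h h'.
by split; apply/forallP => q; case/andP: (h q).
Qed.

Let wE (f f' : bool * bool * bool -> bool) w :
  ([ffun q => (false, f (w q))] == [ffun q => (false, f' (w q))] :> vec)
   = [forall q, f (w q) == f' (w q)].
Proof.
apply/eqP/forallP => [/ffunP h q|h]; last by apply/ffunP => q; rewrite !ffunE (eqP (h q)).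
by have := h q; rewrite !ffunE => -[->].
Qed.

Let w0E : (0 : vec) = [ffun q : 'I_n => (false, false)].
Proof. by apply/ffunP => q; rewrite !ffunE. Qed.
Let wbuE w : wb w + wu w = [ffun q => (false, (w q).1.2 (+) (w q).1.1)].
Proof. by apply/ffunP => q; rewrite !ffunE. Qed.

Lemma chi_Z (x y : 'I_n -> bool) : chi [ffun q => (false, x q)] [ffun q => (false, y q)] = 1.
Proof. by rewrite /symp_sign /sf big1 // => q _; rewrite !ffunE /sf1 /= andbF. Qed.

Variables (t : vec -> vec -> vec -> C).
Variables (a0 ab ac abc a2 c00 cu0 c0u cuu d0 du e0 eu f0 fu c2 : C).
Notation dl b c := ((b == c)%:R : C).
Hypothesis tX : forall b c, chi b c = 1 -> t 0 b c =
  a2 + (ab - a2) * dl c 0 + (ac - a2) * dl b 0 + (abc - a2) * dl c b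
  + (a0 - ab - ac - abc + a2 + a2) * (dl b 0 * dl c 0).
Hypothesis tY : forall u b c, u != 0 -> chi u b = 1 -> chi u c = 1 -> chi b c = 1 ->
  t u b c = c2 + (d0 - c2) * dl c 0 + (du - c2) * dl c u + (e0 - c2) * dl b 0 + (eu - c2) * dl b u
  + (f0 - c2) * dl c b + (fu - c2) * dl c (b + u)
  + (c00 - d0 - e0 - f0 + c2 + c2) * (dl b 0 * dl c 0)
  + (cu0 - d0 - eu - fu + c2 + c2) * (dl b u * dl c 0)
  + (c0u - du - e0 - fu + c2 + c2) * (dl b 0 * dl c u)
  + (cuu - du - eu - f0 + c2 + c2) * (dl b u * dl c u).
Let c6 := d0 + du + e0 + eu + f0 + fu.
Let c4 := c00 + cu0 + c0u + cuu.
Let a3 := ab + ac + abc.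

(** The bases of the powers are 1 - v/4, where v is the sum of the signs over the one-qubit indices
    that satisfy the relation. For u = 0 alone v is 4, with one more relation it is 2, for u = b = c
    = 0 it is 1, and it is 0 whenever u is left free. This is the source of 0, 1/2, 3/4 and 1. *)
Lemma sum_tau_class : \sum_w tau w * t (wu w) (wb w) (wc w) =
  0 ^+ k * a2 + 2^-1 ^+ k * (a3 - 3 * a2) + (3 / 4) ^+ k * (a0 - a3 + 2 * a2)
  + (1 - 0 ^+ k) * c2 + (1 - 2^-1 ^+ k) * (c6 - 6 * c2) + (1 - (3 / 4) ^+ k) * (c4 - 2 * c6 + 8 * c2).
Proof.
pose pu : pattern := fun x => x.1.1 == false.
pose pb : pattern := fun x => x.1.2 == false.
pose pc : pattern := fun x => x.2 == false.
pose pbc : pattern := fun x => x.2 == x.1.2.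
pose pbu : pattern := fun x => x.1.2 == x.1.1.
pose pcu : pattern := fun x => x.2 == x.1.1.
pose pcbu : pattern := fun x => x.2 == x.1.2 (+) x.1.1.
pose k1 := c00 - d0 - e0 - f0 + c2 + c2.
pose k2 := cu0 - d0 - eu - fu + c2 + c2.
pose k3 := c0u - du - e0 - fu + c2 + c2.
pose k4 := cuu - du - eu - f0 + c2 + c2.
pose k0 := a0 - ab - ac - abc + a2 + a2.
(* The formula for nonzero u, plus the indicator of u = 0 times the difference of the two formulas,
   written as a list of coefficients and patterns. At u = 0 the patterns that compare with u turn
   into patterns that compare with 0. *)
pose l := [:: (a2 - c2, pu); (ab - a2 - (d0 - c2), fun x => pu x && pc x); (ac - a2 - (e0 - c2), fun x => pu x && pb x);
  (abc - a2 - (f0 - c2), fun x => pu x && pbc x); (k0 - k1, fun x => pu x && (pb x && pc x));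
  (c2, fun=> true); (d0 - c2, pc); (du - c2, pcu); (e0 - c2, pb); (eu - c2, pbu); (f0 - c2, pbc); (fu - c2, pcbu);
  (- (du - c2), fun x => pu x && pcu x); (- (eu - c2), fun x => pu x && pbu x); (- (fu - c2), fun x => pu x && pcbu x);
  (k1, fun x => pb x && pc x); (k2, fun x => pbu x && pc x); (k3, fun x => pb x && pcu x); (k4, fun x => pbu x && pcu x);
  (- k2, fun x => pu x && (pbu x && pc x)); (- k3, fun x => pu x && (pb x && pcu x)); (- k4, fun x => pu x && (pbu x && pcu x))].
transitivity (\sum_w \sum_(cp <- l) tau w * (cp.1 * I cp.2 w)).
  apply: eq_bigr => w _; rewrite -mulr_sumr; congr (_ * _).
  rewrite /l !big_cons big_nil -!II /=.
  have -> : I (fun=> true) w = 1 by rewrite /I; case: forallP => // h; case: h.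
  have [hu hb hc] : [/\ chi (wu w) (wb w) = 1, chi (wu w) (wc w) = 1 & chi (wb w) (wc w) = 1].
    by split; exact: chi_Z.
  have e1 : dl (wc w) 0 = I pc w.
    by congr ((nat_of_bool _)%:R); rewrite w0E; exact: (wE (fun x => x.2) (fun=> false) w).
  have e2 : dl (wb w) 0 = I pb w.
    by congr ((nat_of_bool _)%:R); rewrite w0E; exact: (wE (fun x => x.1.2) (fun=> false) w).
  have e3 : dl (wc w) (wb w) = I pbc w.
    by congr ((nat_of_bool _)%:R); exact: (wE (fun x => x.2) (fun x => x.1.2) w).
  have e4 : dl (wb w) (wu w) = I pbu w.
    by congr ((nat_of_bool _)%:R); exact: (wE (fun x => x.1.2) (fun x => x.1.1) w).
  have e5 : dl (wc w) (wu w) = I pcu w.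
    by congr ((nat_of_bool _)%:R); exact: (wE (fun x => x.2) (fun x => x.1.1) w).
  have e6 : dl (wc w) (wb w + wu w) = I pcbu w.
    by congr ((nat_of_bool _)%:R); rewrite wbuE; exact: (wE (fun x => x.2) (fun x => x.1.2 (+) x.1.1) w).
  have e7 : dl (wu w) 0 = I pu w.
    by congr ((nat_of_bool _)%:R); rewrite w0E; exact: (wE (fun x => x.1.1) (fun=> false) w).
  have [u0|u0] := eqVneq (wu w) 0.
    have x5 : I pbu w = I pb w by rewrite -e4 -e2 u0.
    have x6 : I pcu w = I pc w by rewrite -e5 -e1 u0.
    have x7 : I pcbu w = I pbc w by rewrite -e6 -e3 u0 addr0.
    by rewrite u0 tX // e1 e2 e3 x5 x6 x7 -e7 u0 eqxx /= /k0; ring.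
  by rewrite tY // e1 e2 e3 e4 e5 e6 -e7 (negbTE u0) /= /k1 /k2 /k3 /k4; ring.
rewrite exchange_big /=.
transitivity (\sum_(cp <- l) cp.1 * \sum_w tau w * I cp.2 w).
  by apply: eq_bigr => cp _; rewrite mulr_sumr; apply: eq_bigr => w _; rewrite mulrCA.
rewrite /l !big_cons big_nil /=.
have cE p v : (\sum_y \sum_c (if p (y, c) then (-1) ^+ y.1 else 0)) = v -> cnt p = v by rewrite cntE.
have J1 p : p 0 -> cnt p = 0 -> \sum_w tau w * I p w = 1.
  by move=> p0 /(J p0) ->; rewrite mulr0 subr0 expr1n.
have Jg p : p 0 -> cnt p = 1 -> \sum_w tau w * I p w = (3 / 4) ^+ k.
  by move=> p0 /(J p0) ->; congr (_ ^+ _); field.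
have Jh p : p 0 -> cnt p = 2 -> \sum_w tau w * I p w = 2^-1 ^+ k.
  by move=> p0 /(J p0) ->; congr (_ ^+ _); field.
have Jz p : p 0 -> cnt p = 4 -> \sum_w tau w * I p w = 0 ^+ k.
  by move=> p0 /(J p0) ->; congr (_ ^+ _); field.
have t1 : cnt pu = 4 by rewrite cntE big_bool2 !big_bool /=; ring.
have u1 : cnt (fun x => pu x && pc x) = 2 by rewrite cntE big_bool2 !big_bool /=; ring.
have u2 : cnt (fun x => pu x && pb x) = 2 by rewrite cntE big_bool2 !big_bool /=; ring.
have u3 : cnt (fun x => pu x && pbc x) = 2 by rewrite cntE big_bool2 !big_bool /=; ring.
have u4 : cnt (fun x => pu x && pcu x) = 2 by rewrite cntE big_bool2 !big_bool /=; ring.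
have u5 : cnt (fun x => pu x && pbu x) = 2 by rewrite cntE big_bool2 !big_bool /=; ring.
have u6 : cnt (fun x => pu x && pcbu x) = 2 by rewrite cntE big_bool2 !big_bool /=; ring.
have v1 : cnt (fun x => pu x && (pb x && pc x)) = 1 by rewrite cntE big_bool2 !big_bool /=; ring.
have v2 : cnt (fun x => pu x && (pbu x && pc x)) = 1 by rewrite cntE big_bool2 !big_bool /=; ring.
have v3 : cnt (fun x => pu x && (pb x && pcu x)) = 1 by rewrite cntE big_bool2 !big_bool /=; ring.
have v4 : cnt (fun x => pu x && (pbu x && pcu x)) = 1 by rewrite cntE big_bool2 !big_bool /=; ring.
have w0 : cnt (fun=> true) = 0 by rewrite cntE big_bool2 !big_bool /=; ring.
have w1 : cnt pc = 0 by rewrite cntE big_bool2 !big_bool /=; ring.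
have w2 : cnt pcu = 0 by rewrite cntE big_bool2 !big_bool /=; ring.
have w3 : cnt pb = 0 by rewrite cntE big_bool2 !big_bool /=; ring.
have w4 : cnt pbu = 0 by rewrite cntE big_bool2 !big_bool /=; ring.
have w5 : cnt pbc = 0 by rewrite cntE big_bool2 !big_bool /=; ring.
have w6 : cnt pcbu = 0 by rewrite cntE big_bool2 !big_bool /=; ring.
have y1 : cnt (fun x => pb x && pc x) = 0 by rewrite cntE big_bool2 !big_bool /=; ring.
have y2 : cnt (fun x => pbu x && pc x) = 0 by rewrite cntE big_bool2 !big_bool /=; ring.
have y3 : cnt (fun x => pb x && pcu x) = 0 by rewrite cntE big_bool2 !big_bool /=; ring.
have y4 : cnt (fun x => pbu x && pcu x) = 0 by rewrite cntE big_bool2 !big_bool /=; ring.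
rewrite (Jz _ _ t1) // (Jh _ _ u1) // (Jh _ _ u2) // (Jh _ _ u3) // (Jh _ _ u4) // (Jh _ _ u5) // (Jh _ _ u6) //.
rewrite (Jg _ _ v1) // (Jg _ _ v2) // (Jg _ _ v3) // (Jg _ _ v4) //.
rewrite (J1 _ _ w0) // (J1 _ _ w1) // (J1 _ _ w2) // (J1 _ _ w3) // (J1 _ _ w4) // (J1 _ _ w5) // (J1 _ _ w6) //.
rewrite (J1 _ _ y1) // (J1 _ _ y2) // (J1 _ _ y3) // (J1 _ _ y4) //.
rewrite /k0 /k1 /k2 /k3 /k4 /c4 /c6 /a3.
move: (0 ^+ k) ((2 : C)^-1 ^+ k) ((3 / 4 : C) ^+ k) => Z H0 G0.
ring.
Qed.

End PatternSums.

(** * Image of the sector projector under one layer *)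

Section OneLayer.
Variable R : realType.
Local Notation C := R[i].
Variable n k : nat.
Hypothesis hk : (k <= n)%N.
Local Notation d := (2 ^ n)%N.
Local Notation Mat := 'M[C]_d.
Local Notation Mat4 := 'M[C]_(d * d * (d * d)).
Local Notation P := (@pauli_vec R n).
Local Notation chi := (@symp_sign n C).
Local Notation vec := (vec n).
Local Notation D := (d%:R : C).
Local Notation p4 := (@p4 R n).
Local Notation p13 := (@p13 R n).
Local Notation p23 := (@p23 R n).
Local Notation g := (sect chi D p4 p13 p23).
Local Notation Pi := (sproj chi D p4 0).
Local Notation s12 := (sw12 D p13 p23).
Local Notation s13 := (sw13 D p13).
Local Notation s23 := (sw23 D p23).
Local Notation R4 := (klein4 chi D p4 p13 p23).
Local Notation tra := (s12 + s13 + s23).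
Local Notation cyc := (s13 *m s23 + s23 *m s13).
Implicit Types (X Y U : Mat) (M : Mat4) (u v w a b c e : vec).
Variables (m : nat) (S : 'I_m -> Mat).
Hypothesis HS : clifford_transversal S.
Local Notation TW := (twirl S).

Lemma sum_chiD (b : vec) : \sum_u chi u b = (D * D) *+ (b == 0).
Proof. by rewrite dim_sqr sum_chi. Qed.

Lemma twirl_clifford_fix M : (forall U, clifford U -> Ad U M = M) -> TW M = M.
Proof.
move=> h; rewrite /twirl (eq_bigr (fun=> M)) => [|j _]; last by apply: h; have [] := HS.
rewrite sumr_const card_ord -[M *+ m]scaler_nat scalerA mulVf ?scale1r //.
by rewrite pnatr_eq0 -lt0n (transversal_gt0 HS).
Qed.

Let fixD U M M' : Ad U M = M -> Ad U M' = M' -> Ad U (M + M') = M + M'.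
Proof. by move=> h h'; rewrite AdD h h'. Qed.
Let fixM U M M' : unitary U -> Ad U M = M -> Ad U M' = M' -> Ad U (M *m M') = M *m M'.
Proof. by move=> hU h h'; rewrite Ad_mul // h h'. Qed.
Let fixZ U x M : Ad U M = M -> Ad U (x *: M) = x *: M.
Proof. by move=> h; rewrite AdZ h. Qed.

Lemma Ad_tra U : unitary U -> Ad U tra = tra.
Proof. by move=> hU; exact: fixD (fixD (Ad_s12 hU) (Ad_s13 hU)) (Ad_s23 hU). Qed.

Lemma Ad_cyc U : unitary U -> Ad U cyc = cyc.
Proof.
by move=> hU; exact: fixD (fixM hU (Ad_s13 hU) (Ad_s23 hU)) (fixM hU (Ad_s23 hU) (Ad_s13 hU)).
Qed.

Variables (xe xt xc ye yt yc : C).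
Let G : C := (3 / 4) ^+ k.
Let H : C := 2^-1 ^+ k.
Let Z : C := 0 ^+ k.
Let N2 : C := D * D.
(** Comparison of coefficients: the first three equations belong to the origin, the lines and the
    generic pairs at u = 0, the last three to the points, the lines and the generic triples at
    nonzero u. *)
Hypothesis E1 : xe + 3 * xt * D^-1 + 2 * xc * N2^-1 = G.
Hypothesis E2 : (N2 - 1) * (xt * D^-1 + 2 * xc * N2^-1) = H - G.
Hypothesis E3 : (N2 - 1) * (N2 - 4) * (xc * N2^-1) = Z - 3 * H + 2 * G.
Hypothesis E4 : (N2 - 1) * 4^-1 * (ye + 6 * yt * D^-1 + 8 * yc * N2^-1) = 1 - G.
Hypothesis E5 : (N2 - 1) * 4^-1 * (N2 - 4) * (yt * D^-1 + 4 * yc * N2^-1) = 2 * G - H - 1.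
Hypothesis E6 : (N2 - 1) * 4^-1 * (N2 - 4) * (N2 - 16) * (yc * N2^-1) = 3 - 8 * G + 6 * H - Z.

Definition layer_image : Mat4 :=
  (xe - ye) *: Pi + (xt - yt) *: (Pi *m tra) + (xc - yc) *: (Pi *m cyc)
  + 4^-1 *: (ye *: R4 + yt *: (R4 *m tra) + yc *: (R4 *m cyc)).

Lemma twirl_layer_image : TW layer_image = layer_image.
Proof.
apply: twirl_clifford_fix => U cU; have hU := proj1 cU.
have hP := Ad_Pi cU; have hR := Ad_klein4 hU; have ht := Ad_tra hU; have hc := Ad_cyc hU.
exact: fixD (fixD (fixD (fixZ _ hP) (fixZ _ (fixM hU hP ht))) (fixZ _ (fixM hU hP hc)))
  (fixZ _ (fixD (fixD (fixZ _ hR) (fixZ _ (fixM hU hR ht))) (fixZ _ (fixM hU hR hc)))).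
Qed.

(** Since [layer_image] is Clifford invariant, it equals its own twirl, and both sides can be
    compared through a matrix entry of the twirl. Each becomes a linear form in six sums of class
    values, one for each of [E1] to [E6]. *)
Lemma twirl_T_Pi : TW (Ad (That R n k) Pi) = layer_image.
Proof.
rewrite -twirl_layer_image; apply/matrixP => i j.
pose L M := TW M i j.
have LD M M' : L (M + M') = L M + L M' by rewrite /L twirlD mxE.
have LZ x M : L (x *: M) = x * L M by rewrite /L twirlZ mxE.
pose t u b c := L (g u b c).
have tinv e u b c : t (transvect e u) (transvect e b) (transvect e c) = t u b c.
  by have h := twirl_sect HS e u b c; exact: (f_equal (fun M => fun_of_matrix M i j) h).
have [ab [ac [abc [a2 [c00 [cu0 [c0u [cuu [d0 [du [e0 [eu [f0 [fu [c2 [tX tY]]]]]]]]]]]]]]]] := class3 tinv.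
change (L (Ad (That R n k) Pi) = L layer_image); rewrite /layer_image.
rewrite (L_layer_image (D_neq0 R n) (@addvecc n) (@chiC n C) (fun w u v => @chiDr n C u v w) (@chi_sqr n C) (@chivv n C) sum_chiD
  (p13_0 R n) (p23_0 R n) (@p13M R n) (@p23M R n) (@p23_13 R n) LD LZ tX tY).
have L_sum (I : finType) (f : I -> Mat4) : L (\sum_i f i) = \sum_i L (f i).
  by apply: (big_morph _ LD); have := LZ 0 0; rewrite scale0r mul0r.
rewrite T_identity L_sum.
transitivity (\sum_w tau R k w * t (wu w) (wb w) (wc w)); first by apply: eq_bigr => w _; rewrite LZ.
rewrite (sum_tau_class hk tX tY) -/(t 0 0 0) -/N2.
rewrite -/G -/H -/Z.
transitivity (t 0 0 0 * G + (ab + ac + abc) * (H - G) + a2 * (Z - 3 * H + 2 * G) + (c00 + cu0 + c0u + cuu) * (1 - G)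
  + (d0 + du + e0 + eu + f0 + fu) * (2 * G - H - 1) + c2 * (3 - 8 * G + 6 * H - Z)).
  move: (t 0 0 0) => a0; clear; ring.
rewrite -/(t 0 0 0) -E6 -E5 -E4 -E3 -E2 -E1.
move: (t 0 0 0) N2^-1 D^-1 => a0 iN iD; clear; ring.
Qed.

End OneLayer.

(** * The two decay rates *)

Section LayerCoefficients.
Variable F : realFieldType.

(* The six equations say that [layer_image] and the T layer applied to the sector
   projector have the same class sums, where g = (3/4)^k, h = 2^-k and z = 0^k.
   The rates are the eigenvalues on the standard and on the trivial
   representation of S_3. *)
Record coefs (D g h z : F) := Coefs {
  c_xe : F; c_xt : F; c_xc : F; c_ye : F; c_yt : F; c_yc : F; rate_std : F; rate_triv : F;
  cE1 : c_xe + 3 * c_xt * D^-1 + 2 * c_xc * (D * D)^-1 = g;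
  cE2 : (D * D - 1) * (c_xt * D^-1 + 2 * c_xc * (D * D)^-1) = h - g;
  cE3 : (D * D - 1) * (D * D - 4) * (c_xc * (D * D)^-1) = z - 3 * h + 2 * g;
  cE4 : (D * D - 1) * 4^-1 * (c_ye + 6 * c_yt * D^-1 + 8 * c_yc * (D * D)^-1) = 1 - g;
  cE5 : (D * D - 1) * 4^-1 * (D * D - 4) * (c_yt * D^-1 + 4 * c_yc * (D * D)^-1) = 2 * g - h - 1;
  cE6 : (D * D - 1) * 4^-1 * (D * D - 4) * (D * D - 16) * (c_yc * (D * D)^-1)
        = 3 - 8 * g + 6 * h - z;
  rate_stdE : rate_std = c_xe - c_xc - (c_ye - c_yc);
  rate_trivE : rate_triv = c_xe + 3 * c_xt + 2 * c_xc - (c_ye + 3 * c_yt + 2 * c_yc);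
  c_ys : c_ye - c_yc = (1 - rate_std) * 4 * (D * D)^-1;
  c_y1 : c_ye + 3 * c_yt + 2 * c_yc = (1 - rate_triv) * 4 * (D * (D + 3))^-1;
  rate_triv_ge0 : 0 <= rate_triv; rate_triv_le : rate_triv <= rate_std; rate_std_le : rate_std <= g;
  rate_triv_gap : D * (g - rate_triv) <= 3 * (1 - rate_triv) }.

(** The case k = 0, where Pi is already invariant; the third parameter is 1 because 0^0 = 1. *)
Lemma coefs_noT D : 0 < D -> coefs D 1 1 1.
Proof.
move=> hD; apply: (@Coefs _ _ _ _ 1 0 0 0 0 0 1 1); rewrite ?ler01 ?lexx //; try ring.
by rewrite subrr !mulr0.
Qed.

(** For D = 2 and D = 4 the factors D^2 - 4 or D^2 - 16 vanish and some equations lose their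
    unknown. The values here and in the next two lemmas are solutions that also satisfy [c_ys] and
    [c_y1]. *)
Lemma coefs_n1 : coefs 2 (3 / 4) 2^-1 0.
Proof.
apply: (@Coefs _ _ _ _ 1 (- 6^-1) 0 3^-1 0 0 (2 / 3) 6^-1); first [lra | by field].
Qed.

Lemma coefs_n2_k1 : coefs 4 (3 / 4) 2^-1 0.
Proof.
apply: (@Coefs _ _ _ _ (4 / 5) (- 15^-1) 0 15^-1 0 0 (11 / 15) (8 / 15)); first [lra | by field].
Qed.

Lemma coefs_n2_k2 : coefs 4 (9 / 16) 4^-1 0.
Proof.
apply: (@Coefs _ _ _ _ (19 / 30) (- 10^-1) 30^-1 (2 / 15) (- 90^-1) 0 (7 / 15) (3 / 10)); first [lra | by field].
Qed.

(** Closed forms of the two eigenvalues for k at least 1, that is z = 0, found by solving [cE1] to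
    [cE6]; for fixed g and h both tend to g as D grows. *)
Definition rate_std_val (D g : F) := (D ^+ 4 * g - 4 * (D ^+ 2 - 1)) / ((D ^+ 2 - 1) * (D ^+ 2 - 4)).
Definition rate_triv_val (D g h : F) :=
  (D * (D + 3) * (D ^+ 2 * g + 3 * D * h) - 4 * (D + 1) * (D + 2)) / ((D + 4) * (D - 1) * (D + 1) * (D + 2)).

(** The hypothesis 1 <= D h encodes k <= n, and 3 h <= 2 g holds for k at least 1. The last bound
    says that the trivial rate can lag behind g only in proportion to 3/D times its distance from 1;
    it controls the lower estimate for rho = phi. *)
Lemma layer_bounds (D g h : F) : 4 <= D -> g <= 3 / 4 -> h <= 2^-1 -> 1 <= D * h ->
  3 * h <= 2 * g -> 2 * g <= 1 + h ->
  [/\ 0 <= rate_triv_val D g h, rate_triv_val D g h <= rate_std_val D g, rate_std_val D g <= g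
    & D * (g - rate_triv_val D g h) <= 3 * (1 - rate_triv_val D g h)].
Proof.
move=> D4 gle hle hgt gh gh1; split.
- apply: divr_ge0; last by rewrite !mulr_ge0 //; lra.
  rewrite subr_ge0.
  have D0 : 0 <= D by lra.
  have e0 : 3 <= 2 * (D * g) by have := ler_wpM2l D0 gh; lra.
  have e : 3 / 2 * D <= D ^+ 2 * g by have := ler_wpM2l D0 e0; rewrite expr2; lra.
  have e2 : D * (D + 3) * (3 / 2 * D + 3) <= D * (D + 3) * (D ^+ 2 * g + 3 * D * h).
    apply: ler_wpM2l; first by rewrite mulr_ge0 //; lra.
    by lra.
  apply: le_trans e2; have : 0 <= D * (D - 4) by [rewrite mulr_ge0 //; lra]; have : 0 <= D * D * (D - 4) by rewrite !mulr_ge0 //; lra.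
  lra.
- rewrite -subr_ge0.
  have -> : rate_std_val D g - rate_triv_val D g h = (3 * D ^+ 4 * (g - h) + 3 * D ^+ 3 * (2 * g - h) + 18 * D ^+ 2 * h - 12 * D ^+ 2 - 12 * D)
     / ((D ^+ 2 - 1) * (D + 2) * (D + 4) * (D - 2)).
    rewrite /rate_std_val /rate_triv_val; field.
    have n1 : D - 1 != 0 by lra.
    have n2 : D + 1 != 0 by lra.
    have n3 : D - 2 != 0 by lra.
    have n4 : D + 2 != 0 by lra.
    have n6 : D + 4 != 0 by lra.
    have m1 : D ^+ 2 - 1 != 0 by have -> : D ^+ 2 - 1 = (D - 1) * (D + 1) by [ring]; rewrite mulf_neq0.
    have m2 : D ^+ 2 - 4 != 0 by have -> : D ^+ 2 - 4 = (D - 2) * (D + 2) by [ring]; rewrite mulf_neq0.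
    by rewrite ?n1 ?n2 ?n3 ?n4 ?n6 ?m1 ?m2.
  apply: divr_ge0; last by rewrite !mulr_ge0 //; nra.
  have h0 : 0 <= h by nra.
  have e1 : 3 / 2 * D ^+ 3 <= 3 * D ^+ 4 * (g - h).
    have : D ^+ 3 * 1 <= D ^+ 3 * (D * h) by rewrite ler_wpM2l // exprn_ge0 //; lra.
    have : D ^+ 4 * (3 * h) <= D ^+ 4 * (2 * g) by rewrite ler_wpM2l // exprn_ge0 //; lra.
    rewrite !exprS expr0; lra.
  have e2 : 6 * D ^+ 2 <= 3 * D ^+ 3 * (2 * g - h).
    have : D ^+ 2 * 1 <= D ^+ 2 * (D * h) by rewrite ler_wpM2l // exprn_ge0 //; lra.
    have : D ^+ 3 * (3 * h) <= D ^+ 3 * (2 * g) by rewrite ler_wpM2l // exprn_ge0 //; lra.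
    rewrite !exprS expr0; lra.
  have e3 : 6 * D ^+ 2 <= 3 / 2 * D ^+ 3.
    have : D ^+ 2 * 4 <= D ^+ 2 * D by rewrite ler_wpM2l // exprn_ge0 //; lra.
    rewrite !exprS expr0; lra.
  have e4 : 18 * D <= 18 * D ^+ 2 * h.
    have : D * 1 <= D * (D * h) by rewrite ler_wpM2l //; lra.
    rewrite !exprS expr0; lra.
  lra.
- have D16 : 16 <= D ^+ 2 by rewrite expr2; nra.
  rewrite /rate_std_val ler_pdivrMr; last by rewrite mulr_gt0 //; lra.
  have : g * (5 * D ^+ 2 - 4) <= 3 / 4 * (5 * D ^+ 2 - 4) by rewrite ler_wpM2r //; lra.
  have -> : D ^+ 4 = D ^+ 2 * D ^+ 2 by rewrite -exprD.
  lra.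
- suff: D * g - 3 <= (D - 3) * rate_triv_val D g h by lra.
  rewrite /rate_triv_val mulrA ler_pdivlMr; last by rewrite !mulr_gt0 //; lra.
  rewrite -subr_ge0.
  have -> : (D - 3) * (D * (D + 3) * (D ^+ 2 * g + 3 * D * h) - 4 * (D + 1) * (D + 2)) -
    (D * g - 3) * ((D + 4) * (D - 1) * (D + 1) * (D + 2)) =
    3 * D ^+ 4 * (1 + h - 2 * g) + D ^+ 3 * (14 - 16 * g) + D ^+ 2 * (21 + 6 * g - 27 * h) + D * (10 + 8 * g).
    ring.
  have p n : 0 <= D ^+ n by rewrite exprn_ge0 //; lra.
  have q1 : 0 <= D ^+ 4 * (1 + h - 2 * g) by rewrite mulr_ge0 //; lra.
  have q2 : 0 <= D ^+ 3 * (14 - 16 * g) by rewrite mulr_ge0 //; lra.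
  have q3 : 0 <= D ^+ 2 * (21 + 6 * g - 27 * h) by rewrite mulr_ge0 //; nra.
  have q4 : 0 <= D * (10 + 8 * g) by rewrite mulr_ge0 //; nra.
  lra.
Qed.

Lemma coefs_gen (D g h : F) : 4 < D -> g <= 3 / 4 -> h <= 2^-1 -> 1 <= D * h ->
  3 * h <= 2 * g -> 2 * g <= 1 + h -> coefs D g h 0.
Proof.
move=> Dgt gle hle hgt gh gh1.
have [b1 b2 b3 b4] := layer_bounds (ltW Dgt) gle hle hgt gh gh1.
(* Each triangular system is solved backwards: [cE3] gives xc, then [cE2] gives xt and [cE1] gives
   xe, and likewise for the y coefficients. *)
pose xc := (D * D) * (2 * g - 3 * h) / ((D * D - 1) * (D * D - 4)).
pose xt := D * ((h - g) / (D * D - 1) - 2 * xc / (D * D)).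
pose xe := g - 3 * xt / D - 2 * xc / (D * D).
pose yc := 4 * (D * D) * (3 - 8 * g + 6 * h) / ((D * D - 1) * (D * D - 4) * (D * D - 16)).
pose yt := D * (4 * (2 * g - h - 1) / ((D * D - 1) * (D * D - 4)) - 4 * yc / (D * D)).
pose ye := 4 * (1 - g) / (D * D - 1) - 6 * yt / D - 8 * yc / (D * D).
have n0 : D != 0 by lra.
have n1 : D - 1 != 0 by lra.
have n2 : D + 1 != 0 by lra.
have n3 : D - 2 != 0 by lra.
have n4 : D + 2 != 0 by lra.
have n5 : D - 4 != 0 by lra.
have n6 : D + 4 != 0 by lra.
have n7 : D + 3 != 0 by lra.
have m1 : D * D - 1 != 0 by have -> : D * D - 1 = (D - 1) * (D + 1) by [ring]; rewrite mulf_neq0.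
have m2 : D * D - 4 != 0 by have -> : D * D - 4 = (D - 2) * (D + 2) by [ring]; rewrite mulf_neq0.
have m3 : D * D - 16 != 0 by have -> : D * D - 16 = (D - 4) * (D + 4) by [ring]; rewrite mulf_neq0.
have m4 : D ^+ 2 - 1 != 0 by rewrite expr2.
have m5 : D ^+ 2 - 4 != 0 by rewrite expr2.
apply: (@Coefs _ _ _ _ xe xt xc ye yt yc (rate_std_val D g) (rate_triv_val D g h)).
- rewrite /xe; field; exact: n0.
- rewrite /xt; field; by rewrite n0 m1.
- rewrite /xc; field; by rewrite n0 m1 m2.
- rewrite /ye; field; by rewrite n0 m1.
- rewrite /yt; field; by rewrite n0 m1 m2.
- rewrite /yc; field; by rewrite n0 m1 m2 m3.
- rewrite /xe /ye /xt /yt /xc /yc /rate_std_val; field; by rewrite n0 m1 m2 m3.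
- rewrite /xe /ye /xt /yt /xc /yc /rate_triv_val; field; by rewrite n0 m1 m2 m3 n6 n1 n2 n4.
- rewrite /ye /yt /yc /rate_std_val; field; by rewrite n0 m1 m2 m3.
- rewrite /ye /yt /yc /rate_triv_val; field; by rewrite n0 m1 m2 m3 n6 n1 n2 n4 n7.
- exact: b1.
- exact: b2.
- exact: b3.
- exact: b4.
Qed.

Lemma coefs_exist n k : (0 < n)%N -> (k <= n)%N ->
  coefs (2 ^ n)%:R ((3 / 4) ^+ k) (2^-1 ^+ k) (0 ^+ k).
Proof.
case: k => [|k] hn hk; first by rewrite !expr0; apply: coefs_noT; rewrite ltr0n expn_gt0.
rewrite [0 ^+ _]exprS mul0r.
have b i : [/\ 0 <= (3 / 4 : F) ^+ i, (3 / 4 : F) ^+ i <= 1, 0 <= (2^-1 : F) ^+ i, (2^-1 : F) ^+ i <= (3 / 4) ^+ i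
    & 2 * (3 / 4) ^+ i <= 1 + (2^-1 : F) ^+ i].
  elim: i => [|i [h1 h2 h3 h4 h5]]; first by rewrite !expr0; split; lra.
  by rewrite !exprS; split; lra.
have [n1|n2|n3] := ltngtP n 2.
- have [n0 k0] : (n = 1)%N /\ (k = 0)%N by lia.
  by rewrite n0 k0 !expr1; exact: coefs_n1.
- have [h1 h2 h3 h4 h5] := b k.
  have e : 1 <= (2 ^ n)%:R * (2^-1 : F) ^+ k.+1.
    rewrite exprVn ler_pdivlMr ?exprn_gt0 // mul1r natrX.
    by rewrite ler_eXn2l // ltr1n.
  have f : 4 < (2 ^ n)%:R :> F by rewrite (ltr_nat _ 4) (@ltn_exp2l 2 2).
  move: e; rewrite !exprS => e.
  by apply: coefs_gen => //; lra.
- rewrite n3 (_ : (2 ^ 2)%:R = 4) //.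
  case: k hk => [|[|k]] hk; last by exfalso; lia.
    by rewrite !expr1; exact: coefs_n2_k1.
  have -> : (3 / 4 : F) ^+ 2 = 9 / 16 by field.
  have -> : (2^-1 : F) ^+ 2 = 4^-1 by field.
  exact: coefs_n2_k2.
Qed.

End LayerCoefficients.

(** * Iteration through the representations of S_3 *)

Section Iteration.
Variables (F : numFieldType) (N : nat) (s12 s13 s23 Pi K : 'M[F]_N) (Phi : 'M[F]_N -> 'M[F]_N).
Implicit Types M : 'M[F]_N.
Hypothesis s13K : s13 *m s13 = 1%:M.
Hypothesis s23K : s23 *m s23 = 1%:M.
Hypothesis s13_s12 : s13 *m s12 = s23 *m s13.
Hypothesis s23_s12 : s23 *m s12 = s13 *m s23.
Local Notation tra := (s12 + s13 + s23).
Local Notation cyc := (s13 *m s23 + s23 *m s13).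
Local Notation sym12 := (1%:M + s12).
Local Notation sym123 := (1%:M + tra + cyc).

Let s12E : s12 = s13 *m s23 *m s13.
Proof. by rewrite -mulmxA -s13_s12 mulmxA s13K mul1mx. Qed.
Let s12E' : s12 = s23 *m s13 *m s23.
Proof. by rewrite -mulmxA -s23_s12 mulmxA s23K mul1mx. Qed.
Lemma s12_mul_s13 : s12 *m s13 = s13 *m s23.
Proof. by rewrite s12E -mulmxA s13K mulmx1. Qed.
Lemma s12_mul_s23 : s12 *m s23 = s23 *m s13.
Proof. by rewrite s12E' -mulmxA s23K mulmx1. Qed.
Let s12K : s12 *m s12 = 1%:M.
Proof. by rewrite {1}s12E -mulmxA s13_s12 mulmxA -[_ *m s23 *m s23]mulmxA s23K mulmx1 s13K. Qed.

Lemma tra_sym12 : tra *m sym12 = sym123.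
Proof.
rewrite mulmxDr mulmx1 !mulmxDl s12K s13_s12 s23_s12.
move: (s13 *m s23) (s23 *m s13) 1%:M => x y z; apply/matrixP => i j; rewrite !mxE; ring.
Qed.

Lemma cyc_sym12 : cyc *m sym12 = sym123 - sym12.
Proof.
rewrite mulmxDr mulmx1 !mulmxDl -!mulmxA s13_s12 s23_s12 !mulmxA s13K s23K !mul1mx.
move: (s13 *m s23) (s23 *m s13) 1%:M => x y z; apply/matrixP => i j; rewrite !mxE; ring.
Qed.

Let s13_sym : s13 *m sym123 = sym123.
Proof.
rewrite !mulmxDr mulmx1 s13_s12 s13K mulmxA s13K mul1mx mulmxA -s12E.
move: (s13 *m s23) (s23 *m s13) 1%:M => x y z; apply/matrixP => i j; rewrite !mxE; ring.
Qed.

Let s23_sym : s23 *m sym123 = sym123.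
Proof.
rewrite !mulmxDr mulmx1 s23_s12 s23K mulmxA mulmxA s23K mul1mx -s12E'.
move: (s13 *m s23) (s23 *m s13) 1%:M => x y z; apply/matrixP => i j; rewrite !mxE; ring.
Qed.

Let s12_sym : s12 *m sym123 = sym123.
Proof. by rewrite {1}s12E -(mulmxA _ s13) s13_sym -(mulmxA s13) s23_sym s13_sym. Qed.

Lemma tra_sym : tra *m sym123 = 3 *: sym123.
Proof.
rewrite 2!mulmxDl s12_sym s13_sym s23_sym.
by apply/matrixP => i j; rewrite !mxE; ring.
Qed.

Lemma cyc_sym : cyc *m sym123 = 2 *: sym123.
Proof.
rewrite mulmxDl -(mulmxA s13) -(mulmxA s23) s23_sym s13_sym s23_sym.
by apply/matrixP => i j; rewrite !mxE; ring.
Qed.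

Hypothesis PhiD : forall M M', Phi (M + M') = Phi M + Phi M'.
Hypothesis PhiZ : forall x M, Phi (x *: M) = x *: Phi M.
Hypothesis Phi13 : forall M, Phi (M *m s13) = Phi M *m s13.
Hypothesis Phi23 : forall M, Phi (M *m s23) = Phi M *m s23.
Hypothesis PhiK : Phi K = K.
Variables xe xt xc ye yt yc as_ a1 y_s y_1 : F.
Hypothesis PhiPi : Phi Pi = (xe - ye) *: Pi + (xt - yt) *: (Pi *m tra) + (xc - yc) *: (Pi *m cyc)
  + 4^-1 *: (ye *: K + yt *: (K *m tra) + yc *: (K *m cyc)).
Hypothesis as_E : as_ = xe - xc - (ye - yc).
Hypothesis a1_E : a1 = xe + 3 * xt + 2 * xc - (ye + 3 * yt + 2 * yc).
(** In the application the layer map preserves the trace. This forces y_s and y_1 to be the ratios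
    of the traces of Pi and K against the standard and the trivial component, namely 1/D^2 and 1/(D
    (D + 3)). *)
Hypothesis ys_E : ye - yc = (1 - as_) * 4 * y_s.
Hypothesis y1_E : ye + 3 * yt + 2 * yc = (1 - a1) * 4 * y_1.

Let Phi12 M : Phi (M *m s12) = Phi M *m s12.
Proof. by rewrite s12E !mulmxA !(Phi13, Phi23). Qed.

Let Phi_sym12 M : Phi (M *m sym12) = Phi M *m sym12.
Proof. by rewrite mulmxDr mulmx1 PhiD Phi12 mulmxDr mulmx1. Qed.

Let Phi_sym M : Phi (M *m sym123) = Phi M *m sym123.
Proof. by rewrite !mulmxDr !mulmx1 !mulmxA !PhiD !(Phi12, Phi13, Phi23). Qed.

(** The standard component of 1 + (12): the trivial component is a third of the sum over S_3, and
    the sign component is absent because (12) fixes 1 + (12). The class sums of transpositions and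
    of 3-cycles act as 0 and -1 on it, and as 3 and 2 on the trivial component. *)
Local Notation mix12 := (sym12 - 3^-1 *: sym123).

Let Phi_mix M : Phi (M *m mix12) = Phi M *m mix12.
Proof.
have -> : M *m mix12 = M *m sym12 + (- 3^-1) *: (M *m sym123).
  by rewrite mulmxBr -scalemxAr scaleNr.
by rewrite PhiD PhiZ Phi_sym12 Phi_sym scaleNr mulmxBr -scalemxAr.
Qed.

Let Phi_Pi_mul s : (forall M, Phi (M *m s) = Phi M *m s) ->
  Phi (Pi *m s) = (xe - ye) *: (Pi *m s) + (xt - yt) *: (Pi *m (tra *m s)) + (xc - yc) *: (Pi *m (cyc *m s))
  + 4^-1 *: (ye *: (K *m s) + yt *: (K *m (tra *m s)) + yc *: (K *m (cyc *m s))).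
Proof.
move=> ->; rewrite PhiPi; move: tra cyc => A B.
by rewrite !mulmxDl -!scalemxAl !mulmxDl -!scalemxAl !mulmxA.
Qed.

Let Phi_Pi_sym : Phi (Pi *m sym123) = a1 *: (Pi *m sym123) + ((1 - a1) * y_1) *: (K *m sym123).
Proof.
have h : (1 - a1) * y_1 = 4^-1 * (ye + 3 * yt + 2 * yc) by rewrite y1_E; field.
rewrite (Phi_Pi_mul Phi_sym) tra_sym cyc_sym -!scalemxAr h a1_E.
move: (Pi *m _) (K *m _) => A B.
by apply/matrixP => i j; rewrite !mxE; ring.
Qed.

Let Phi_Pi_mix : Phi (Pi *m mix12) = as_ *: (Pi *m mix12) + ((1 - as_) * y_s) *: (K *m mix12).
Proof.
have h : (1 - as_) * y_s = 4^-1 * (ye - yc) by rewrite ys_E; field.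
have h3 : (3 : F) != 0 by rewrite pnatr_eq0.
have t0 : tra *m mix12 = 0.
  by rewrite mulmxBr tra_sym12 -scalemxAr tra_sym scalerA mulVf // scale1r subrr.
have c0 : cyc *m mix12 = - mix12.
  rewrite mulmxBr cyc_sym12 -scalemxAr cyc_sym; move: sym123 sym12 => A B.
  by apply/matrixP => i j; rewrite !mxE; field.
rewrite (Phi_Pi_mul Phi_mix) t0 c0 !mulmx0 !mulmxN h as_E.
move: (Pi *m _) (K *m _) => A B.
by apply/matrixP => i j; rewrite !mxE; ring.
Qed.

(** The difference A - y B is an eigenvector with eigenvalue x, and y B is the fixed part. *)
Let iter_affine l x y A B : Phi A = x *: A + ((1 - x) * y) *: B -> Phi B = B ->
  iter l Phi A = x ^+ l *: A + ((1 - x ^+ l) * y) *: B.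
Proof.
move=> hA hB; elim: l => [|l IH] /=; first by rewrite expr0 scale1r subrr mul0r scale0r addr0.
rewrite IH PhiD !PhiZ hA hB exprS; move: (x ^+ l) => z.
by apply/matrixP => i j; rewrite !mxE; ring.
Qed.

Lemma iter_Phi l : iter l Phi (Pi *m sym12) =
  as_ ^+ l *: (Pi *m mix12) + ((1 - as_ ^+ l) * y_s) *: (K *m mix12)
  + 3^-1 *: (a1 ^+ l *: (Pi *m sym123) + ((1 - a1 ^+ l) * y_1) *: (K *m sym123)).
Proof.
have h3 : (3 : F) != 0 by rewrite pnatr_eq0.
have iterD M M' : iter l Phi (M + M') = iter l Phi M + iter l Phi M'.
  by elim: (l) => //= k ->; rewrite PhiD.
have iterZ x M : iter l Phi (x *: M) = x *: iter l Phi M.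
  by elim: (l) => //= k ->; rewrite PhiZ.
have -> : Pi *m sym12 = Pi *m mix12 + 3^-1 *: (Pi *m sym123).
  by rewrite mulmxBr -scalemxAr subrK.
rewrite iterD iterZ (iter_affine _ Phi_Pi_mix) ?Phi_mix ?PhiK //.
by rewrite (iter_affine _ Phi_Pi_sym) ?Phi_sym ?PhiK.
Qed.

End Iteration.

Lemma big_tuple_cons (T : nmodType) (I : finType) l (f : I -> l.-tuple I -> T) (h : seq I -> T) :
  (forall j t, h (j :: tval t) = f j t) ->
  \sum_(t : l.+1.-tuple I) h t = \sum_j \sum_t f j t.
Proof.
move=> hf; rewrite pair_big /=.
rewrite (reindex (fun p : I * l.-tuple I => [tuple of p.1 :: p.2])) /=; last first.
  exists (fun t => (thead t, behead_tuple t)) => [[j t] _|t _] /=.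
    by congr (_, _); exact: val_inj.
  exact: esym (tuple_eta t).
by apply: eq_bigr => -[j t] _; exact: hf.
Qed.

Lemma big_tuple_nil (T : nmodType) (I : finType) (h : seq I -> T) :
  \sum_(t : 0.-tuple I) h t = h [::].
Proof.
rewrite (eq_bigr (fun=> h [::])) => [|[[|//] ?] _] //.
by rewrite sumr_const card_tuple expn0.
Qed.

(** * The ensemble and the measurement kernel *)

Section Words.
Variable R : realType.
Local Notation C := R[i].
Variable n : nat.
Local Notation d := (2 ^ n)%N.
Local Notation Mat := 'M[C]_d.
Local Notation Mat4 := 'M[C]_(d * d * (d * d)).
Variables (m : nat) (S : 'I_m -> Mat).
Local Notation TW := (twirl S).

Lemma word_cons (W : Mat) c0 j t : word S W c0 (j :: t) = word S W j t *m W *m S c0.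
Proof.
have gen (t' : seq 'I_m) (A B : Mat) :
    foldl (fun V j => S j *m W *m V) (A *m B) t' = foldl (fun V j => S j *m W *m V) A t' *m B.
  by elim: t' A => //= j' t' IH A; rewrite mulmxA IH.
by rewrite /word /= -mulmxA -[_ *m W *m S c0]mulmxA -gen mulmxA.
Qed.

(** The first Clifford factor of a word acts outermost on the kernel, so peeling it off leaves a
    shorter word inside. Independence of the factors turns the average into an iterate of one
    averaged layer. *)
Lemma sum_word (W : Mat) l (K : Mat4) :
  (m%:R ^+ l.+1)^-1 *: \sum_c0 \sum_(t : l.-tuple 'I_m) Ad (word S W c0 t) K
  = iter l (fun M => TW (Ad W M)) (TW K).
Proof.
elim: l => [|l IH].
  rewrite expr1 /twirl; congr (_ *: _); apply: eq_bigr => c0 _.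
  by rewrite (big_tuple_nil (fun s => Ad (word S W c0 s) K)).
rewrite iterS -IH exprS invfM {1}/twirl -scalerA; congr (_ *: _).
rewrite scaler_sumr; apply: eq_bigr => c0 _; rewrite !AdZ; congr (_ *: _).
rewrite (@big_tuple_cons _ _ l (fun j t => Ad (S c0) (Ad W (Ad (word S W j t) K))) (fun s => Ad (word S W c0 s) K)) => [|j t]; last first.
  rewrite word_cons; transitivity (Ad (S c0) (Ad (word S W j t *m W) K)); first exact: esym (Ad_comp _ _ _).
  by congr (Ad _ _); exact: esym (Ad_comp _ _ _).
rewrite !Ad_sum; apply: eq_bigr => j _; rewrite !Ad_sum; exact: eq_bigr.
Qed.

Lemma Eens_ev k l (K : Mat4) X1 X2 X3 X4 :
  Eens S k l (fun U => ev K (U *m X1 *m adj U) (U *m X2 *m adj U) (U *m X3 *m adj U) (U *m X4 *m adj U))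
  = ev (iter l (fun M => TW (Ad (That R n k) M)) (TW K)) X1 X2 X3 X4.
Proof.
rewrite -sum_word evZ ev_sum; congr (_ * _); apply: eq_bigr => c0 _.
by rewrite ev_sum; apply: eq_bigr => t _; rewrite ev_Ad.
Qed.

End Words.

Section ZStrings.
Variable R : realType.
Local Notation C := R[i].
Variable n : nat.
Local Notation d := (2 ^ n)%N.
Local Notation Mat := 'M[C]_d.
Local Notation P := (@pauli_vec R n).
Local Notation D := (d%:R : C).

Definition zv (z : {ffun 'I_n -> bool}) : vec n := [ffun q => (false, z q)].

Lemma zvD z z' : zv z + zv z' = zv [ffun q => z q (+) z' q].
Proof. by apply/ffunP => q; rewrite !ffunE. Qed.

Lemma zv_inj : injective zv.
Proof. by move=> z z' /ffunP h; apply/ffunP => q; have := h q; rewrite !ffunE => -[]. Qed.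

Lemma chi_zv (F : pzRingType) z z' : symp_sign F (zv z) (zv z') = 1.
Proof. by rewrite /symp_sign /sf big1 // => q _; rewrite !ffunE /sf1 /= andbF. Qed.

Lemma pauli_zvM z z' : P (zv z) *m P (zv z') = P (zv z + zv z').
Proof.
rewrite pauli_mul (_ : kap R _ _ = 1) ?scale1r // /kap big1 // => q _.
by rewrite !ffunE /kap1 /= !expr0 !mul1r andbF.
Qed.

Lemma pauli_zv_complete i j k l : \sum_z P (zv z) i j * P (zv z) k l
  = D * (i == j)%:R * (k == l)%:R * (i == k)%:R.
Proof.
under eq_bigr => z _ do rewrite !pauli_vecE !mxE -big_split /=.
pose f (q : 'I_n) (b : bool) := sig R (false, b) (bit (n - 1 - q) i) (bit (n - 1 - q) j) *
   sig R (false, b) (bit (n - 1 - q) k) (bit (n - 1 - q) l).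
transitivity (\sum_(z : {ffun 'I_n -> bool}) \prod_q f q (z q)).
  by apply: eq_bigr => z _; apply: eq_bigr => q _; rewrite /f !ffunE.
rewrite -(bigA_distr_bigA f).
transitivity (\prod_(q < n) (2%:R * (bit (n - 1 - q) i == bit (n - 1 - q) j)%:R
  * (bit (n - 1 - q) k == bit (n - 1 - q) l)%:R * (bit (n - 1 - q) i == bit (n - 1 - q) k)%:R : C)).
  apply: eq_bigr => q _; rewrite /f big_bool !sigE.
  move: (bit _ i) (bit _ j) (bit _ k) (bit _ l) => a b c e.
  elim/ord2P: a; elim/ord2P: b; elim/ord2P: c; elim/ord2P: e;
  by rewrite /= ?(expr0, expr1, mul1r, mulr1, mul0r, mulr0, add0r, addr0, mulrN, mulNr, opprK, subrr, addNr).
by rewrite !big_split /= !bits_eq prodr_const card_ord natrX.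
Qed.

Lemma sum_delta (T : finType) i (f : T -> C) : \sum_j (i == j)%:R * f j = f i.
Proof.
rewrite (bigD1 i) //= eqxx mul1r big1 ?addr0 // => j /negbTE h.
by rewrite eq_sym h mul0r.
Qed.

(** Strings of Z form an orthogonal basis of the diagonal matrices, so a sum over measurement
    outcomes becomes a sum over Pauli labels. *)
Lemma pauli_zv_tr2 (X Y : Mat) : \sum_z \tr (P (zv z) *m X) * \tr (P (zv z) *m Y) = D * \sum_b X b b * Y b b.
Proof.
transitivity (\sum_i \sum_j \sum_k \sum_l (X j i * Y l k) * \sum_z P (zv z) i j * P (zv z) k l).
  under [RHS]eq_bigr => i _ do under eq_bigr => j _ do under eq_bigr => k _ do under eq_bigr => l _ do rewrite mulr_sumr.
  under [RHS]eq_bigr => i _ do under eq_bigr => j _ do under eq_bigr => k _ do rewrite exchange_big.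
  under [RHS]eq_bigr => i _ do under eq_bigr => j _ do rewrite exchange_big.
  under [RHS]eq_bigr => i _ do rewrite exchange_big.
  rewrite [RHS]exchange_big; apply: eq_bigr => z _ /=.
  rewrite /mxtrace mulr_suml; apply: eq_bigr => i _; rewrite mulE mulr_suml; apply: eq_bigr => j _.
  rewrite mulr_sumr; apply: eq_bigr => k _; rewrite mulE mulr_sumr; apply: eq_bigr => l _; ring.
rewrite mulr_sumr; apply: eq_bigr => i _.
rewrite -(sum_delta i (fun j => D * (X j i * Y i i))); apply: eq_bigr => j _.
rewrite -(sum_delta i (fun k => (i == j)%:R * (D * (X j i * Y k k)))); apply: eq_bigr => k _.
rewrite -(sum_delta k (fun l => (i == k)%:R * ((i == j)%:R * (D * (X j i * Y l k))))); apply: eq_bigr => l _.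
rewrite pauli_zv_complete; ring.
Qed.

End ZStrings.

Lemma sum_eq_but1 (F : pzRingType) (T : finType) (i0 : T) (f : T -> F) k :
  (forall i, i != i0 -> f i = k) -> \sum_i f i = f i0 + (#|T|%:R - 1) * k.
Proof.
move=> h; rewrite (bigD1 i0) //=; congr (_ + _).
have c0 : (0 < #|T|)%N by apply/card_gt0P; exists i0.
by rewrite (eq_bigr (fun=> k)) // sumr_const cardC1 -(prednK c0) -natr1 addrK mulr_natl.
Qed.

(** Here x is the value at the identity and x1, ..., x5 are those at Pi, (12), (34), Pi (12) and
    (12)(34). The left side is the average over pairs of strings of Z, the right side the value at
    the invariant image. *)
Lemma diag1234_algebra (F : fieldType) (D ab ac abc a2 x x1 x2 x3 x4 x5 : F) :
  D != 0 -> D + 1 != 0 -> D + 2 != 0 ->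
  D * D * x1 = x + (D * D - 1) * ab -> D * x2 = x + (D * D - 1) * ac -> D * x3 = x + (D * D - 1) * abc ->
  D * D * D * x4 + D * D * x5 =
    2 * x + 2 * (D * D - 1) * (ab + ac + abc) + (D * D - 1) * (D * D - 4) * a2 ->
  (D * D)^-1 * (D * D * a2 + D * (ab + ac + abc - 3 * a2) + (x - ab - ac - abc + 2 * a2)) =
  ((D + 1) * (D + 2))^-1 * (x + x2 + x3 + x5 + D * (x1 + x4)).
Proof.
move=> hD hD1 hD2 h1 h2 h3 h4; have hN : D * D != 0 by rewrite mulf_neq0.
rewrite (canRL (mulKf hN) h1) (canRL (mulKf hD) h2) (canRL (mulKf hD) h3).
rewrite (canRL (mulKf hN) (canRL (addKr _) h4)); field.
by rewrite hD hD1 hD2.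
Qed.

(** * Clifford twirl of the measurement kernel *)

Section MeasurementTwirl.
Variable R : realType.
Local Notation C := R[i].
Variable n : nat.
Local Notation d := (2 ^ n)%N.
Local Notation Mat := 'M[C]_d.
Local Notation Mat4 := 'M[C]_(d * d * (d * d)).
Local Notation P := (@pauli_vec R n).
Local Notation chi := (@symp_sign n C).
Local Notation vec := (vec n).
Local Notation D := (d%:R : C).
Local Notation p4 := (@p4 R n).
Local Notation p12 := (@p12 R n).
Local Notation p13 := (@p13 R n).
Local Notation p23 := (@p23 R n).
Local Notation Pi := (sproj chi D p4 0).
Local Notation s12 := (sw12 D p13 p23).
Implicit Types (X Y U : Mat) (M : Mat4) (u v w a b c e : vec).
Variables (m : nat) (S : 'I_m -> Mat).
Hypothesis HS : clifford_transversal S.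
Local Notation TW := (twirl S).

Definition diag12 : Mat4 := D^-1 *: \sum_z p12 (zv z).
(** The kernel of the squared estimator, a product of two sums over outcomes. Written with p4 and
    p12 it is a sum over commuting pairs of labels, to which [class2] applies. *)
Definition diag1234 : Mat4 := (D * D)^-1 *: \sum_y \sum_z p4 (zv y) *m p12 (zv z).
Definition sw34 : Mat4 := D^-1 *: \sum_b t4 1%:M 1%:M (P b) (P b).

Lemma ev_diag12 X1 X2 X3 X4 :
  ev diag12 X1 X2 X3 X4 = (\sum_b X1 b b * X2 b b) * \tr X3 * \tr X4.
Proof.
rewrite evZ ev_sum (eq_bigr (fun z => \tr (P (zv z) *m X1) * \tr (P (zv z) *m X2) * (\tr X3 * \tr X4))) => [|z _].
  by rewrite -mulr_suml pauli_zv_tr2 mulrA mulKf ?D_neq0 // mulrA.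
by rewrite p12E ev_t4_base !mul1mx mulrA.
Qed.

Lemma ev_diag1234 X1 X2 X3 X4 :
  ev diag1234 X1 X2 X3 X4 = (\sum_b X1 b b * X2 b b) * (\sum_b X3 b b * X4 b b).
Proof.
rewrite evZ ev_sum.
transitivity ((D * D)^-1 * \sum_y \sum_z (\tr (P (zv z) *m X1) * \tr (P (zv z) *m X2))
    * (\tr (P (zv y) *m X3) * \tr (P (zv y) *m X4))).
  congr (_ * _); apply: eq_bigr => y _; rewrite ev_sum.
  (* In the product of p4 and p12 the copies 1 and 2 carry the string y + z, and the shift by y
     separates the two sums. *)
  pose h (z : {ffun 'I_n -> bool}) := [ffun q => y q (+) z q].
  have hh : involutive h by move=> z; apply/ffunP => q; rewrite !ffunE addbA addbb.
  rewrite [RHS](reindex_inj (can_inj hh)); apply: eq_bigr => z _.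
  by rewrite p4E p12E t4_mul !mulmx1 ev_t4_base pauli_zvM zvD mulrA.
rewrite (eq_bigr _ (fun y _ => esym (mulr_suml _ _ _ _))) -mulr_sumr !pauli_zv_tr2.
by rewrite [X in _ * X]mulrACA mulKf // mulf_neq0 ?D_neq0.
Qed.

Lemma sum_p12 : \sum_b p12 b = D *: s12.
Proof.
rewrite scalerA mulfV ?D_neq0 // scale1r; apply: eq_bigr => b _; exact: esym (p13_23 R b).
Qed.

Lemma Ad_p12 c b : Ad (Utv R c) (p12 b) = p12 (transvect c b).
Proof.
rewrite -!p13_23 Ad_mul; last exact: Utv_unitary.
by rewrite (Ad_p13 (Utv_unitary R c) (Utv_conj R c)) (Ad_p23 (Utv_unitary R c) (Utv_conj R c)).
Qed.

Lemma D1_neq0 : D + 1 != 0. Proof. by rewrite natr1 pnatr_eq0. Qed.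
Lemma D2_neq0 : D + 2 != 0. Proof. by rewrite -natrD pnatr_eq0 addn2. Qed.

Lemma twirl_diag12 : TW diag12 = (D + 1)^-1 *: (1%:M + s12).
Proof.
have fix12 : TW ((D + 1)^-1 *: (1%:M + s12)) = (D + 1)^-1 *: (1%:M + s12).
  by apply: (twirl_fix HS) => U hU; rewrite AdZ AdD (Ad1 hU) (Ad_s12 hU).
rewrite -[RHS]fix12; apply/matrixP => i j.
pose L M := TW M i j.
have LD M M' : L (M + M') = L M + L M' by rewrite /L twirlD mxE.
have LZ x M : L (x *: M) = x * L M by rewrite /L twirlZ mxE.
have L_sum (I : finType) (f : I -> Mat4) : L (\sum_i f i) = \sum_i L (f i).
  by apply: (big_morph _ LD); have := LZ 0 0; rewrite scale0r mul0r.
pose f b := L (p12 b).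
have finv e b : f (transvect e b) = f b.
  have h : TW (p12 (transvect e b)) = TW (p12 b) by rewrite -Ad_p12 (twirl_Ad HS _ (Utv_clifford R e)).
  exact: (f_equal (fun M => fun_of_matrix M i j) h).
have [k hk] := const1 finv.
have z0 : zv 0 = 0 :> vec by apply/ffunP => q; rewrite !ffunE.
have f0 : f 0 = L 1%:M by rewrite /f p12_0.
have e1 : \sum_z f (zv z) = f 0 + (D - 1) * k.
  have hz z : z != 0 -> f (zv z) = k by move=> hz; rewrite hk // -z0 (inj_eq (@zv_inj n)).
  by rewrite (sum_eq_but1 hz) z0 card_ffun card_bool card_ord.
have e2 : D * L s12 = f 0 + (D * D - 1) * k.
  rewrite -LZ -sum_p12 L_sum (sum_eq_but1 hk).
  by rewrite dim_sqr card_ffun card_prod card_bool card_ord.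
change (L diag12 = L ((D + 1)^-1 *: (1%:M + s12))).
rewrite !LZ LD L_sum e1 -f0.
rewrite (canRL (mulKf (D_neq0 R n)) e2).
move: (f 0) (D_neq0 R n) D1_neq0 => x h h1; field; by rewrite h h1.
Qed.

Lemma Ad_sw34 U : unitary U -> Ad U sw34 = sw34.
Proof. by move=> hU; rewrite AdZ Ad_sum34. Qed.

Lemma sum_p4_12 : \sum_a p4 a *m p12 a = D *: sw34.
Proof.
rewrite scalerA mulfV ?D_neq0 // scale1r; apply: eq_bigr => b _.
by rewrite p4E p12E t4_mul !pauli_sqr !mulmx1.
Qed.

Lemma sum_chi_p4_12 : \sum_a \sum_b chi a b *: (p4 a *m p12 b) = (D * D) *: (s12 *m sw34).
Proof.
have e34 : D *: sw34 = \sum_b t4 1%:M 1%:M (P b) (P b) by rewrite scalerA mulfV ?D_neq0 // scale1r.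
transitivity ((\sum_b p12 b) *m (\sum_b t4 1%:M 1%:M (P b) (P b))); last first.
  by rewrite sum_p12 -e34 -scalemxAl -scalemxAr scalerA.
rewrite mulmx_sumr; apply: eq_bigr => a _.
rewrite mulmx_suml (reindex_inj (addrI a)); apply: eq_bigr => e _ /=.
rewrite p4E !p12E !t4_mul !mulmx1 !mul1mx !pauli_mul addKvec.
have hk : chi a (a + e) * (kap R a (a + e) * kap R a (a + e)) = 1 by rewrite kap_sqr chi_sqr.
by apply: mat4P => *; rewrite mxE !t4E !mxE -[RHS]mul1r -hk; ring.
Qed.

Definition sym_image : Mat4 :=
  1%:M + s12 + sw34 + s12 *m sw34 + D *: (Pi *m (1%:M + s12)).

Lemma twirl_sym_image : TW sym_image = sym_image.
Proof.
apply: (twirl_clifford_fix HS) => U cU; have hU := proj1 cU.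
have e1 := Ad1 hU; have e2 := Ad_s12 hU; have e3 := Ad_sw34 hU; have e4 := Ad_Pi cU.
have fixD M M' : Ad U M = M -> Ad U M' = M' -> Ad U (M + M') = M + M' by move=> h h'; rewrite AdD h h'.
have fixM M M' : Ad U M = M -> Ad U M' = M' -> Ad U (M *m M') = M *m M'.
  by move=> h h'; rewrite Ad_mul // h h'.
have fixZ x M : Ad U M = M -> Ad U (x *: M) = x *: M by move=> h; rewrite AdZ h.
exact: fixD _ _ (fixD _ _ (fixD _ _ (fixD _ _ e1 e2) e3) (fixM _ _ e2 e3)) (fixZ _ _ (fixM _ _ e4 (fixD _ _ e1 e2))).
Qed.

(** As for a T layer, both sides are compared through a matrix entry of the twirl; strings of Z
    reach all five classes of commuting pairs with known multiplicities. *)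
Lemma twirl_diag1234 : TW diag1234 = ((D + 1) * (D + 2))^-1 *: sym_image.
Proof.
rewrite -twirl_sym_image -twirlZ; apply/matrixP => i j.
pose L M := TW M i j.
have LD M M' : L (M + M') = L M + L M' by rewrite /L twirlD mxE.
have LZ x M : L (x *: M) = x * L M by rewrite /L twirlZ mxE.
have L_sum (I : finType) (f : I -> Mat4) : L (\sum_i f i) = \sum_i L (f i).
  by apply: (big_morph _ LD); have := LZ 0 0; rewrite scale0r mul0r.
change (L diag1234 = L (((D + 1) * (D + 2))^-1 *: sym_image)).
pose f a b := L (p4 a *m p12 b).
have finv e a b : f (transvect e a) (transvect e b) = f a b.
  have h0 : Ad (Utv R e) (p4 a *m p12 b) = p4 (transvect e a) *m p12 (transvect e b).
    exact: etrans (Ad_mul _ _ (Utv_unitary R e)) (f_equal2 mulmx (Ad_p4 (Utv_conj R e) a) (Ad_p12 e b)).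
  have h := etrans (congr1 TW (esym h0)) (twirl_Ad HS _ (Utv_clifford R e)).
  exact: (f_equal (fun M => fun_of_matrix M i j) h).
have [ab [ac [abc [a2 hf]]]] := class2 finv.
(* The class sums for triples are reused with a function that ignores its first label. *)
pose t (u : vec) := f.
have tX b c : chi b c = 1 -> t 0 b c = _ := hf b c.
have k1 := sum_t0b0 (@addvecc n) (@chiC n C) (fun w u v => @chiDr n C u v w) (@chivv n C) (@sum_chiD R n) tX.
have k2 := sum_t00c (@addvecc n) (@chiC n C) (fun w u v => @chiDr n C u v w) (@chivv n C) (@sum_chiD R n) tX.
have k3 := sum_t0bb (@addvecc n) (@chiC n C) (fun w u v => @chiDr n C u v w) (@chivv n C) (@sum_chiD R n) tX.
have k4 := sum_t0bc (@addvecc n) (@chiC n C) (fun w u v => @chiDr n C u v w) (@chi_sqr n C) (@chivv n C) (@sum_chiD R n) tX.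
pose N2 : C := D * D.
have hN : N2 != 0 by rewrite mulf_neq0 ?D_neq0.
have lPi : N2 * L Pi = f 0 0 + (N2 - 1) * ab.
  rewrite -k1 PiE -LZ scalerA mulfV ?mulf_neq0 ?D_neq0 // scale1r L_sum; apply: eq_bigr => a _.
  by rewrite /t /f p12_0 mulmx1.
have l12 : D * L s12 = f 0 0 + (N2 - 1) * ac.
  by rewrite -k2 -LZ -sum_p12 L_sum; apply: eq_bigr => a _; rewrite /t /f p4_0 mul1mx.
have l34 : D * L sw34 = f 0 0 + (N2 - 1) * abc.
  by rewrite -k3 -LZ -sum_p4_12 L_sum; apply: eq_bigr.
have lc : N2 * D * L (Pi *m s12) + N2 * L (s12 *m sw34) =
   2 * f 0 0 + 2 * (N2 - 1) * (ab + ac + abc) + (N2 - 1) * (N2 - 4) * a2.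
  rewrite -k4 -!LZ -LD -sum_chi_p4_12.
  have -> : (N2 * D) *: (Pi *m s12) = \sum_a \sum_b p4 a *m p12 b.
    have gen x y (A B : Mat4) : (x * y) *: ((x^-1 *: A) *m B) = (x * y / x) *: (A *m B).
      by rewrite -scalemxAl scalerA.
    transitivity ((\sum_a p4 a) *m (\sum_b p12 b)).
      by rewrite sum_p12 PiE gen mulrAC mulfV ?mul1r // scalemxAr.
    by rewrite mulmx_suml; apply: eq_bigr => a _; rewrite mulmx_sumr.
  rewrite -big_split L_sum; apply: eq_bigr => a _; rewrite -big_split L_sum; apply: eq_bigr => b _.
  by rewrite LD LZ mulrDl mul1r.
have z0 : zv 0 = 0 :> vec by apply/ffunP => q; rewrite !ffunE.
have zd (z z' : {ffun 'I_n -> bool}) : (zv z == zv z' :> vec) = (z == z') by rewrite (inj_eq (@zv_inj n)).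
have zd0 (z : {ffun 'I_n -> bool}) : (zv z == 0) = (0 == z).
  by rewrite -[X in _ == X]z0 zd eq_sym.
pose bz := {ffun 'I_n -> bool}.
have zc (x : C) : \sum_(z : bz) x = D * x.
  by rewrite sumr_const card_ffun card_bool card_ord mulr_natl.
have zdelta (z : bz) : \sum_(z' : bz) (z == z')%:R = 1 :> C.
  by rewrite -[RHS](sum_delta z (fun=> 1)); apply: eq_bigr => z' _; rewrite mulr1.
have lL : \sum_y \sum_z f (zv y) (zv z) = N2 * a2 + D * (ab + ac + abc - 3 * a2) + (f 0 0 - ab - ac - abc + 2 * a2).
  pose kk := f 0 0 - ab - ac - abc + a2 + a2.
  transitivity (\sum_(y : bz) (D * a2 + (ab - a2) + (abc - a2) + (D * (ac - a2) + kk) * (0 == y)%:R)).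
    apply: eq_bigr => y _.
    transitivity (\sum_(z : bz) (a2 + (ab - a2) * (0 == z)%:R + (ac - a2) * (0 == y)%:R + (abc - a2) * (y == z)%:R
        + kk * (0 == y)%:R * (0 == z)%:R)).
      apply: eq_bigr => z _; rewrite (hf _ _ (chi_zv _ y z)) !zd0 zd (eq_sym z y) /kk; ring.
    by rewrite !big_split /= -!mulr_sumr !zdelta !zc; ring.
  by rewrite !big_split /= -!mulr_sumr !zdelta !zc /kk /N2; ring.
have hD := D_neq0 R n; have hD1 := D1_neq0; have hD2 := D2_neq0.
have -> : L diag1234 = N2^-1 * \sum_y \sum_z f (zv y) (zv z).
  by rewrite LZ L_sum; congr (_ * _); apply: eq_bigr => y _; rewrite L_sum.
rewrite lL [RHS]LZ /sym_image !LD (LZ D).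
have -> : L (Pi *m (1%:M + s12)) = L Pi + L (Pi *m s12) by rewrite mulmxDr mulmx1 LD.
have -> : L 1%:M = f 0 0 by rewrite /f p4_0 p12_0 mulmx1.
exact: diag1234_algebra hD hD1 hD2 lPi l12 l34 lc.
Qed.

End MeasurementTwirl.

(** * The layer map and the measurement channel *)

Section Channel.
Variable R : realType.
Local Notation C := R[i].
Variables n k : nat.
Local Notation d := (2 ^ n)%N.
Local Notation Mat := 'M[C]_d.
Local Notation Mat4 := 'M[C]_(d * d * (d * d)).
Local Notation P := (@pauli_vec R n).
Local Notation chi := (@symp_sign n C).
Local Notation vec := (vec n).
Local Notation D := (d%:R : C).
Local Notation p4 := (@p4 R n).
Local Notation p12 := (@p12 R n).
Local Notation p13 := (@p13 R n).
Local Notation p23 := (@p23 R n).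
Local Notation Pi := (sproj chi D p4 0).
Local Notation s12 := (sw12 D p13 p23).
Local Notation s13 := (sw13 D p13).
Local Notation s23 := (sw23 D p23).
Local Notation s34 := (sw34 R n).
Local Notation R4 := (klein4 chi D p4 p13 p23).
Local Notation tra := (s12 + s13 + s23).
Local Notation cyc := (s13 *m s23 + s23 *m s13).
Implicit Types (X Y U : Mat) (M : Mat4) (u v w a b c e : vec).
Variables (m : nat) (S : 'I_m -> Mat).
Hypothesis HS : clifford_transversal S.
Local Notation TW := (twirl S).
Local Notation That := (That R n k).

Definition layer M : Mat4 := TW (Ad That M).
Local Notation Phi := layer.

Lemma That_unitary : unitary That.
Proof.
rewrite /unitary ThatE tens_adj tens_mul -tens1; apply: eq_tens => q; exact: Tq_unitary.
Qed.

Lemma Phi_fix M : (forall U, unitary U -> Ad U M = M) -> Phi M = M.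
Proof. by move=> h; rewrite /layer (h _ That_unitary) (twirl_fix HS h). Qed.

Lemma PhiD M M' : Phi (M + M') = Phi M + Phi M'.
Proof. by rewrite /layer AdD twirlD. Qed.
Lemma PhiZ x M : Phi (x *: M) = x *: Phi M.
Proof. by rewrite /layer AdZ twirlZ. Qed.
Lemma Phi_mulr M M' : (forall U, unitary U -> Ad U M' = M') -> Phi (M *m M') = Phi M *m M'.
Proof. by move=> h; rewrite /layer (Ad_mul _ _ That_unitary) (h _ That_unitary) (twirl_mulr HS _ h). Qed.

Lemma iter_PhiD l M M' : iter l Phi (M + M') = iter l Phi M + iter l Phi M'.
Proof. by elim: l => //= l ->; rewrite PhiD. Qed.
Lemma iter_PhiZ l x M : iter l Phi (x *: M) = x *: iter l Phi M.
Proof. by elim: l => //= l ->; rewrite PhiZ. Qed.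
Lemma iter_Phi_fix l M : (forall U, unitary U -> Ad U M = M) -> iter l Phi M = M.
Proof. by move=> h; elim: l => //= l ->; exact: Phi_fix. Qed.

Lemma word_unitary (c0 : 'I_m) cs : unitary (word S That c0 cs).
Proof.
elim: cs c0 => [|j cs IH] c0; first exact: (S_unitary HS).
rewrite word_cons /unitary !adjcM !mulmxA -[_ *m _ *m word _ _ _ _]mulmxA IH mulmx1.
by rewrite -[_ *m _ *m That]mulmxA That_unitary mulmx1 (S_unitary HS).
Qed.

Lemma Ad_1s12 U : unitary U -> Ad U (1%:M + s12) = 1%:M + s12.
Proof. by move=> hU; rewrite AdD (Ad1 hU) (Ad_s12 hU). Qed.

Lemma ev1 X1 X2 X3 X4 : ev 1%:M X1 X2 X3 X4 = \tr X1 * \tr X2 * \tr X3 * \tr X4.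
Proof. by rewrite -t4_1 ev_t4_base !mul1mx. Qed.

Lemma ev_mul_s12 M X1 X2 X3 X4 :
  ev (M *m s12) X1 X2 X3 X4 = D^-1 * \sum_c ev M (P c *m X1) (P c *m X2) X3 X4.
Proof.
rewrite s12E -scalemxAr evZ mulmx_sumr ev_sum; congr (_ * _); apply: eq_bigr => c _.
by rewrite ev_t4 !mul1mx.
Qed.

Lemma ev_mul_s13 M X1 X2 X3 X4 :
  ev (M *m s13) X1 X2 X3 X4 = D^-1 * \sum_c ev M (P c *m X1) X2 (P c *m X3) X4.
Proof.
rewrite s13E -scalemxAr evZ mulmx_sumr ev_sum; congr (_ * _); apply: eq_bigr => c _.
by rewrite ev_t4 !mul1mx.
Qed.

Lemma ev_mul_s23 M X1 X2 X3 X4 :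
  ev (M *m s23) X1 X2 X3 X4 = D^-1 * \sum_c ev M X1 (P c *m X2) (P c *m X3) X4.
Proof.
rewrite s23E -scalemxAr evZ mulmx_sumr ev_sum; congr (_ * _); apply: eq_bigr => c _.
by rewrite ev_t4 !mul1mx.
Qed.

Lemma ev_s12 X1 X2 X3 X4 : ev s12 X1 X2 X3 X4 = \tr (X1 *m X2) * \tr X3 * \tr X4.
Proof.
rewrite -[s12]mul1mx ev_mul_s12 (eq_bigr (fun c => \tr (P c *m X1) * \tr (P c *m X2) * (\tr X3 * \tr X4))) => [|c _].
  by rewrite -mulr_suml sum_tr_pauli2 -!mulrA mulKf ?D_neq0.
by rewrite ev1 !mulrA.
Qed.

Lemma mxtrace_delta i j X : \tr (delta_mx i j *m X) = X j i.
Proof.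
rewrite -[RHS](sum_delta i (fun i' => X j i')); apply: eq_bigr => i' _.
rewrite mulE -[X j i'](sum_delta j (fun j' => X j' i')) mulr_sumr; apply: eq_bigr => j' _.
by rewrite mxE mulrA -natrM mulnb (eq_sym i') (eq_sym j').
Qed.

Lemma meas_channelE l X : meas_channel S k l X = (D + 1)^-1 *: ((\tr X)%:M + X).
Proof.
have trE Y : \tr (meas_channel S k l X *m Y) = (D + 1)^-1 * (\tr X * \tr Y + \tr (X *m Y)).
  have h : D * D * \tr (meas_channel S k l X *m Y) = Eens S k l (fun U => ev (diag12 R n)
      (U *m X *m adj U) (U *m Y *m adj U) (U *m 1%:M *m adj U) (U *m 1%:M *m adj U)).
    rewrite /meas_channel /Eens_mx /Eens -scalemxAl mxtraceZ mulrCA; congr (_ * _).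
    rewrite mulmx_suml raddf_sum mulr_sumr; apply: eq_bigr => c0 _.
    rewrite mulmx_suml raddf_sum mulr_sumr; apply: eq_bigr => t _.
    have hU := word_unitary c0 t; move: (word _ _ _ _) hU => U hU.
    rewrite ev_diag12 !mulmx1 (unitaryC hU) mxtrace1 -[RHS]mulrA mulrC; congr (_ * _).
    rewrite mulmx_suml raddf_sum; apply: eq_bigr => b _.
    rewrite -scalemxAl /= mxtraceZ; congr (_ * _).
    rewrite -!mulmxA mxtrace_mulC -!mulmxA.
    by rewrite mxtrace_delta !mulmxA.
  have hN : D * D != 0 by rewrite mulf_neq0 ?D_neq0.
  apply: (mulfI hN); rewrite h Eens_ev -/(iter l Phi _) (twirl_diag12 HS) iter_PhiZ (iter_Phi_fix l Ad_1s12).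
  rewrite evZ evD ev1 ev_s12 !mxtrace1; ring.
apply/matrixP => i j.
have := trE (delta_mx j i).
have trd (Z : Mat) : \tr (Z *m delta_mx j i) = Z i j by rewrite mxtrace_mulC mxtrace_delta.
have trd1 : \tr (delta_mx j i : Mat) = (i == j)%:R by rewrite -[delta_mx _ _]mul1mx trd mxE.
by rewrite !trd trd1 => ->; rewrite !mxE mulr_natr.
Qed.

End Channel.

Section Variance.
Variable R : realType.
Local Notation C := R[i].
Variables n k : nat.
Local Notation d := (2 ^ n)%N.
Local Notation Mat := 'M[C]_d.
Local Notation Mat4 := 'M[C]_(d * d * (d * d)).
Local Notation P := (@pauli_vec R n).
Local Notation chi := (@symp_sign n C).
Local Notation vec := (vec n).
Local Notation D := (d%:R : C).
Local Notation p4 := (@p4 R n).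
Local Notation p12 := (@p12 R n).
Local Notation p13 := (@p13 R n).
Local Notation p23 := (@p23 R n).
Local Notation Pi := (sproj chi D p4 0).
Local Notation s12 := (sw12 D p13 p23).
Local Notation s13 := (sw13 D p13).
Local Notation s23 := (sw23 D p23).
Local Notation s34 := (sw34 R n).
Local Notation R4 := (klein4 chi D p4 p13 p23).
Local Notation tra := (s12 + s13 + s23).
Local Notation cyc := (s13 *m s23 + s23 *m s13).
Local Notation sym12 := (1%:M + s12).
Local Notation sym123 := (1%:M + tra + cyc).
Implicit Types (X Y U : Mat) (M : Mat4) (u v w a b c e : vec).

Lemma ev_mul_s34 M X1 X2 X3 X4 :
  ev (M *m s34) X1 X2 X3 X4 = D^-1 * \sum_c ev M X1 X2 (P c *m X3) (P c *m X4).
Proof.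
rewrite -scalemxAr evZ mulmx_sumr ev_sum; congr (_ * _); apply: eq_bigr => c _.
by rewrite ev_t4 !mul1mx.
Qed.

Lemma ev_s12_s34 X1 X2 X3 X4 : ev (s12 *m s34) X1 X2 X3 X4 = \tr (X1 *m X2) * \tr (X3 *m X4).
Proof.
rewrite ev_mul_s34 (eq_bigr (fun c => \tr (X1 *m X2) * (\tr (P c *m X3) * \tr (P c *m X4)))) => [|c _].
  by rewrite -mulr_sumr sum_tr_pauli2 mulrCA mulKf ?D_neq0.
by rewrite ev_s12 mulrA.
Qed.

Lemma ev_s34 X1 X2 X3 X4 : ev s34 X1 X2 X3 X4 = \tr X1 * \tr X2 * \tr (X3 *m X4).
Proof.
rewrite -[s34]mul1mx ev_mul_s34 (eq_bigr (fun c => \tr X1 * \tr X2 * (\tr (P c *m X3) * \tr (P c *m X4)))) => [|c _].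
  by rewrite -mulr_sumr sum_tr_pauli2 mulrCA mulKf ?D_neq0.
by rewrite ev1 mulrA.
Qed.

Variables (m : nat) (S : 'I_m -> Mat).
Hypothesis HS : clifford_transversal S.

(** Since O is traceless, the terms 1, (12) and (34) vanish, and (12)(34) gives the square of tr(O
    rho). The prefactor is (D + 1)^2 from the inverse channel over (D + 1)(D + 2) from the twirl. *)
Lemma Eens_variance l (O rho : Mat) : \tr O = 0 ->
  Eens S k l (fun U => (\sum_(b : 'I_d) (U *m rho *m adj U) b b * (U *m ((D + 1) *: O) *m adj U) b b) ^+ 2)
  = (D + 1) / (D + 2) * (\tr (O *m rho) ^+ 2 + D * ev (iter l (layer k S) (Pi *m sym12)) O rho O rho).
Proof.
move=> O0; pose Q := (D + 1) *: O.
transitivity (Eens S k l (fun U => ev (diag1234 R n)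
    (U *m Q *m adj U) (U *m rho *m adj U) (U *m Q *m adj U) (U *m rho *m adj U))).
  congr (_ * _); apply: eq_bigr => c0 _; apply: eq_bigr => t _.
  rewrite ev_diag1234 expr2; congr (_ * _); apply: eq_bigr => b _; exact: mulrC.
rewrite Eens_ev (twirl_diag1234 HS).
have evQ M : ev M Q rho Q rho = (D + 1) ^+ 2 * ev M O rho O rho.
  by rewrite /ev -[X in t4 _ X _ _]scale1r -[X in t4 _ _ _ X]scale1r t4Z !mulr1 -scalemxAr mxtraceZ.
rewrite evQ -/(layer k S).
pose L M := ev (iter l (layer k S) M) O rho O rho.
have LD M M' : L (M + M') = L M + L M' by rewrite /L iter_PhiD evD.
have LZ x M : L (x *: M) = x * L M by rewrite /L iter_PhiZ evZ.
have Lfix M : (forall U, unitary U -> Ad U M = M) -> L M = ev M O rho O rho.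
  by move=> h; rewrite /L (iter_Phi_fix k HS l h).
change ((D + 1) ^+ 2 * L (((D + 1) * (D + 2))^-1 *: sym_image R n) = (D + 1) / (D + 2) *
  (\tr (O *m rho) ^+ 2 + D * L (Pi *m sym12))).
rewrite LZ /sym_image !LD (LZ D).
have -> : L 1%:M = 0 by rewrite (Lfix _ (@Ad1 R n)) ev1 O0 !mul0r.
have -> : L s12 = 0 by rewrite (Lfix _ (@Ad_s12 R n)) ev_s12 O0 mulr0 mul0r.
have -> : L s34 = 0 by rewrite (Lfix _ (@Ad_sw34 R n)) ev_s34 O0 !mul0r.
have -> : L (s12 *m s34) = \tr (O *m rho) ^+ 2.
  rewrite Lfix ?ev_s12_s34 ?expr2 // => U hU.
  exact: etrans (Ad_mul _ _ hU) (f_equal2 mulmx (Ad_s12 hU) (Ad_sw34 hU)).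
have h1 := D1_neq0 R n; have h2 := D2_neq0 R n; move: (L _) => y; field.
by rewrite h1 h2.
Qed.

End Variance.

(** * Evaluation on the observable and the state *)

Section KleinEvaluation.
Variable R : realType.
Local Notation C := R[i].
Variables n : nat.
Local Notation d := (2 ^ n)%N.
Local Notation Mat := 'M[C]_d.
Local Notation Mat4 := 'M[C]_(d * d * (d * d)).
Local Notation P := (@pauli_vec R n).
Local Notation chi := (@symp_sign n C).
Local Notation vec := (vec n).
Local Notation D := (d%:R : C).
Local Notation p4 := (@p4 R n).
Local Notation p13 := (@p13 R n).
Local Notation p23 := (@p23 R n).
Local Notation Pi := (sproj chi D p4 0).
Local Notation s12 := (sw12 D p13 p23).
Local Notation s13 := (sw13 D p13).
Local Notation s23 := (sw23 D p23).
Local Notation R4 := (klein4 chi D p4 p13 p23).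
Local Notation tra := (s12 + s13 + s23).
Local Notation cyc := (s13 *m s23 + s23 *m s13).
Local Notation sym12 := (1%:M + s12).
Local Notation sym123 := (1%:M + tra + cyc).
Implicit Types (X Y U : Mat) (M : Mat4) (u v w a b c e : vec).

(** A transposition either joins two cycles of a permutation or splits one; on traces these are
    [tr2] and [tr11]. *)
Let tr2 X Y : D^-1 * (\sum_c \tr (P c *m X) * \tr (P c *m Y)) = \tr (X *m Y).
Proof. by rewrite sum_tr_pauli2 mulKf ?D_neq0. Qed.

Let tr11 X Y : D^-1 * (\sum_c \tr (P c *m X *m P c *m Y)) = \tr X * \tr Y.
Proof. by rewrite sum_tr_pauli11 -mulrA mulKf ?D_neq0. Qed.

Lemma ev_pair (F G : vec -> Mat4) X1 X2 X3 X4 x :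
  (\sum_b \sum_c ev (F b *m G c) X1 X2 X3 X4 = D * D * x) ->
  ev ((D * D)^-1 *: ((\sum_b F b) *m (\sum_b G b))) X1 X2 X3 X4 = x.
Proof.
move=> h; rewrite evZ mulmx_suml ev_sum.
under eq_bigr do rewrite mulmx_sumr ev_sum.
by rewrite h mulKf ?mulf_neq0 ?D_neq0.
Qed.

Lemma ev_klein4 X1 X2 X3 X4 : ev R4 X1 X2 X3 X4 = \tr X1 * \tr X2 * \tr X3 * \tr X4
  + \tr (X1 *m X3) * \tr (X2 *m X4) + \tr (X2 *m X3) * \tr (X1 *m X4) + \tr (X1 *m X2) * \tr (X3 *m X4).
Proof.
rewrite klein4_perms !evD ev1; congr (_ + _ + _ + _); apply: ev_pair.
- transitivity (\sum_b \sum_c (\tr (P b *m X1) * \tr (P b *m X3)) * (\tr (P c *m X2) * \tr (P c *m X4))).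
    by apply: eq_bigr => b _; apply: eq_bigr => c _; rewrite ev_t4 ev_t4_base !mul1mx; ring.
  by under eq_bigr do rewrite -mulr_sumr; rewrite -mulr_suml !sum_tr_pauli2; ring.
- transitivity (\sum_b \sum_c (\tr (P b *m X2) * \tr (P b *m X3)) * (\tr (P c *m X1) * \tr (P c *m X4))).
    by apply: eq_bigr => b _; apply: eq_bigr => c _; rewrite ev_t4 ev_t4_base !mul1mx; ring.
  by under eq_bigr do rewrite -mulr_sumr; rewrite -mulr_suml !sum_tr_pauli2; ring.
- transitivity (\sum_b \sum_c (\tr (P b *m X1) * \tr (P b *m X2)) * (\tr (P c *m X3) * \tr (P c *m X4))).
    by apply: eq_bigr => b _; apply: eq_bigr => c _; rewrite ev_t4 ev_t4_base !mul1mx; ring.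
  by under eq_bigr do rewrite -mulr_sumr; rewrite -mulr_suml !sum_tr_pauli2; ring.
Qed.

Let sum4 (f1 f2 f3 f4 : vec -> C) x1 x2 x3 x4 :
  D^-1 * (\sum_c f1 c) = x1 -> D^-1 * (\sum_c f2 c) = x2 -> D^-1 * (\sum_c f3 c) = x3 -> D^-1 * (\sum_c f4 c) = x4 ->
  D^-1 * \sum_c (f1 c + f2 c + f3 c + f4 c) = x1 + x2 + x3 + x4.
Proof. by move=> <- <- <- <-; rewrite !big_split !mulrDr. Qed.

Let trm x X Y : D^-1 * (\sum_c \tr (P c *m X) * \tr (P c *m Y) * x) = \tr (X *m Y) * x.
Proof. by rewrite -mulr_suml mulrA tr2. Qed.

Let tr11m x X Y : D^-1 * (\sum_c \tr (P c *m X *m P c *m Y) * x) = \tr X * \tr Y * x.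
Proof. by rewrite -mulr_suml mulrA tr11. Qed.

Lemma ev_klein4_s12 X1 X2 X3 X4 : ev (R4 *m s12) X1 X2 X3 X4 = \tr (X1 *m X2) * (\tr X3 * \tr X4)
  + \tr (X1 *m X3 *m (X2 *m X4)) + \tr (X2 *m X3 *m (X1 *m X4)) + \tr X1 * \tr X2 * \tr (X3 *m X4).
Proof.
rewrite ev_mul_s12 (eq_bigr _ (fun c _ => ev_klein4 _ _ _ _)); apply: sum4.
- by rewrite -trm; congr (_ * _); apply: eq_bigr => c _; rewrite !mulrA.
- by rewrite -tr2; congr (_ * _); apply: eq_bigr => c _; rewrite !mulmxA.
- by rewrite -tr2; congr (_ * _); apply: eq_bigr => c _; rewrite !mulmxA.
- by rewrite -tr11m; congr (_ * _); apply: eq_bigr => c _; rewrite !mulmxA.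
Qed.

Lemma ev_klein4_s13 X1 X2 X3 X4 : ev (R4 *m s13) X1 X2 X3 X4 = \tr (X1 *m X3) * (\tr X2 * \tr X4)
  + \tr X1 * \tr X3 * \tr (X2 *m X4) + \tr (X3 *m X2 *m (X1 *m X4)) + \tr (X1 *m X2 *m (X3 *m X4)).
Proof.
rewrite ev_mul_s13 (eq_bigr _ (fun c _ => ev_klein4 _ _ _ _)); apply: sum4.
- by rewrite -trm; congr (_ * _); apply: eq_bigr => c _; ring.
- by rewrite -tr11m; congr (_ * _); apply: eq_bigr => c _; rewrite !mulmxA.
- by rewrite -tr2; congr (_ * _); apply: eq_bigr => c _; rewrite [\tr (X2 *m _)]mxtrace_mulC !mulmxA.
- by rewrite -tr2; congr (_ * _); apply: eq_bigr => c _; rewrite !mulmxA.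
Qed.

Lemma ev_klein4_s23 X1 X2 X3 X4 : ev (R4 *m s23) X1 X2 X3 X4 = \tr (X2 *m X3) * (\tr X1 * \tr X4)
  + \tr (X3 *m X1 *m (X2 *m X4)) + \tr X2 * \tr X3 * \tr (X1 *m X4) + \tr (X2 *m X1 *m (X3 *m X4)).
Proof.
rewrite ev_mul_s23 (eq_bigr _ (fun c _ => ev_klein4 _ _ _ _)); apply: sum4.
- by rewrite -trm; congr (_ * _); apply: eq_bigr => c _; ring.
- by rewrite -tr2; congr (_ * _); apply: eq_bigr => c _; rewrite [\tr (X1 *m _)]mxtrace_mulC !mulmxA.
- by rewrite -tr11m; congr (_ * _); apply: eq_bigr => c _; rewrite !mulmxA.
- by rewrite -tr2; congr (_ * _); apply: eq_bigr => c _; rewrite [\tr (X1 *m _)]mxtrace_mulC !mulmxA.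
Qed.

(** The factors 1 keep the split traces in the shape of [tr11m]. *)
Lemma ev_klein4_s13_s23 X1 X2 X3 X4 : ev (R4 *m (s13 *m s23)) X1 X2 X3 X4 = \tr (X3 *m X1 *m X2) * \tr X4
  + \tr (X3 *m (X2 *m X4)) * \tr X1 + \tr X3 * \tr (X2 *m X1 *m X4) * 1 + \tr X2 * \tr (X3 *m X4 *m X1) * 1.
Proof.
rewrite (mulmxA R4) ev_mul_s23 (eq_bigr _ (fun c _ => ev_klein4_s13 _ _ _ _)); apply: sum4.
- rewrite -trm; congr (_ * _); apply: eq_bigr => c _.
  by rewrite [\tr (X1 *m _)]mxtrace_mulC !mulmxA; ring.
- rewrite -trm; congr (_ * _); apply: eq_bigr => c _; rewrite !mulmxA; ring.
- rewrite -tr11m; congr (_ * _); apply: eq_bigr => c _; rewrite !mulmxA mulr1 //.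
- rewrite -tr11m; congr (_ * _); apply: eq_bigr => c _.
  by rewrite -!mulmxA mxtrace_mulC !mulmxA mulr1.
Qed.

Lemma ev_klein4_s23_s13 X1 X2 X3 X4 : ev (R4 *m (s23 *m s13)) X1 X2 X3 X4 = \tr (X3 *m X2 *m X1) * \tr X4
  + \tr X3 * \tr (X1 *m X2 *m X4) * 1 + \tr (X3 *m (X1 *m X4)) * \tr X2 + \tr X1 * \tr (X3 *m X4 *m X2) * 1.
Proof.
rewrite (mulmxA R4) ev_mul_s13 (eq_bigr _ (fun c _ => ev_klein4_s23 _ _ _ _)); apply: sum4.
- rewrite -trm; congr (_ * _); apply: eq_bigr => c _.
  by rewrite [\tr (X2 *m _)]mxtrace_mulC !mulmxA; ring.
- rewrite -tr11m; congr (_ * _); apply: eq_bigr => c _; rewrite !mulmxA mulr1 //.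
- rewrite -trm; congr (_ * _); apply: eq_bigr => c _; rewrite !mulmxA; ring.
- rewrite -tr11m; congr (_ * _); apply: eq_bigr => c _.
  by rewrite -!mulmxA mxtrace_mulC !mulmxA mulr1.
Qed.

Lemma ev_mul_sym M M1 M2 M3 M4 M5 X1 X2 X3 X4 :
  ev (M *m (1%:M + (M1 + M2 + M3) + (M4 + M5))) X1 X2 X3 X4 =
  ev (M *m (1%:M + M1)) X1 X2 X3 X4 + ev (M *m M2) X1 X2 X3 X4 + ev (M *m M3) X1 X2 X3 X4
  + ev (M *m M4) X1 X2 X3 X4 + ev (M *m M5) X1 X2 X3 X4.
Proof. by rewrite !mulmxDr !evD !addrA. Qed.

Variables O rho : Mat.
Hypothesis trO : \tr O = 0.
Hypothesis trrho : \tr rho = 1.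
Let tq := \tr (O *m O).
Let tr2_ := \tr (rho *m rho).
Let tw := \tr (O *m rho).
Let tw2 := \tr (O *m O *m rho).
Let to := \tr (O *m O *m rho *m rho).
Let tm := \tr (O *m rho *m O *m rho).

Lemma ev_klein4_sym12 : ev (R4 *m sym12) O rho O rho = 2 * tw ^+ 2 + tq * tr2_ + 2 * to.
Proof.
rewrite mulmxDr mulmx1 evD ev_klein4 ev_klein4_s12 trO trrho.
have -> : \tr (rho *m O) = tw by exact: mxtrace_mulC.
have -> : \tr (O *m O *m (rho *m rho)) = to by rewrite mulmxA.
have -> : \tr (rho *m O *m (O *m rho)) = to by rewrite -mulmxA mxtrace_mulC !mulmxA.
rewrite -/tw -/tq -/tr2_; ring.
Qed.

Lemma ev_klein4_sym : ev (R4 *m sym123) O rho O rho =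
  2 * tw ^+ 2 + tq * tr2_ + 4 * to + tq + 2 * tm + 4 * tw2.
Proof.
have e1 : \tr (rho *m O) = tw by exact: mxtrace_mulC.
have e2 : \tr (O *m O *m (rho *m rho)) = to by rewrite mulmxA.
have e3 : \tr (rho *m O *m (O *m rho)) = to.
  by rewrite -mulmxA mxtrace_mulC !mulmxA.
have e4 : \tr (O *m rho *m (O *m rho)) = tm by rewrite mulmxA.
have e6 : \tr (O *m rho *m O) = tw2 by rewrite mxtrace_mulC mulmxA.
have e7 : \tr (O *m (O *m rho)) = tw2 by rewrite mulmxA.
have h1 := ev_klein4_s13 O rho O rho; have h2 := ev_klein4_s23 O rho O rho.
have h3 := ev_klein4_s13_s23 O rho O rho; have h4 := ev_klein4_s23_s13 O rho O rho.
rewrite trO trrho e4 -/tq in h1; rewrite trO e2 e3 in h2.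
rewrite trO trrho e6 in h3; rewrite trO trrho e6 e7 in h4.
apply: etrans (ev_mul_sym _ _ _ _ _ _ _ _ _ _) _.
apply: etrans (f_equal2 +%R (f_equal2 +%R (f_equal2 +%R (f_equal2 +%R ev_klein4_sym12 h1) h2) h3) h4) _.
rewrite -/tw2; generalize tw tq tr2_ to tm tw2; intros; ring.
Qed.

End KleinEvaluation.

Lemma cyc_algebra (F : fieldType) (D x1 x2 x3 x4 u q t2 r2 f : F) : D != 0 ->
  u = q + 2 * f / D - (D * D)^-1 -> D * x1 = u -> D * x2 = t2 -> D * x3 = t2 -> D * x4 = r2 ->
  D * (x1 + - D^-1 * x2 + - D^-1 * x3 + - D^-1 * - D^-1 * x4) = q + 2 * (f - t2) / D - (1 - r2) / (D * D).
Proof.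
move=> h e h1 h2 h3 h4.
have -> : D * (x1 + - D^-1 * x2 + - D^-1 * x3 + - D^-1 * - D^-1 * x4) =
  D * x1 - D^-1 * (D * x2) - D^-1 * (D * x3) + D^-1 * D^-1 * (D * x4) by ring.
by rewrite h1 h2 h3 h4 e; field.
Qed.

Lemma sym_algebra (F : fieldType) (D x1 x2 x3 x4 x5 p q t2 r2 f : F) : D != 0 ->
  D * x1 = p + q -> D * x2 = p + (1 - r2) / D -> D * x3 = q ->
  D * x4 = q + 2 * (f - t2) / D - (1 - r2) / (D * D) -> D * x5 = q + 2 * (f - t2) / D - (1 - r2) / (D * D) ->
  D * (x1 + x2 + x3 + x4 + x5) = 2 * p + 4 * q + (1 - r2) / D + 4 * (f - t2) / D - 2 * (1 - r2) / (D * D).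
Proof. by move=> h h1 h2 h3 h4 h5; rewrite !mulrDr h1 h2 h3 h4 h5; field. Qed.

(** * Values of the sector operators *)

Section SectorEvaluation.
Variable R : realType.
Local Notation C := R[i].
Variables n : nat.
Local Notation d := (2 ^ n)%N.
Local Notation Mat := 'M[C]_d.
Local Notation Mat4 := 'M[C]_(d * d * (d * d)).
Local Notation P := (@pauli_vec R n).
Local Notation chi := (@symp_sign n C).
Local Notation vec := (vec n).
Local Notation D := (d%:R : C).
Local Notation p4 := (@p4 R n).
Local Notation p13 := (@p13 R n).
Local Notation p23 := (@p23 R n).
Local Notation Pi := (sproj chi D p4 0).
Local Notation s12 := (sw12 D p13 p23).
Local Notation s13 := (sw13 D p13).
Local Notation s23 := (sw23 D p23).
Local Notation tra := (s12 + s13 + s23).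
Local Notation cyc := (s13 *m s23 + s23 *m s13).
Local Notation sym12 := (1%:M + s12).
Local Notation sym123 := (1%:M + tra + cyc).
Implicit Types (X Y U : Mat) (M : Mat4) (u v w a b c e : vec).

Lemma swap_sqr (p : vec -> Mat4) : (forall a b, p a *m p b = chi a b *: p (a + b)) ->
  p 0 = 1%:M -> (D^-1 *: \sum_b p b) *m (D^-1 *: \sum_b p b) = 1%:M.
Proof.
move=> pM p0; rewrite -scalemxAl -scalemxAr scalerA mulmx_suml.
under eq_bigr => a _ do rewrite mulmx_sumr (reindex_inj (addrI a)).
rewrite exchange_big /= (eq_bigr (fun b => ((4 ^ n)%:R *+ (b == 0)) *: p b)).
  rewrite (bigD1 0) //= eqxx mulr1n p0 big1 ?addr0 => [|b /negbTE ->].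
    by rewrite scalerA -dim_sqr -mulrA mulKf ?mulVf ?scale1r ?D_neq0.
  by rewrite mulr0n scale0r.
move=> b _; rewrite -sum_chi scaler_suml; apply: eq_bigr => a _.
by rewrite pM addKvec chiDr chivv mul1r.
Qed.

Lemma sw13K : s13 *m s13 = 1%:M. Proof. exact: swap_sqr (@p13M R n) (p13_0 R n). Qed.
Lemma sw23K : s23 *m s23 = 1%:M. Proof. exact: swap_sqr (@p23M R n) (p23_0 R n). Qed.

Let swapXY X Y i j k l : \sum_v (P v *m X) i j * (P v *m Y) k l
  = \sum_v (Y *m P v) i j * (X *m P v) k l.
Proof.
transitivity (D * Y i l * X k j).
  by have := pauli_swap 1%:M 1%:M X Y i j k l; rewrite !mul1mx => <-; apply: eq_bigr => v _; rewrite !mul1mx.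
by have := pauli_swap Y X 1%:M 1%:M i j k l; rewrite !mulmx1 => <-; apply: eq_bigr => v _; rewrite !mulmx1.
Qed.

Lemma sw13_t4 X1 X2 X3 X4 : s13 *m t4 X1 X2 X3 X4 = t4 X3 X2 X1 X4 *m s13.
Proof.
rewrite s13E -scalemxAl -scalemxAr mulmx_suml mulmx_sumr; congr (_ *: _).
apply: mat4P => i1 i2 i3 i4 j1 j2 j3 j4.
rewrite !(eq_bigr _ (fun v _ => t4_mul _ _ _ _ _ _ _ _)) !sumt4E !mul1mx !mulmx1.
rewrite -!mulr_suml; congr (_ * _).
under eq_bigr do rewrite mulrAC; under [RHS]eq_bigr do rewrite mulrAC.
rewrite -!mulr_suml; congr (_ * _); exact: swapXY.
Qed.

Lemma sw23_t4 X1 X2 X3 X4 : s23 *m t4 X1 X2 X3 X4 = t4 X1 X3 X2 X4 *m s23.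
Proof.
rewrite s23E -scalemxAl -scalemxAr mulmx_suml mulmx_sumr; congr (_ *: _).
apply: mat4P => i1 i2 i3 i4 j1 j2 j3 j4.
rewrite !(eq_bigr _ (fun v _ => t4_mul _ _ _ _ _ _ _ _)) !sumt4E !mul1mx !mulmx1.
rewrite -!mulr_suml; congr (_ * _).
under eq_bigr do rewrite -mulrA; under [RHS]eq_bigr do rewrite -mulrA.
rewrite -!mulr_sumr; congr (_ * _); exact: swapXY.
Qed.

Let swap_conj M (F G : vec -> Mat4) : (forall b, M *m F b = G b *m M) ->
  M *m (D^-1 *: \sum_b F b) = (D^-1 *: \sum_b G b) *m M.
Proof.
by move=> h; rewrite -scalemxAr -scalemxAl mulmx_sumr mulmx_suml; congr (_ *: _); apply: eq_bigr => b _.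
Qed.

Lemma sw13_12 : s13 *m s12 = s23 *m s13.
Proof. by rewrite [s12]s12E [X in _ = X *m _]s23E; apply: swap_conj => b; exact: sw13_t4. Qed.
Lemma sw23_12 : s23 *m s12 = s13 *m s23.
Proof. by rewrite [s12]s12E [X in _ = X *m _]s13E; apply: swap_conj => b; exact: sw23_t4. Qed.

Lemma ev_Pi X1 X2 X3 X4 : ev Pi X1 X2 X3 X4 =
  (D * D)^-1 * \sum_a \tr (P a *m X1) * \tr (P a *m X2) * \tr (P a *m X3) * \tr (P a *m X4).
Proof.
rewrite PiE evZ ev_sum; congr (_ * _); apply: eq_bigr => a _.
by rewrite p4E ev_t4_base.
Qed.

Lemma tr_PP a b X : \tr (P a *m (P b *m X)) = kap R a b * \tr (P (a + b) *m X).
Proof. by rewrite mulmxA pauli_mul -scalemxAl mxtraceZ. Qed.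

Lemma pauli_conj a c : P a *m P c *m P a = chi a c *: P c.
Proof. by rewrite (pauli_comm R a c) -scalemxAl -mulmxA pauli_sqr mulmx1. Qed.

Lemma chi_tr_PP a c X : chi a c * \tr (P a *m P c *m X) = \tr (P c *m P a *m X).
Proof. by rewrite (pauli_comm R a c) -scalemxAl mxtraceZ mulrA chi_sqr mul1r. Qed.

Let comb3 X Y Z : \sum_a \sum_c \tr (P a *m (P c *m X)) * \tr (P c *m Y) * \tr (P a *m Z)
  = D * D * \tr (Y *m X *m Z).
Proof.
rewrite exchange_big /=.
transitivity (\sum_c D * (\tr (P c *m (X *m Z)) * \tr (P c *m Y))).
  apply: eq_bigr => c _; under eq_bigr do rewrite mulrAC.
  by rewrite -mulr_suml sum_tr_pauli2 -mulrA -mulmxA.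
by rewrite -mulr_sumr sum_tr_pauli2 mulrA; congr (_ * _); rewrite mxtrace_mulC mulmxA.
Qed.

Let comb3' X Y Z : \sum_a \sum_c chi a c * \tr (P a *m (P c *m X)) * \tr (P c *m Y) * \tr (P a *m Z)
  = D * D * \tr (X *m Y *m Z).
Proof.
transitivity (\sum_a D * (\tr (P a *m (X *m Y)) * \tr (P a *m Z))).
  apply: eq_bigr => a _; rewrite -mulr_suml mulrA; congr (_ * _).
  rewrite mulmxA -sum_tr_pauli2; apply: eq_bigr => c _.
  by rewrite mulmxA chi_tr_PP -mulmxA.
by rewrite -mulr_sumr sum_tr_pauli2 mulrA.
Qed.

Let sum_trPP a (f : vec -> C) : \sum_b \tr (P a *m P b) * f b = D * f a.
Proof.
rewrite (bigD1 a) //= pauli_sqr mxtrace1 big1 ?addr0 // => b hb.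
rewrite pauli_mul mxtraceZ mxtrace_pauli addvec_eq0 eq_sym (negbTE hb) mulr0n mulr0 mul0r //.
Qed.

Let comb4 X Y Z : \sum_b \sum_a \sum_c \tr (P a *m P b) *
    (\tr (P a *m P c *m P b *m Y) * \tr (P a *m (P c *m X)) * \tr (P a *m Z))
  = D * (D * D * \tr (X *m Y *m Z)).
Proof.
rewrite -comb3' exchange_big mulr_sumr; apply: eq_bigr => a _ /=.
rewrite exchange_big mulr_sumr; apply: eq_bigr => c _ /=.
by rewrite sum_trPP pauli_conj -scalemxAl mxtraceZ; ring.
Qed.

Lemma ev_Pi_s12 X1 X2 X3 X4 : ev (Pi *m s12) X1 X2 X3 X4 = D^-1 * (D * D)^-1 *
  \sum_c \sum_a \tr (P a *m (P c *m X1)) * \tr (P a *m (P c *m X2)) * \tr (P a *m X3) * \tr (P a *m X4).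
Proof. by rewrite ev_mul_s12 (eq_bigr _ (fun c _ => ev_Pi _ _ _ _)) -mulr_sumr mulrA. Qed.

Lemma ev_Pi_s13 X1 X2 X3 X4 : ev (Pi *m s13) X1 X2 X3 X4 = D^-1 * (D * D)^-1 *
  \sum_c \sum_a \tr (P a *m (P c *m X1)) * \tr (P a *m X2) * \tr (P a *m (P c *m X3)) * \tr (P a *m X4).
Proof. by rewrite ev_mul_s13 (eq_bigr _ (fun c _ => ev_Pi _ _ _ _)) -mulr_sumr mulrA. Qed.

Lemma ev_Pi_s23 X1 X2 X3 X4 : ev (Pi *m s23) X1 X2 X3 X4 = D^-1 * (D * D)^-1 *
  \sum_c \sum_a \tr (P a *m X1) * \tr (P a *m (P c *m X2)) * \tr (P a *m (P c *m X3)) * \tr (P a *m X4).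
Proof. by rewrite ev_mul_s23 (eq_bigr _ (fun c _ => ev_Pi _ _ _ _)) -mulr_sumr mulrA. Qed.

Lemma ev_Pi_s13_s23_1 X2 X3 X4 :
  ev (Pi *m (s13 *m s23)) 1%:M X2 X3 X4 = D^-1 * \tr (X3 *m X2 *m X4).
Proof.
rewrite (mulmxA Pi) ev_mul_s23 (eq_bigr _ (fun c _ => ev_Pi_s13 _ _ _ _)) -mulr_sumr.
have E c : \sum_b \sum_a \tr (P a *m (P b *m 1%:M)) * \tr (P a *m (P c *m X2)) * \tr (P a *m (P b *m (P c *m X3)))
    * \tr (P a *m X4) = D * \sum_a \tr (P a *m (P c *m X2)) * \tr (P c *m X3) * \tr (P a *m X4).
  rewrite exchange_big mulr_sumr; apply: eq_bigr => a _ /=.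
  under eq_bigr => b _ do rewrite mulmx1 -!mulrA.
  by rewrite sum_trPP (mulmxA (P a) (P a)) pauli_sqr mul1mx !mulrA.
rewrite (eq_bigr _ (fun c _ => E c)) -mulr_sumr exchange_big comb3; field; exact: D_neq0.
Qed.

Lemma ev_Pi_s13_s23_3 X1 X2 X4 :
  ev (Pi *m (s13 *m s23)) X1 X2 1%:M X4 = D^-1 * \tr (X2 *m X1 *m X4).
Proof.
(* The same 3-cycle is written with (13) last, so that its Pauli sum meets the identity on copy 3;
   the trace of P a P b then forces b = a. *)
rewrite -(s12_mul_s13 sw13K sw13_12) (mulmxA Pi) ev_mul_s13 (eq_bigr _ (fun c _ => ev_Pi_s12 _ _ _ _)) -mulr_sumr.
have E b : \sum_c \sum_a \tr (P a *m (P c *m (P b *m X1))) * \tr (P a *m (P c *m X2)) * \tr (P a *m (P b *m 1%:M))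
    * \tr (P a *m X4) = \sum_a \sum_c \tr (P a *m P b) * (\tr (P a *m P c *m P b *m X1) * \tr (P a *m (P c *m X2)) * \tr (P a *m X4)).
  rewrite exchange_big; apply: eq_bigr => a _; apply: eq_bigr => c _ /=.
  by rewrite mulmx1 !mulmxA; ring.
rewrite (eq_bigr _ (fun b _ => E b)) comb4; field; exact: D_neq0.
Qed.

Lemma ev_Pi_s23_s13_1 X2 X3 X4 :
  ev (Pi *m (s23 *m s13)) 1%:M X2 X3 X4 = D^-1 * \tr (X2 *m X3 *m X4).
Proof.
rewrite (mulmxA Pi) ev_mul_s13 (eq_bigr _ (fun c _ => ev_Pi_s23 _ _ _ _)) -mulr_sumr.
have E b : \sum_c \sum_a \tr (P a *m (P b *m 1%:M)) * \tr (P a *m (P c *m X2)) * \tr (P a *m (P c *m (P b *m X3)))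
    * \tr (P a *m X4) = \sum_a \sum_c \tr (P a *m P b) * (\tr (P a *m P c *m P b *m X3) * \tr (P a *m (P c *m X2)) * \tr (P a *m X4)).
  rewrite exchange_big; apply: eq_bigr => a _; apply: eq_bigr => c _ /=.
  by rewrite mulmx1 !mulmxA; ring.
rewrite (eq_bigr _ (fun b _ => E b)) comb4; field; exact: D_neq0.
Qed.

Lemma ev_Pi_s23_s13_3 X1 X2 X4 :
  ev (Pi *m (s23 *m s13)) X1 X2 1%:M X4 = D^-1 * \tr (X1 *m X2 *m X4).
Proof.
rewrite -(s12_mul_s23 sw23K sw23_12) (mulmxA Pi) ev_mul_s23 (eq_bigr _ (fun c _ => ev_Pi_s12 _ _ _ _)) -mulr_sumr.
have E b : \sum_c \sum_a \tr (P a *m (P c *m X1)) * \tr (P a *m (P c *m (P b *m X2))) * \tr (P a *m (P b *m 1%:M))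
    * \tr (P a *m X4) = \sum_a \sum_c \tr (P a *m P b) * (\tr (P a *m P c *m P b *m X2) * \tr (P a *m (P c *m X1)) * \tr (P a *m X4)).
  rewrite exchange_big; apply: eq_bigr => a _; apply: eq_bigr => c _ /=.
  by rewrite mulmx1 !mulmxA; ring.
rewrite (eq_bigr _ (fun b _ => E b)) comb4; field; exact: D_neq0.
Qed.

Lemma ev_lin1 M x X1 Y1 X2 X3 X4 :
  ev M (X1 + x *: Y1) X2 X3 X4 = ev M X1 X2 X3 X4 + x * ev M Y1 X2 X3 X4.
Proof.
rewrite /ev -mxtraceZ -mxtraceD scalemxAr -mulmxDr; congr (\tr (_ *m _)).
by apply: mat4P => *; rewrite mxE [in RHS]mxE !t4E !mxE; ring.
Qed.

Lemma ev_lin3 M x X1 X2 X3 Y3 X4 :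
  ev M X1 X2 (X3 + x *: Y3) X4 = ev M X1 X2 X3 X4 + x * ev M X1 X2 Y3 X4.
Proof.
rewrite /ev -mxtraceZ -mxtraceD scalemxAr -mulmxDr; congr (\tr (_ *m _)).
by apply: mat4P => *; rewrite mxE [in RHS]mxE !t4E !mxE; ring.
Qed.

Lemma ev_lin13 M x X Y Z Z' : ev M (X + x *: Y) Z (X + x *: Y) Z' =
  ev M X Z X Z' + x * ev M X Z Y Z' + x * ev M Y Z X Z' + x * x * ev M Y Z Y Z'.
Proof. by rewrite ev_lin1 !ev_lin3 mulrDr !addrA mulrA. Qed.

Variables f rho : Mat.
Hypothesis trf : \tr f = 1.
(** Rank one in entries: f tensor f is fixed by the swap of its two copies. *)
Hypothesis rank1 : forall i j k l, f i l * f k j = f i j * f k l.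
Hypothesis trrho : \tr rho = 1.

Lemma rank1_mul X : f *m X *m f = \tr (X *m f) *: f.
Proof.
apply/matrixP => i j; rewrite mulE mxE /mxtrace mulr_suml.
transitivity (\sum_k \sum_l f i k * X k l * f l j).
  by rewrite exchange_big; apply: eq_bigr => l _; rewrite mulE mulr_suml.
apply: eq_bigr => k _; rewrite mulE mulr_suml; apply: eq_bigr => l _.
by rewrite mulrAC rank1; ring.
Qed.

Lemma s13_rank1 X Y : s13 *m t4 f X f Y = t4 f X f Y.
Proof.
rewrite s13E -scalemxAl mulmx_suml.
under eq_bigr do rewrite t4_mul !mul1mx.
apply: mat4P => i1 i2 i3 i4 j1 j2 j3 j4; rewrite mxE sumt4E t4E.
transitivity (D^-1 * ((\sum_v (1%:M *m P v *m f) i1 j1 * (1%:M *m P v *m f) i3 j3) * (X i2 j2 * Y i4 j4))).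
  congr (_ * _); rewrite mulr_suml; apply: eq_bigr => v _; rewrite !mul1mx; ring.
rewrite pauli_swap !mul1mx -!mulrA mulKf ?D_neq0 // mulrA rank1; ring.
Qed.

Let O : Mat := f + (- D^-1) *: 1%:M.
Let F := \tr (f *m rho).
Let t2 := \tr (f *m rho *m rho).
Let r2 := \tr (rho *m rho).
Let fa a := \tr (P a *m f).
Let ya a := \tr (P a *m rho).
(** The joint Pauli spectrum of observable and state. Its sum of squares and its symplectic
    autocorrelation are, up to normalization, the values at Pi and Pi (12); the remaining values
    reduce to these and to traces of products of f and rho. *)
Definition overlap a : C := \tr (P a *m O) * \tr (P a *m rho).
Let p := D^-1 * \sum_a overlap a ^+ 2.
Let q12 := (D * D)^-1 * \sum_c \sum_a chi a c * overlap c * overlap a.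

Lemma tr_PO a : \tr (P a *m O) = \tr (P a *m f) - (a == 0)%:R.
Proof.
rewrite mulmxDr mxtraceD -scalemxAr mulmx1 mxtraceZ mxtrace_pauli mulNr; congr (_ - _).
by case: (a == 0); rewrite /= ?mulr1n ?mulr0n ?mulr0 ?mulVf ?D_neq0.
Qed.

Lemma fa0 : fa 0 = 1. Proof. by rewrite /fa pauli_vec0 mul1mx. Qed.
Lemma ya0 : ya 0 = 1. Proof. by rewrite /ya pauli_vec0 mul1mx. Qed.

Lemma overlapE a : overlap a = fa a * ya a - (a == 0)%:R.
Proof.
by rewrite /overlap tr_PO mulrBl -/(ya a); case: eqP => [->|_]; rewrite ?ya0 ?mul1r ?mul0r.
Qed.

Lemma D_ev_Pi : D * ev Pi O rho O rho = p.
Proof.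
rewrite ev_Pi invfM -!mulrA mulVKf ?D_neq0 //; congr (_ * _); apply: eq_bigr => a _.
by rewrite /overlap; ring.
Qed.

Let pair_sum (X : Mat) : \sum_c \sum_a \tr (P a *m (P c *m X)) * \tr (P a *m (P c *m rho)) * \tr (P a *m X) * \tr (P a *m rho)
 = \sum_c \sum_a chi a c * (\tr (P c *m X) * \tr (P c *m rho)) * (\tr (P a *m X) * \tr (P a *m rho)).
Proof.
rewrite exchange_big [RHS]exchange_big; apply: eq_bigr => a _ /=.
rewrite (reindex_inj (addrI a)); apply: eq_bigr => c _ /=.
rewrite !tr_PP addKvec; transitivity (kap R a (a + c) * kap R a (a + c) * (\tr (P c *m X) * \tr (P c *m rho)) * (\tr (P a *m X) * \tr (P a *m rho))).
  by ring.
by rewrite kap_sqr chiDr chivv mul1r.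
Qed.

Lemma D_ev_Pi_s12 : D * ev (Pi *m s12) O rho O rho = q12.
Proof.
rewrite ev_Pi_s12 -!mulrA mulVKf ?D_neq0 //; congr (_ * _).
by rewrite pair_sum; apply: eq_bigr => c _; apply: eq_bigr => a _; rewrite /overlap; ring.
Qed.

Lemma D_ev_Pi_s23 : D * ev (Pi *m s23) O rho O rho = q12.
Proof.
rewrite ev_Pi_s23 -!mulrA mulVKf ?D_neq0 //; congr (_ * _).
transitivity (\sum_c \sum_a \tr (P a *m (P c *m O)) * \tr (P a *m (P c *m rho)) * \tr (P a *m O) * \tr (P a *m rho)).
  by apply: eq_bigr => c _; apply: eq_bigr => a _; ring.
by rewrite pair_sum; apply: eq_bigr => c _; apply: eq_bigr => a _; rewrite /overlap; ring.
Qed.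

(** O and f have the same Pauli coefficients except at the label 0, where that of O vanishes. *)
Lemma sum_overlap_fy (h : vec -> C) :
  \sum_a fa a * ya a * h a = \sum_a overlap a * h a + h 0.
Proof.
rewrite (bigD1 0) //= [in RHS](bigD1 0) //= overlapE eqxx fa0 ya0 mul1r subrr mul0r add0r mul1r addrC.
by congr (_ + _); apply: eq_bigr => a ha; rewrite overlapE (negbTE ha) subr0.
Qed.

Lemma sum_fy : \sum_a fa a * ya a = D * F.
Proof. exact: sum_tr_pauli2. Qed.

(** Because f X f = tr(X f) f, the squared Pauli spectrum of a pure state is its own symplectic
    Fourier transform up to the factor D. *)
Lemma sum_chi_ff a : \sum_c chi a c * fa c ^+ 2 = D * fa a ^+ 2.
Proof.
transitivity (\sum_c \tr (P c *m (P a *m f *m P a)) * \tr (P c *m f)).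
  apply: eq_bigr => c _; rewrite expr2 mulrA; congr (_ * _).
  by rewrite -mxtraceZ scalemxAl -pauli_conj [in RHS]mulmxA [RHS]mxtrace_mulC !mulmxA.
have e : P a *m f *m P a *m f = P a *m (f *m P a *m f) by rewrite !mulmxA.
by rewrite sum_tr_pauli2 e rank1_mul -scalemxAr mxtraceZ expr2.
Qed.

Let sum_y2 : \sum_a ya a ^+ 2 = D * r2.
Proof. by rewrite -sum_tr_pauli2; apply: eq_bigr => a _; rewrite expr2. Qed.

Lemma D_ev_Pi_s13 : D * ev (Pi *m s13) O rho O rho = p + (1 - r2) / D.
Proof.
rewrite ev_Pi_s13 -(mulrA D^-1) mulVKf ?D_neq0 //.
have -> : \sum_c \sum_a \tr (P a *m (P c *m O)) * \tr (P a *m rho) * \tr (P a *m (P c *m O)) * \tr (P a *m rho)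
   = D * (\sum_a overlap a ^+ 2 + 1) - D * r2.
  transitivity (\sum_a (D * (fa a * ya a) ^+ 2 - ya a ^+ 2)).
    rewrite exchange_big; apply: eq_bigr => a _ /=.
    rewrite (reindex_inj (addrI a)) /=.
    transitivity (\sum_c (chi a c * fa c ^+ 2 - (c == 0)%:R) * ya a ^+ 2).
      apply: eq_bigr => c _; rewrite !tr_PP addKvec tr_PO.
      transitivity (kap R a (a + c) * kap R a (a + c) * (fa c - (c == 0)%:R) ^+ 2 * ya a ^+ 2); first by ring.
      rewrite kap_sqr chiDr chivv mul1r; congr (_ * _).
      by case: eqP => [->|_]; rewrite ?subr0 // fa0 chiv0 expr1n subrr expr2 !mulr0 mulr1 subrr.
    rewrite -mulr_suml sumrB sum_chi_ff.
    have -> : \sum_(c : vec) (c == 0)%:R = 1 :> C.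
      by rewrite -[RHS](sum_delta (0 : vec) (fun=> 1)); apply: eq_bigr => c _; rewrite mulr1 eq_sym.
    by ring.
  rewrite sumrB sum_y2; congr (_ - _); rewrite -mulr_sumr; congr (_ * _).
  transitivity (\sum_a fa a * ya a * (fa a * ya a)); first by apply: eq_bigr => a _; rewrite expr2.
  rewrite sum_overlap_fy fa0 ya0 mulr1; congr (_ + _).
  transitivity (\sum_a fa a * ya a * overlap a); first by apply: eq_bigr => a _; rewrite mulrC.
  rewrite sum_overlap_fy overlapE fa0 ya0 eqxx mulr1 subrr addr0.
  by apply: eq_bigr => a _; rewrite expr2.
rewrite /p; field; exact: D_neq0.
Qed.

Let u := (D * D)^-1 * \sum_c \sum_a chi a c * (fa c * ya c) * (fa a * ya a).

Let u_q12 : u = q12 + 2 * F / D - (D * D)^-1.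
Proof.
rewrite /u /q12.
have -> : \sum_c \sum_a chi a c * (fa c * ya c) * (fa a * ya a) =
   \sum_c \sum_a chi a c * overlap c * overlap a + 2 * (D * F) - 1.
  transitivity (\sum_c (fa c * ya c * (\sum_a overlap a * chi a c + 1))).
    apply: eq_bigr => c _.
    have := sum_overlap_fy (fun a => chi a c); rewrite chi0v => <-; rewrite mulr_sumr.
    by apply: eq_bigr => a _; ring.
  rewrite sum_overlap_fy.
  have -> : \sum_a overlap a * chi a 0 = D * F - 1.
    have := sum_overlap_fy (fun=> 1); rewrite -sum_fy => /(canLR (addrK _)) e.
    rewrite -(eq_bigr _ (fun a _ => mulr1 (fa a * ya a))) e.
    by apply: eq_bigr => a _; rewrite chiv0.
  rewrite (eq_bigr (fun c => \sum_a chi a c * overlap c * overlap a + overlap c)) => [|c _]; last first.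
    rewrite mulrDr mulr1 mulr_sumr; congr (_ + _); apply: eq_bigr => a _; ring.
  rewrite big_split /=.
  have -> : \sum_a overlap a = D * F - 1.
    have := sum_overlap_fy (fun=> 1); rewrite -sum_fy => /(canLR (addrK _)) e.
    rewrite -(eq_bigr _ (fun a _ => mulr1 (fa a * ya a))) e.
    by apply: eq_bigr => a _; rewrite mulr1.
  by ring.
field; exact: D_neq0.
Qed.

Let D_ev_Pi_s12_ff : D * ev (Pi *m s12) f rho f rho = u.
Proof. by rewrite ev_Pi_s12 -(mulrA D^-1) mulVKf ?D_neq0 // pair_sum. Qed.

Let D_ev_Pi_s23_ff : D * ev (Pi *m s23) f rho f rho = u.
Proof.
rewrite ev_Pi_s23 -!mulrA mulVKf ?D_neq0 //; congr (_ * _).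
by rewrite -pair_sum; do 2!apply: eq_bigr => ? _; ring.
Qed.

Lemma ev_s13_rank1 M : ev (M *m s13) f rho f rho = ev M f rho f rho.
Proof. by rewrite /ev -mulmxA s13_rank1. Qed.

(** For a 3-cycle O is expanded as f - 1/d on copies 1 and 3. On the pair f, f the swap (13) is
    absorbed and a single transposition remains; the other three terms have an identity on copy 1 or
    3 and are plain traces. *)
Let cyc_rest M : D * ev M f rho f rho = u -> D * ev M f rho 1%:M rho = t2 -> D * ev M 1%:M rho f rho = t2 ->
  D * ev M 1%:M rho 1%:M rho = r2 -> D * ev M O rho O rho = q12 + 2 * (F - t2) / D - (1 - r2) / (D * D).
Proof.
move=> h1 h2 h3 h4; apply: etrans (congr1 _ (ev_lin13 _ _ _ _ _ _)) _.
exact: cyc_algebra (D_neq0 R n) u_q12 h1 h2 h3 h4.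
Qed.

Lemma D_ev_Pi_s13_s23 : D * ev (Pi *m (s13 *m s23)) O rho O rho = q12 + 2 * (F - t2) / D - (1 - r2) / (D * D).
Proof.
apply: cyc_rest.
- by rewrite -(s12_mul_s13 sw13K sw13_12) (mulmxA Pi) ev_s13_rank1 D_ev_Pi_s12_ff.
- rewrite ev_Pi_s13_s23_3 mulVKf ?D_neq0 //; by rewrite -mulmxA mxtrace_mulC.
- rewrite ev_Pi_s13_s23_1 mulVKf ?D_neq0 //.
- by rewrite ev_Pi_s13_s23_1 mulVKf ?D_neq0 // mul1mx.
Qed.

Lemma D_ev_Pi_s23_s13 : D * ev (Pi *m (s23 *m s13)) O rho O rho = q12 + 2 * (F - t2) / D - (1 - r2) / (D * D).
Proof.
apply: cyc_rest.
- by rewrite (mulmxA Pi) ev_s13_rank1 D_ev_Pi_s23_ff.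
- by rewrite ev_Pi_s23_s13_3 mulVKf ?D_neq0.
- rewrite ev_Pi_s23_s13_1 mulVKf ?D_neq0 //; by rewrite -mulmxA mxtrace_mulC.
- by rewrite ev_Pi_s23_s13_1 mulVKf ?D_neq0 // mulmx1.
Qed.

Lemma D_ev_Pi_sym12 : D * ev (Pi *m sym12) O rho O rho = p + q12.
Proof. by rewrite mulmxDr mulmx1 evD mulrDr D_ev_Pi D_ev_Pi_s12. Qed.

Lemma D_ev_Pi_sym : D * ev (Pi *m sym123) O rho O rho =
  2 * p + 4 * q12 + (1 - r2) / D + 4 * (F - t2) / D - 2 * (1 - r2) / (D * D).
Proof.
apply: etrans (congr1 _ (ev_mul_sym _ _ _ _ _ _ _ _ _ _)) _.
exact: sym_algebra (D_neq0 R n) D_ev_Pi_sym12 D_ev_Pi_s13 D_ev_Pi_s23 D_ev_Pi_s13_s23 D_ev_Pi_s23_s13.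
Qed.

End SectorEvaluation.

Section IteratedLayer.
Variable R : realType.
Local Notation C := R[i].
Variables n k : nat.
Local Notation d := (2 ^ n)%N.
Local Notation Mat := 'M[C]_d.
Local Notation Mat4 := 'M[C]_(d * d * (d * d)).
Local Notation P := (@pauli_vec R n).
Local Notation chi := (@symp_sign n C).
Local Notation vec := (vec n).
Local Notation D := (d%:R : C).
Local Notation p4 := (@p4 R n).
Local Notation p13 := (@p13 R n).
Local Notation p23 := (@p23 R n).
Local Notation Pi := (sproj chi D p4 0).
Local Notation s12 := (sw12 D p13 p23).
Local Notation s13 := (sw13 D p13).
Local Notation s23 := (sw23 D p23).
Local Notation R4 := (klein4 chi D p4 p13 p23).
Local Notation tra := (s12 + s13 + s23).
Local Notation cyc := (s13 *m s23 + s23 *m s13).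
Local Notation sym12 := (1%:M + s12).
Local Notation sym123 := (1%:M + tra + cyc).
Local Notation "x %:RC" := (real_complex R x) (at level 2, format "x %:RC").
Hypothesis hk : (k <= n)%N.
Variables (m : nat) (S : 'I_m -> Mat).
Hypothesis HS : clifford_transversal S.
Variable c : coefs (d%:R : R) ((3 / 4) ^+ k) (2^-1 ^+ k) (0 ^+ k).

Let rcE := (rmorph_nat (real_complex R), rmorph1 (real_complex R), rmorph0 (real_complex R),
  rmorphXn (real_complex R), fmorphV (real_complex R), rmorphM (real_complex R),
  rmorphB (real_complex R), rmorphD (real_complex R)).

Lemma iter_layer l : iter l (layer k S) (Pi *m sym12) =
  (rate_std c)%:RC ^+ l *: (Pi *m (sym12 - 3^-1 *: sym123))
  + ((1 - (rate_std c)%:RC ^+ l) * (D * D)^-1) *: (R4 *m (sym12 - 3^-1 *: sym123))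
  + 3^-1 *: ((rate_triv c)%:RC ^+ l *: (Pi *m sym123) + ((1 - (rate_triv c)%:RC ^+ l) * (D * (D + 3))^-1) *: (R4 *m sym123)).
Proof.
have e1 := congr1 (real_complex R) (cE1 c); rewrite !rcE in e1.
have e2 := congr1 (real_complex R) (cE2 c); rewrite !rcE in e2.
have e3 := congr1 (real_complex R) (cE3 c); rewrite !rcE in e3.
have e4 := congr1 (real_complex R) (cE4 c); rewrite !rcE in e4.
have e5 := congr1 (real_complex R) (cE5 c); rewrite !rcE in e5.
have e6 := congr1 (real_complex R) (cE6 c); rewrite !rcE in e6.
have e7 := congr1 (real_complex R) (rate_stdE c); rewrite !rcE in e7.
have e8 := congr1 (real_complex R) (rate_trivE c); rewrite !rcE in e8.
have e9 := congr1 (real_complex R) (c_ys c); rewrite !rcE in e9.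
have e10 := congr1 (real_complex R) (c_y1 c); rewrite !rcE in e10.
have hPi := twirl_T_Pi hk HS e1 e2 e3 e4 e5 e6.
have h13 M : layer k S (M *m s13) = layer k S M *m s13 by apply: (Phi_mulr k HS); exact: Ad_s13.
have h23 M : layer k S (M *m s23) = layer k S M *m s23 by apply: (Phi_mulr k HS); exact: Ad_s23.
have hK : layer k S R4 = R4 by apply: (Phi_fix k HS); exact: Ad_klein4.
exact: (iter_Phi (sw13K R n) (sw23K R n) (sw13_12 R n) (sw23_12 R n) (@PhiD R n k m S) (@PhiZ R n k m S)
   h13 h23 hK hPi e7 e8 e9 e10).
Qed.

End IteratedLayer.

(** The quadratic that Cauchy-Schwarz produces when N is the squared modulus of the inner product: N
    then occurs in two coefficients, and the conclusion is linear in N. *)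
Lemma discriminant_le (F : realFieldType) (a b N : F) : 0 <= a -> 0 <= b -> 0 <= N ->
  (forall t, 0 <= t ^+ 2 * a - 2 * t * N + N * b) -> N <= a * b.
Proof.
move=> a0 b0 N0 h; have [->|N1] := eqVneq N 0; first exact: mulr_ge0.
have Np : 0 < N by rewrite lt_def N1.
have [a1|a1] := eqVneq a 0.
  (* For a = 0 the form is N (b - 2 t), which is negative at t = b + 1 since N is positive. *)
  have := h (b + 1); rewrite a1 mulr0 add0r => h1.
  have : 0 <= N * (- (b + 2)) by lra.
  by rewrite pmulr_rge0 // => h2; lra.
have ap : 0 < a by rewrite lt_def a1.
have := h (N / a).
have -> : (N / a) ^+ 2 * a - 2 * (N / a) * N + N * b = N * ((a * b - N) / a) by field.
by rewrite pmulr_rge0 // pmulr_lge0 ?invr_gt0 // subr_ge0.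
Qed.

(** * Density operators *)

Section Positive.
Variable R : realType.
Local Notation C := R[i].
Local Notation "x %:RC" := (real_complex R x) (at level 2, format "x %:RC").

Lemma adjE p q (A : 'M[C]_(p, q)) i j : adj A i j = conjc (A j i).
Proof. by rewrite !mxE. Qed.

Lemma tr_adj p (A : 'M[C]_p) : \tr (adj A) = conjc (\tr A).
Proof. by rewrite /mxtrace rmorph_sum; apply: eq_bigr => i _; rewrite adjE. Qed.

Lemma conjc_real (z : C) : conjc z = z -> z = (complex.Re z)%:RC.
Proof.
case: z => a b /= /eqP; rewrite eq_complex /= eqxx /= => /eqP h.
by congr (_ +i* _)%C; lra.
Qed.

Lemma herm_tr_real p (A B : 'M[C]_p) : adj A = A -> adj B = B ->
  \tr (A *m B) = (complex.Re (\tr (A *m B)))%:RC.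
Proof. by move=> hA hB; apply: conjc_real; rewrite -tr_adj adjcM hA hB mxtrace_mulC. Qed.

Definition psd p (M : 'M[C]_p) : Prop :=
  adj M = M /\ forall v : 'cV[C]_p, 0 <= (adj v *m M *m v) 0 0.

Definition normsq (z : C) : R := complex.Re z ^+ 2 + complex.Im z ^+ 2.

Lemma normsqE z : z * conjc z = (normsq z)%:RC.
Proof. by case: z => a b; apply/eqP; rewrite eq_complex /normsq /=; apply/andP; split; apply/eqP; ring. Qed.

Lemma normsq_ge0 z : 0 <= normsq z.
Proof. by rewrite addr_ge0 ?sqr_ge0. Qed.

Lemma ge0_real (z : C) : 0 <= z -> z = (complex.Re z)%:RC /\ 0 <= complex.Re z.
Proof. by case: z => a b; rewrite lecE /= => /andP [/eqP -> h]. Qed.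

Lemma psd_CS p (M : 'M[C]_p) (u v : 'cV[C]_p) : psd M ->
  normsq ((adj u *m M *m v) 0 0)
  <= complex.Re ((adj u *m M *m u) 0 0) * complex.Re ((adj v *m M *m v) 0 0).
Proof.
move=> [hM pM]; pose sp (x y : 'cV[C]_p) := (adj x *m M *m y) 0 0.
have spC x y : sp y x = conjc (sp x y) by rewrite -adjE !adjcM adjcK hM mulmxA.
have [ua ua0] := ge0_real (pM u); have [va va0] := ge0_real (pM v).
apply: discriminant_le => // [|t]; first exact: normsq_ge0.
have spr w x y : sp w (x *: u + y *: v) = x * sp w u + y * sp w v.
  by rewrite /sp mulmxDr -!scalemxAr mxE [X in X + _]mxE [X in _ + X]mxE.
have spl w x y : sp (x *: u + y *: v) w = conjc x * sp u w + conjc y * sp v w.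
  by rewrite spC spr rmorphD !rmorphM /= -!spC.
(* The coefficient of v aligns its phase with u, so that a single real parameter t is enough. *)
have := pM (t%:RC *: u + (- conjc (sp u v)) *: v).
rewrite -/(sp _ _) spl !spr (spC u v) rmorphN /= conjcK oppr0.
have -> : t%:RC * (t%:RC * sp u u + - conjc (sp u v) * sp u v) + - sp u v * (t%:RC * conjc (sp u v) + - conjc (sp u v) * sp v v)
   = t%:RC ^+ 2 * sp u u - 2 * t%:RC * (sp u v * conjc (sp u v)) + (sp u v * conjc (sp u v)) * sp v v by ring.
have ua' : sp u u = (complex.Re (sp u u))%:RC := ua.
have va' : sp v v = (complex.Re (sp v v))%:RC := va.
rewrite normsqE => h; set N := normsq _ in h *.
have e (x y : R) : (t ^+ 2 * x - 2 * t * N + N * y)%:RC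
    = t%:RC ^+ 2 * x%:RC - 2 * t%:RC * N%:RC + N%:RC * y%:RC.
  by rewrite !(rmorph_nat, rmorphXn, rmorphM, rmorphB, rmorphD).
rewrite ua' va' -e in h; exact: proj2 (ge0_real h).
Qed.

Variable n : nat.
Local Notation d := (2 ^ n)%N.
Local Notation Mat := 'M[C]_d.
Local Notation P := (@pauli_vec R n).

Lemma psd1 p : psd (1%:M : 'M[C]_p).
Proof.
split=> [|v]; first exact: adjc1.
rewrite mulmx1 mxE; apply: sumr_ge0 => i _.
by rewrite adjE mulrC normsqE lecR normsq_ge0.
Qed.

Lemma psd_conj p q (A : 'M[C]_(p, q)) (M : 'M[C]_p) : psd M -> psd (adj A *m M *m A).
Proof.
move=> [hM pM]; split; first by rewrite !adjcM adjcK hM mulmxA.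
by move=> v; have := pM (A *m v); rewrite adjcM !mulmxA.
Qed.

Lemma psd_diag p (M : 'M[C]_p) i : psd M -> 0 <= M i i.
Proof.
move=> [_ /(_ (delta_mx i 0))].
have -> : adj (delta_mx i 0 : 'cV[C]_p) = delta_mx 0 i.
  by apply/matrixP => a b; rewrite !mxE rmorph_nat andbC.
by rewrite -rowE -colE !mxE.
Qed.

Lemma psd_tr_ge0 p (M : 'M[C]_p) : psd M -> 0 <= \tr M.
Proof. by move=> h; apply: sumr_ge0 => i _; exact: psd_diag. Qed.

Lemma psd_CS_entries p (M : 'M[C]_p) i j : psd M ->
  normsq (M i j) <= complex.Re (M i i) * complex.Re (M j j).
Proof.
move=> /(psd_CS (delta_mx i 0) (delta_mx j 0)).
have e k l : (adj (delta_mx k 0 : 'cV[C]_p) *m M *m (delta_mx l 0 : 'cV[C]_p)) 0 0 = M k l.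
  have -> : adj (delta_mx k 0 : 'cV[C]_p) = delta_mx 0 k.
    by apply/matrixP => a b; rewrite !mxE rmorph_nat andbC.
  by rewrite -rowE -colE !mxE.
by rewrite !e.
Qed.

Lemma density_psd (rho : Mat) : density rho -> psd rho.
Proof. by move=> [h [_ h']]. Qed.

Variable rho : Mat.
Hypothesis Hrho : density rho.

Lemma pauli_expect_real a : \tr (P a *m rho) = (complex.Re (\tr (P a *m rho)))%:RC.
Proof. by apply: herm_tr_real; [exact: pauli_adj | case: Hrho]. Qed.

(** For a sign s the operator 1 + s P is twice a projector, so its trace against rho is
    nonnegative. *)
Lemma pauli_expect_bound a : `|complex.Re (\tr (P a *m rho))| <= 1.
Proof.
have pr := density_psd Hrho; have [_ [tr1 _]] := Hrho.
have h (s : C) : conjc s = s -> s * s = 1 -> 0 <= 1 + s * \tr (P a *m rho).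
  move=> sr s2; pose M := 1%:M + s *: P a.
  have hM : adj M = M by rewrite adjcD adjc1 adjcZ pauli_adj sr.
  have MM : M *m M = 2 *: M.
    rewrite mulmxDl !mulmxDr !mulmx1 !mul1mx -scalemxAl -scalemxAr pauli_sqr scalerA s2 scale1r.
    by rewrite [_ + 1%:M]addrC scaler_nat mulr2n.
  have := psd_tr_ge0 (psd_conj M pr); rewrite hM mxtrace_mulC mulmxA MM -scalemxAl mxtraceZ.
  rewrite mulmxDl mul1mx -scalemxAl mxtraceD mxtraceZ tr1.
  by rewrite pmulr_rge0 // ltr0n.
have := h 1 (rmorph1 _) (mulr1 _); have := h (-1) (rmorphN1 _); rewrite mulrNN mulr1 => /(_ erefl).
rewrite pauli_expect_real mul1r mulN1r => h1 h2.
have e : 1 = (1 : R)%:RC by [].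
rewrite ler_norml; apply/andP; split.
  by move: h2; rewrite {1}e -rmorphD lecR; lra.
by move: h1; rewrite {1}e -rmorphB lecR; lra.
Qed.

Lemma purity_real : \tr (rho *m rho) = (complex.Re (\tr (rho *m rho)))%:RC.
Proof. by apply: herm_tr_real; case: Hrho. Qed.

Lemma trace_sqr p (M : 'M[C]_p) : adj M = M -> \tr (M *m M) = (\sum_i \sum_j normsq (M i j))%:RC.
Proof.
move=> h; rewrite rmorph_sum; apply: eq_bigr => i _; rewrite mulE rmorph_sum; apply: eq_bigr => j _.
by rewrite -{2}h adjE /= normsqE.
Qed.

(** Cauchy-Schwarz bounds the squared modulus of each entry of rho by the product of two diagonal
    entries, and the trace is 1. *)
Lemma purity_le1 : complex.Re (\tr (rho *m rho)) <= 1.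
Proof.
have pr := density_psd Hrho; have [hr [tr1 _]] := Hrho.
rewrite (trace_sqr hr) /=.
apply: (@le_trans _ _ (\sum_i \sum_j complex.Re (rho i i) * complex.Re (rho j j))).
  by apply: ler_sum => i _; apply: ler_sum => j _; exact: psd_CS_entries.
have e : \sum_i complex.Re (rho i i) = 1.
  by rewrite -(raddf_sum (@complex.Re R)) -/(\tr rho) tr1.
by under eq_bigr do rewrite -mulr_sumr e mulr1; rewrite e.
Qed.

Lemma purity_ge0 : 0 <= complex.Re (\tr (rho *m rho)).
Proof.
have [hr _] := Hrho; rewrite (trace_sqr hr) /=.
by apply: sumr_ge0 => i _; apply: sumr_ge0 => j _; exact: normsq_ge0.
Qed.

Variable phi : 'cV[C]_d.
Hypothesis Hphi : pure_state phi.
Let f := projector phi.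

Lemma projector_adj : adj f = f.
Proof. by rewrite /f /projector adjcM adjcK. Qed.

Lemma expect_tr (M : Mat) : (adj phi *m M *m phi) 0 0 = \tr (M *m f).
Proof.
by rewrite /f /projector mulmxA mxtrace_mulC mulmxA /mxtrace big_ord1.
Qed.

Lemma tr_projector : \tr f = 1.
Proof. by rewrite -[f]mul1mx -expect_tr mulmx1. Qed.

Lemma projector_rank1 i j k l : f i l * f k j = f i j * f k l.
Proof. by rewrite /f /projector !mulE !big_ord1; ring. Qed.

Lemma projector_density : density f.
Proof.
split; first exact: projector_adj; split; first exact: tr_projector.
move=> v; rewrite /f /projector mulmxA -mulmxA mulE big_ord1.
have -> : (adj phi *m v) 0 0 = conjc ((adj v *m phi) 0 0) by rewrite -adjE adjcM adjcK.
by rewrite normsqE lecR normsq_ge0.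
Qed.

Lemma fidelity_real : \tr (f *m rho) = (complex.Re (\tr (f *m rho)))%:RC.
Proof. by apply: herm_tr_real; [exact: projector_adj | case: Hrho]. Qed.

Let F := complex.Re (\tr (f *m rho)).
Let t2 := complex.Re (\tr (f *m rho *m rho)).

Lemma fidelity2_real : \tr (f *m rho *m rho) = t2%:RC.
Proof.
rewrite -mulmxA; apply: etrans (herm_tr_real _ _) _; first exact: projector_adj.
  by rewrite adjcM; case: Hrho => ->.
by rewrite mulmxA.
Qed.

Let FE : F = complex.Re ((adj phi *m rho *m phi) 0 0).
Proof. by rewrite expect_tr mxtrace_mulC. Qed.

Let rphi_sq : (adj (rho *m phi) *m (rho *m phi)) 0 0 = t2%:RC.
Proof.
rewrite -fidelity2_real -mulmxA mxtrace_mulC -expect_tr adjcM; case: Hrho => -> _.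
by rewrite !mulmxA.
Qed.

Lemma fidelity_ge0 : 0 <= F.
Proof. by rewrite FE; have [_ /(_ phi) /ge0_real []] := density_psd Hrho. Qed.

(** Here t2 is the squared norm of rho phi. Cauchy-Schwarz for the form rho bounds the square of
    coordinate b by rho_bb F, and the diagonal sums to 1. *)
Lemma fidelity2_le : t2 <= F.
Proof.
have pr := density_psd Hrho; have [hr [tr1 _]] := Hrho.
have -> : t2 = \sum_b normsq ((rho *m phi) b 0).
  have := rphi_sq; rewrite mulE (eq_bigr (fun b => (normsq ((rho *m phi) b 0))%:RC)) => [|b _].
    by rewrite -rmorph_sum => /(congr1 (@complex.Re R)) /= <-.
  by rewrite adjE mulrC normsqE.
have e : \sum_i complex.Re (rho i i) * F = F.
  by rewrite -mulr_suml -(raddf_sum (@complex.Re R)) -/(\tr rho) tr1 mul1r.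
rewrite -[leRHS]e; apply: ler_sum => b _.
have := psd_CS (delta_mx b 0) phi pr; rewrite -FE.
have -> : adj (delta_mx b 0 : 'cV[C]_d) = delta_mx 0 b.
  by apply/matrixP => i j; rewrite !mxE rmorph_nat andbC.
by rewrite -mulmxA -!rowE -colE !mxE.
Qed.

Lemma fidelity_sqr_le : F ^+ 2 <= t2.
Proof.
have := psd_CS phi (rho *m phi) (psd1 _).
rewrite !mulmx1 rphi_sq Hphi mul1r mulmxA expect_tr mxtrace_mulC fidelity_real.
by rewrite /normsq /= expr0n addr0.
Qed.

End Positive.

(** * The exact variance and its bounds *)

Section VarianceValue.
Variable K : fieldType.
Variables (d s1 s2 p q F t2 r2 : K).

(* Here F = tr (phi rho), t2 = tr (phi rho^2), r2 = tr (rho^2), and s1, s2 are the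
   l-th powers of the rates. *)
Definition trOOrr : K := t2 - 2 * t2 / d + r2 / (d * d).
Definition trOrOr : K := F ^+ 2 - 2 * t2 / d + r2 / (d * d).
Definition trOOr : K := F - 2 * F / d + (d * d)^-1.
Definition klein_sym12 : K := 2 * (F - d^-1) ^+ 2 + (1 - d^-1) * r2 + 2 * trOOrr.
Definition klein_sym : K := 2 * (F - d^-1) ^+ 2 + (1 - d^-1) * r2 + 4 * trOOrr + (1 - d^-1) + 2 * trOrOr + 4 * trOOr.
Definition sector_sym : K := 2 * p + 4 * q + (1 - r2) / d + 4 * (F - t2) / d - 2 * (1 - r2) / (d * d).
Definition variance_value : K := (d + 1) / (d + 2) * ((F - d^-1) ^+ 2 + (s1 * (p + q - 3^-1 * sector_sym)
  + (1 - s1) * d^-1 * (klein_sym12 - 3^-1 * klein_sym)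
  + 3^-1 * (s2 * sector_sym + (1 - s2) / (d + 3) * klein_sym))) - (F - d^-1) ^+ 2.

End VarianceValue.

(** The traces are computed over the complex numbers and the estimates are made over the reals; the
    same formula serves both. *)
Lemma rmorph_variance_value (K L : fieldType) (h : {rmorphism K -> L}) (d s1 s2 p q F t2 r2 : K) :
  h (variance_value d s1 s2 p q F t2 r2) =
  variance_value (h d) (h s1) (h s2) (h p) (h q) (h F) (h t2) (h r2).
Proof.
rewrite /variance_value /klein_sym /klein_sym12 /sector_sym /trOOrr /trOrOr /trOOr.
by rewrite !(rmorph_nat, rmorph1, rmorphXn, fmorphV, rmorphM, rmorphB, rmorphD).
Qed.

Lemma variance_algebra (K : fieldType) (d s1 s2 A1 B1 V1 S1 A B V S : K) :
  d != 0 -> d + 3 != 0 -> d * A1 = A -> d * B1 = B -> V1 = V -> S1 = S ->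
  d * (s1 * (A1 - 3^-1 * B1) + (1 - s1) * (d * d)^-1 * (V1 - 3^-1 * S1)
    + 3^-1 * (s2 * B1 + (1 - s2) * (d * (d + 3))^-1 * S1)) =
  s1 * (A - 3^-1 * B) + (1 - s1) * d^-1 * (V - 3^-1 * S) + 3^-1 * (s2 * B + (1 - s2) / (d + 3) * S).
Proof. by move=> h h3 <- <- <- <-; have [->|h0] := eqVneq (3 : K) 0; rewrite ?invr0 ?mul0r; field; rewrite ?h ?h3 ?h0. Qed.

Lemma shift_sqr (K : comPzRingType) n (f : 'M[K]_n) x : f *m f = f ->
  (f + x *: 1%:M) *m (f + x *: 1%:M) = f + (2 * x) *: f + (x * x) *: 1%:M.
Proof.
move=> ff; rewrite mulmxDl !mulmxDr ff -!scalemxAl -!scalemxAr !mulmx1 mul1mx scalerA.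
by rewrite mulr_natl mulr2n scalerDl !addrA.
Qed.

Lemma shift_alternating (K : comPzRingType) n (f r : 'M[K]_n) x :
  (f + x *: 1%:M) *m r *m (f + x *: 1%:M) *m r =
  f *m r *m f *m r + x *: (f *m r *m r) + x *: (r *m f *m r) + (x * x) *: (r *m r).
Proof.
rewrite [(f + _) *m r]mulmxDl -scalemxAl mul1mx !mulmxDr -!scalemxAr !mulmx1 !mulmxDl -!scalemxAl.
by rewrite !mulmxDl scalerDr -!scalemxAl scalerA !addrA; congr (_ + _); rewrite addrAC.
Qed.

Section VarianceFormula.
Variable R : realType.
Local Notation C := R[i].
Variables n k : nat.
Local Notation d := (2 ^ n)%N.
Local Notation Mat := 'M[C]_d.
Local Notation Mat4 := 'M[C]_(d * d * (d * d)).
Local Notation P := (@pauli_vec R n).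
Local Notation chi := (@symp_sign n C).
Local Notation vec := (vec n).
Local Notation D := (d%:R : C).
Local Notation "x %:RC" := (real_complex R x) (at level 2, format "x %:RC").
Hypothesis hk : (k <= n)%N.
Variables (m : nat) (S : 'I_m -> Mat).
Hypothesis HS : clifford_transversal S.
Variable c : coefs (d%:R : R) ((3 / 4) ^+ k) (2^-1 ^+ k) (0 ^+ k).
Variable phi : 'cV[C]_d.
Hypothesis Hphi : pure_state phi.
Let f := projector phi.
Let O := Ophi phi.

Let OE : O = f + (- D^-1) *: 1%:M.
Proof. by rewrite scaleNr. Qed.

Lemma tr_Ophi : \tr O = 0.
Proof.
by rewrite OE mxtraceD mxtraceZ mxtrace1 (tr_projector Hphi) mulNr mulVf ?D_neq0 // subrr.
Qed.

(** Taking traces forces tr Q = 0, and on traceless operators the channel is a scaling. *)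
Lemma meas_channel_inv l Q : meas_channel S k l Q = O -> Q = (D + 1) *: O.
Proof.
move=> e; have := e; rewrite (meas_channelE k HS) => e1.
have h := D1_neq0 R n.
have trQ : \tr Q = 0.
  have := congr1 mxtrace e1; rewrite tr_Ophi mxtraceZ.
  have -> : \tr ((\tr Q)%:M + Q) = (D + 1) * \tr Q by rewrite mxtraceD mxtrace_scalar mulrDl mul1r mulr_natl.
  by rewrite mulKf.
by rewrite -e1 trQ scalerA mulfV // scale1r raddf0 add0r.
Qed.

Variable rho : Mat.
Hypothesis Hrho : density rho.
Let F := complex.Re (\tr (f *m rho)).
Let t2 := complex.Re (\tr (f *m rho *m rho)).
Let r2 := complex.Re (\tr (rho *m rho)).
Definition pauli_overlap (a : vec) : R :=
  (complex.Re (\tr (P a *m f)) - (a == 0)%:R) * complex.Re (\tr (P a *m rho)).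
Let p : R := d%:R^-1 * \sum_a pauli_overlap a ^+ 2.
Let q : R := (d%:R * d%:R)^-1 * \sum_b \sum_a symp_sign R a b * pauli_overlap b * pauli_overlap a.

Let trrho : \tr rho = 1. Proof. by case: Hrho => _ []. Qed.
Let ff : f *m f = f.
Proof.
have := rank1_mul (@projector_rank1 R n phi) 1%:M.
by rewrite mulmx1 mul1mx (tr_projector Hphi) scale1r.
Qed.
Let FC : \tr (f *m rho) = F%:RC. Proof. exact: fidelity_real. Qed.
Let t2C : \tr (f *m rho *m rho) = t2%:RC. Proof. exact: fidelity2_real. Qed.
Let r2C : \tr (rho *m rho) = r2%:RC. Proof. exact: purity_real. Qed.

Let overlapC a : overlap f rho a = (pauli_overlap a)%:RC.
Proof.
have h (x z : R) : ((x - (a == 0)%:R) * z)%:RC = (x%:RC - (a == 0)%:R) * z%:RC.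
  by rewrite rmorphM rmorphB rmorph_nat.
by rewrite /overlap tr_PO h -(pauli_expect_real Hrho) -(pauli_expect_real (projector_density Hphi)).
Qed.

Let chiC b a : chi b a = (symp_sign R b a)%:RC.
Proof. by rewrite /symp_sign rmorphXn rmorphN1. Qed.

Let pC : D^-1 * \sum_a overlap f rho a ^+ 2 = p%:RC.
Proof.
rewrite rmorphM fmorphV rmorph_nat rmorph_sum; congr (_ * _).
by apply: eq_bigr => a _; rewrite rmorphXn overlapC.
Qed.

Let qC : (D * D)^-1 * \sum_b \sum_a chi a b * overlap f rho b * overlap f rho a = q%:RC.
Proof.
rewrite rmorphM fmorphV rmorphM !rmorph_nat rmorph_sum; congr (_ * _).
apply: eq_bigr => b _; rewrite rmorph_sum; apply: eq_bigr => a _.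
have h (x y z : R) : (x * y * z)%:RC = x%:RC * y%:RC * z%:RC by rewrite !rmorphM.
by rewrite chiC !overlapC; exact: esym (h _ _ _).
Qed.

Let wC : \tr (O *m rho) = F%:RC - D^-1.
Proof. by rewrite OE mulmxDl mxtraceD FC -scalemxAl mul1mx mxtraceZ trrho mulr1. Qed.

Let OOE : O *m O = f + (2 * - D^-1) *: f + (- D^-1 * - D^-1) *: 1%:M.
Proof. by rewrite OE; exact: shift_sqr ff. Qed.

Let trOO : \tr (O *m O) = 1 - D^-1.
Proof.
rewrite OOE !mxtraceD !mxtraceZ mxtrace1 (tr_projector Hphi); field; exact: D_neq0.
Qed.

Let tr_OOr : \tr (O *m O *m rho) = trOOr D F%:RC.
Proof.
rewrite OOE !mulmxDl !mxtraceD -!scalemxAl !mxtraceZ mul1mx FC trrho /trOOr.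
by move: D (F%:RC) (D_neq0 R n) => x y x0; field.
Qed.

Let tr_OOrr : \tr (O *m O *m rho *m rho) = trOOrr D t2%:RC r2%:RC.
Proof.
rewrite OOE !mulmxDl !mxtraceD -!scalemxAl !mxtraceZ mul1mx t2C r2C /trOOrr.
by move: D (t2%:RC) (r2%:RC) (D_neq0 R n) => x y z x0; field.
Qed.

Let tr_OrOr : \tr (O *m rho *m O *m rho) = trOrOr D F%:RC t2%:RC r2%:RC.
Proof.
have e1 : \tr (f *m rho *m f *m rho) = F%:RC ^+ 2.
  by rewrite (rank1_mul (@projector_rank1 R n phi)) -scalemxAl mxtraceZ mxtrace_mulC FC expr2.
have e2 : \tr (rho *m f *m rho) = t2%:RC by rewrite -t2C -mulmxA mxtrace_mulC.
rewrite OE shift_alternating.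
rewrite !mxtraceD !mxtraceZ e1 e2 t2C r2C /trOrOr.
by move: D (F%:RC) (t2%:RC) (r2%:RC) (D_neq0 R n) => x y z w x0; field.
Qed.

Let ev_mix (M A B : Mat4) x X1 X2 X3 X4 :
  ev (M *m (A - x *: B)) X1 X2 X3 X4 = ev (M *m A) X1 X2 X3 X4 - x * ev (M *m B) X1 X2 X3 X4.
Proof. by rewrite mulmxBr -scalemxAr evD -scaleNr evZ mulNr. Qed.

Let ev_comb (M1 M2 M3 M4 : Mat4) x y z u v X1 X2 X3 X4 :
  ev (x *: M1 + y *: M2 + z *: (u *: M3 + v *: M4)) X1 X2 X3 X4 =
  x * ev M1 X1 X2 X3 X4 + y * ev M2 X1 X2 X3 X4 + z * (u * ev M3 X1 X2 X3 X4 + v * ev M4 X1 X2 X3 X4).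
Proof. by rewrite !evD !evZ evD !evZ. Qed.

Lemma Vstar_value l Q : meas_channel S k l Q = O ->
  Vstar_rho S k l O Q rho = variance_value d%:R (rate_std c ^+ l) (rate_triv c ^+ l) p q F t2 r2.
Proof.
move=> /meas_channel_inv ->.
rewrite /Vstar_rho (Eens_variance k HS l rho tr_Ophi) (iter_layer hk HS c l).
suff -> : forall x, x = (variance_value d%:R (rate_std c ^+ l) (rate_triv c ^+ l) p q F t2 r2)%:RC ->
   complex.Re x = variance_value d%:R (rate_std c ^+ l) (rate_triv c ^+ l) p q F t2 r2 => //; last by move=> x ->.
rewrite rmorph_variance_value !rmorphXn rmorph_nat /variance_value wC; congr (_ * (_ + _) - _).
apply: etrans (congr1 _ (ev_comb _ _ _ _ _ _ _ _ _ _ _ _ _)) _.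
rewrite !ev_mix.
have hA := D_ev_Pi_sym12 f rho; rewrite pC qC -OE in hA.
have hB := D_ev_Pi_sym (tr_projector Hphi) (@projector_rank1 R n phi) trrho.
rewrite pC qC FC t2C r2C -OE in hB.
have hV := ev_klein4_sym12 tr_Ophi trrho; rewrite wC trOO r2C tr_OOrr in hV.
have hS := ev_klein4_sym tr_Ophi trrho; rewrite wC trOO r2C tr_OOrr tr_OrOr tr_OOr in hS.
have h3 : D + 3 != 0 by rewrite -natrD pnatr_eq0 addn3.
exact: variance_algebra (D_neq0 R n) h3 hA hB hV hS.
Qed.

End VarianceFormula.

(** With B for [sector_sym] the decaying part is s1 (p + q) - (s1 - s2) B / 3. As B is at least 2p +
    4q, it is at most s1 (p - q)/3 + s2 (2p + 4q)/3, hence at most 2 p s1 because |q| <= p and s2 <=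
    s1. The leading square cancels since (d + 1)/(d + 2) <= 1. *)
Lemma variance_upper (K : realFieldType) (d s1 s2 G p q F t2 r2 : K) :
  2 <= d -> 0 <= s2 -> s2 <= s1 -> s1 <= G -> s1 <= 1 -> `|q| <= p -> 0 <= F -> F ^+ 2 <= t2 -> t2 <= F ->
  0 <= r2 -> r2 <= 1 ->
  variance_value d s1 s2 p q F t2 r2 <= 2 * p * G + 6 / d.
Proof.
move=> d2 s20 s21 s1G s11 qp F0 Ft tF r0 r1.
rewrite /variance_value; set w := (F - d^-1) ^+ 2; set br := _ + 3^-1 * _.
have d0 : 0 < d by lra.
have [p0 /andP [q1 q2]] : 0 <= p /\ (- p <= q <= p) by rewrite -ler_norml; split=> //; apply: le_trans qp.
have G0 : 0 <= G by lra.
set e := d^-1.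
have e0 : 0 < e by rewrite invr_gt0.
have e1 : e <= 2^-1 by rewrite lef_pV2 ?posrE //; lra.
have F1 : F <= 1 by apply/negP => /negP; rewrite -ltNge => h; nra.
have F20 : 0 <= F ^+ 2 by rewrite sqr_ge0.
have pG : 0 <= 2 * p * G by rewrite !mulr_ge0 //; lra.
have eF : 0 <= e * F by rewrite mulr_ge0 //; lra.
have et : 0 <= e * t2 by rewrite mulr_ge0 //; lra.
have hB : 2 * p + 4 * q <= sector_sym d p q F t2 r2.
  have -> : sector_sym d p q F t2 r2 = 2 * p + 4 * q + (e * (1 - r2)) * (1 - 2 * e) + 4 * (e * (F - t2)).
    by rewrite /sector_sym invfM -/e; ring.
  have h1 : 0 <= e * (1 - r2) * (1 - 2 * e) by rewrite !mulr_ge0 //; lra.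
  have h2 : 0 <= e * (F - t2) by rewrite mulr_ge0 //; lra.
  lra.
have k1 : 0 <= (2^-1 - e) * (1 - F) by rewrite mulr_ge0 //; lra.
have k2 : 0 <= e * (2^-1 - e) * (1 + r2) by rewrite !mulr_ge0 //; lra.
have k3 : 0 <= e * (1 - r2) by rewrite mulr_ge0 //; lra.
have k4 : 0 <= (1 - e) * (1 - r2) by rewrite mulr_ge0 //; lra.
have hV : klein_sym12 d F t2 r2 - 3^-1 * klein_sym d F t2 r2 <= 4 / 3.
  have -> : klein_sym12 d F t2 r2 - 3^-1 * klein_sym d F t2 r2 =
    - (4 / 3) * (F - F ^+ 2) + (2 / 3) * (t2 - F ^+ 2) + (1 - e) * (2 * r2 - 1) / 3.
    by rewrite /klein_sym12 /klein_sym /trOOrr /trOrOr /trOOr invfM -/e; field.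
  lra.
(* The bound at F = t2 = r2 = 1 without the terms in 1/d. A third of it plus the 4/3 above is the
   constant 6. *)
have hS : klein_sym d F t2 r2 <= 14.
  have -> : klein_sym d F t2 r2 = 4 * F ^+ 2 + 4 * t2 + 4 * F + r2 - e * r2 - 12 * (e * F) - 12 * (e * t2)
     + 6 * r2 * e ^+ 2 + 6 * e ^+ 2 + 1 - e.
    by rewrite /klein_sym /trOOrr /trOrOr /trOOr invfM -/e; ring.
  lra.
have hg : 0 <= (d + 3)^-1 /\ (d + 3)^-1 <= e.
  by split; [rewrite invr_ge0; lra | rewrite lef_pV2 ?posrE //; lra].
have hbr : br <= 2 * p * G + 6 * e.
  rewrite /br -/e; move: (sector_sym _ _ _ _ _ _) hB => B hB.
  move: (klein_sym12 _ _ _ _) hV => V; move: (klein_sym _ _ _ _) hS => S hS hV.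
  move: hg; set g := (d + 3)^-1 => -[g0 ge].
  have a1 : (s1 - s2) * (2 * p + 4 * q) <= (s1 - s2) * B by rewrite ler_wpM2l //; lra.
  have a2 : (1 - s1) * e * (V - 3^-1 * S) <= (1 - s1) * e * (4 / 3).
    by rewrite ler_wpM2l // mulr_ge0 //; lra.
  have a3 : (1 - s1) * e * (4 / 3) <= e * (4 / 3) by have := mulr_ge0 (le_trans s20 s21) (ltW e0); lra.
  have a4 : (1 - s2) * g * S <= (1 - s2) * g * 14 by rewrite ler_wpM2l // mulr_ge0 //; lra.
  have a5 : (1 - s2) * g <= e by have := mulr_ge0 s20 g0; lra.
  have a6 : s1 * p <= G * p by rewrite ler_wpM2r.
  have a7 : 0 <= s2 * (p + q) by rewrite mulr_ge0 //; lra.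
  have a8 : 0 <= (s1 - s2) * (p + q) by rewrite mulr_ge0 //; lra.
  have a9 : 0 <= s1 * (p - q) by rewrite mulr_ge0 //; lra.
  have a10 : 0 <= s2 * (p - q) by rewrite mulr_ge0 //; lra.
  have a11 : 0 <= (s1 - s2) * (p - q) by rewrite mulr_ge0 //; lra.
  lra.
set c := (d + 1) / (d + 2).
have c0 : 0 <= c by rewrite divr_ge0 //; lra.
have c1 : c <= 1 by rewrite ler_pdivrMr; lra.
have w0 : 0 <= w by rewrite sqr_ge0.
have h1 : c * (w + br) <= c * (w + (2 * p * G + 6 * e)) by rewrite ler_wpM2l // lerD2l.
have h2 : c * (w + (2 * p * G + 6 * e)) <= 1 * (w + (2 * p * G + 6 * e)) by rewrite ler_wpM2r //; lra.
lra.
Qed.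

(** The arguments are the values of p, q, F, t2 and r2 at rho = phi. The variance is then affine in
    s2: at s2 = 0 it is S, which is below 4/d, and at s2 = 1 it stays within 6/d of 2x. In between,
    replacing G by s2 costs at most 6 (1 - s2)/d by the gap hypothesis. *)
Lemma variance_pure (K : realFieldType) (d s1 s2 G x : K) :
  2 <= d -> 0 <= s2 -> s2 <= G -> s2 <= 1 -> d * (G - s2) <= 3 * (1 - s2) -> 0 <= x -> x <= 1 ->
  - (6 / d) < variance_value d s1 s2 (x - d^-1) (x - 2 / d + (d * d)^-1) 1 1 1 - 2 * x * G /\
  variance_value d s1 s2 (x - d^-1) (x - 2 / d + (d * d)^-1) 1 1 1 - 2 * x * G < 4 / d.
Proof.
move=> d2 s20 s2G s21 gap x0 x1.
have d0 : d != 0 by lra.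
have d3 : d + 2 != 0 by lra.
have d4 : d + 3 != 0 by lra.
set e := d^-1.
have e0 : 0 < e by rewrite invr_gt0; lra.
have e1 : e <= 2^-1 by rewrite lef_pV2 ?posrE //; lra.
pose c := (d + 1) / (d + 2); pose S := c * ((1 - e) ^+ 2 + e * (1 - e) / 3 + (12 * (1 - e) ^+ 2 + 2 * (1 - e)) / (3 * (d + 3))) - (1 - e) ^+ 2.
pose M := (1 - e) ^+ 2 + e * (1 - e) / 3 - 10 / 3 * e + 4 / 3 * e ^+ 2.
(* The standard component contributes (1 - 1/d)/(3d) both to the decaying and to the fixed part, so
   s1 cancels. *)
have -> : variance_value d s1 s2 (x - d^-1) (x - 2 / d + (d * d)^-1) 1 1 1 =
   S * (1 - s2) + s2 * (c * (2 * x + M) - (1 - e) ^+ 2).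
  rewrite /M /variance_value /klein_sym12 /klein_sym /sector_sym /trOOrr /trOrOr /trOOr /S /c /e.
  by field; rewrite d0 d3 d4.
have den : 0 < (1 + 2 * e) * (1 + 3 * e) by rewrite mulr_gt0 //; lra.
have SE : S * ((1 + 2 * e) * (1 + 3 * e)) = 4 * e * (1 - e).
  by rewrite /S /c /e; field; rewrite d0 d3 d4.
have S0 : 0 < S by rewrite -(pmulr_lgt0 _ den) SE !mulr_gt0 //; lra.
have S4 : S < 4 * e.
  rewrite -(ltr_pM2r den) SE.
  have : 0 < e * e by rewrite mulr_gt0.
  have : 0 < e * e * e by rewrite !mulr_gt0.
  lra.
have c0 : 0 <= c by rewrite divr_ge0 //; lra.
have c1 : c <= 1 by rewrite ler_pdivrMr; lra.
(* L is the error at s2 = 1 and x = 1, and L + 6 e equals 12 e^2 / (1 + 2 e). *)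
pose L := c * (2 + M) - (1 - e) ^+ 2 - 2.
have L6 : - (6 * e) < L.
  have den2 : 0 < 1 + 2 * e by lra.
  rewrite -subr_gt0 opprK -(pmulr_lgt0 _ den2).
  have -> : (L + 6 * e) * (1 + 2 * e) = 12 * (e * e) by rewrite /L /M /c /e; field; rewrite d0 d3.
  by rewrite mulr_gt0 // mulr_gt0.
have gap' : G <= s2 + 3 * e * (1 - s2).
  have : e * (d * (G - s2)) <= e * (3 * (1 - s2)) by rewrite ler_wpM2l // ltW.
  by rewrite mulrA mulVf // mul1r; lra.
have LT : 0 < (1 - s2) * S + s2 * (L + 6 * e).
  have [->|s2n] := eqVneq s2 1; first by lra.
  have h1 : 0 < (1 - s2) * S by rewrite mulr_gt0 // subr_gt0 lt_neqAle s2n.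
  have h2 : 0 <= s2 * (L + 6 * e) by rewrite mulr_ge0 //; lra.
  lra.
have MS : c * M - (1 - e) ^+ 2 <= S.
  rewrite lerD2r ler_wpM2l // /M -!addrA !lerD2l.
  have h1 : 0 <= (12 * (1 - e) ^+ 2 + 2 * (1 - e)) / (3 * (d + 3)).
    rewrite divr_ge0 //; last by lra.
    by rewrite addr_ge0 ?mulr_ge0 ?sqr_ge0 //; lra.
  have h2 : 0 <= e * (1 - e) by rewrite mulr_ge0 //; lra.
  lra.
split; rewrite -/e.
  have h1 : x * G <= x * (s2 + 3 * e * (1 - s2)) by rewrite ler_wpM2l.
  have h2 : 0 <= (1 - x) * (s2 * (1 - c)) by rewrite !mulr_ge0 //; lra.
  have h3 : 0 <= (1 - x) * (e * (1 - s2)) by rewrite !mulr_ge0 //; lra.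
  rewrite /L in LT; lra.
have h1 : 0 <= x * (G - s2) by rewrite mulr_ge0 //; lra.
have h2 : 0 <= x * (s2 * (1 - c)) by rewrite !mulr_ge0 //; lra.
have h3 : s2 * (c * M - (1 - e) ^+ 2) <= s2 * S by rewrite ler_wpM2l.
lra.
Qed.

(** Splitting g^(l+1) - a^(l+1) as g (g^l - a^l) + a^l (g - a) carries the gap of one layer over to
    l layers with the same constant 3. *)
Lemma pow_gap (K : realFieldType) (d g a : K) l : 0 <= a -> a <= g -> g <= 1 ->
  d * (g - a) <= 3 * (1 - a) -> d * (g ^+ l - a ^+ l) <= 3 * (1 - a ^+ l).
Proof.
move=> a0 ag g1 h; elim: l => [|l IH]; first by rewrite !expr0; lra.
have al : 0 <= a ^+ l by rewrite exprn_ge0.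
have al1 : a ^+ l <= 1 by rewrite exprn_ile1 //; lra.
have h1 : a ^+ l * (d * (g - a)) <= a ^+ l * (3 * (1 - a)) by rewrite ler_wpM2l.
have h2 : g * (d * (g ^+ l - a ^+ l)) <= g * (3 * (1 - a ^+ l)) by rewrite ler_wpM2l //; lra.
have h3 : g * (3 * (1 - a ^+ l)) <= 1 * (3 * (1 - a ^+ l)) by rewrite ler_wpM2r //; lra.
rewrite !exprS; lra.
Qed.

(** * Bounds on Pauli spectra *)

Section OverlapBounds.
Variable R : realType.
Local Notation C := R[i].
Variable n : nat.
Local Notation d := (2 ^ n)%N.
Local Notation Mat := 'M[C]_d.
Local Notation P := (@pauli_vec R n).
Local Notation chi := (@symp_sign n R).
Local Notation vec := (vec n).
Local Notation D := (d%:R : R).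
Local Notation "x %:RC" := (real_complex R x) (at level 2, format "x %:RC").
Implicit Types v : vec -> R.

Lemma dim_gt0 : 0 < D. Proof. by rewrite ltr0n expn_gt0. Qed.

(** Parseval's identity for the symplectic Fourier transform. *)
Lemma sum_chi_sqr v : \sum_b (\sum_a chi a b * v a) ^+ 2 = D * D * \sum_a v a ^+ 2.
Proof.
transitivity (\sum_a \sum_a' (\sum_b chi b (a + a')) * (v a * v a')).
  transitivity (\sum_b \sum_a \sum_a' chi b (a + a') * (v a * v a')).
    apply: eq_bigr => b _; rewrite expr2 mulr_suml; apply: eq_bigr => a _.
    by rewrite mulr_sumr; apply: eq_bigr => a' _; rewrite chiDr !(chiC _ b); ring.
  rewrite exchange_big; apply: eq_bigr => a _; rewrite exchange_big; apply: eq_bigr => a' _.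
  by rewrite mulr_suml.
rewrite mulr_sumr; apply: eq_bigr => a _; rewrite (bigD1 a) //= sum_chi addvecc eqxx mulr1n big1 => [|a' ha'].
  by rewrite addr0 expr2 -natrM -expnMn.
by rewrite sum_chi addvec_eq0 eq_sym (negbTE ha') mulr0n mul0r.
Qed.

(** This is |q| <= p. Let u be the symplectic transform of v; by Parseval, expanding the sum of the
    squares of D v + u and of D v - u gives the two signs. *)
Lemma chi_corr_le v : `|(D * D)^-1 * \sum_b \sum_a chi a b * v b * v a| <= D^-1 * \sum_a v a ^+ 2.
Proof.
have d0 := dim_gt0; pose u b := \sum_a chi a b * v a.
have -> : \sum_b \sum_a chi a b * v b * v a = \sum_b v b * u b.
  by apply: eq_bigr => b _; rewrite mulr_sumr; apply: eq_bigr => a _; ring.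
have key s : s ^+ 2 = 1 -> 0 <= D * \sum_a v a ^+ 2 + s * \sum_b v b * u b.
  move=> s2; have : 0 <= \sum_b (D * v b + s * u b) ^+ 2 by apply: sumr_ge0 => b _; exact: sqr_ge0.
  have -> : \sum_b (D * v b + s * u b) ^+ 2 = 2 * D * (D * \sum_a v a ^+ 2 + s * \sum_b v b * u b).
    rewrite (eq_bigr (fun b => D * D * v b ^+ 2 + 2 * D * s * (v b * u b) + u b ^+ 2)) => [|b _].
      by rewrite !big_split /= -!mulr_sumr sum_chi_sqr; ring.
    have -> : u b ^+ 2 = s ^+ 2 * u b ^+ 2 by rewrite s2 mul1r.
    by ring.
  by rewrite pmulr_rge0 // mulr_gt0.
have h1 := key 1 (expr1n _ _); have h2 := key (-1) (etrans (sqrrN 1) (expr1n _ _)).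
have i0 : 0 <= (D * D)^-1 by rewrite invr_ge0 mulr_ge0 // ltW.
have -> : D^-1 * \sum_a v a ^+ 2 = (D * D)^-1 * (D * \sum_a v a ^+ 2) by field; rewrite gt_eqF.
by rewrite ler_norml -mulrN !ler_wpM2l //; lra.
Qed.

Variables (rho : Mat) (Hrho : density rho).
Local Notation y a := (complex.Re (\tr (P a *m rho))).

Lemma expect0 : y 0 = 1.
Proof. by rewrite pauli_vec0 mul1mx; case: Hrho => _ [-> _]. Qed.

Lemma sum_expect_sqr : \sum_a y a ^+ 2 = D * complex.Re (\tr (rho *m rho)).
Proof.
have h : (\sum_a y a ^+ 2)%:RC = (D * complex.Re (\tr (rho *m rho)))%:RC.
  have -> : (D * complex.Re (\tr (rho *m rho)))%:RC = d%:R * (complex.Re (\tr (rho *m rho)))%:RC.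
    by rewrite rmorphM rmorph_nat.
  rewrite -(purity_real Hrho) -sum_tr_pauli2 rmorph_sum; apply: eq_bigr => a _.
  rewrite [in RHS](pauli_expect_real Hrho a) expr2; exact: rmorphM.
exact: (fmorph_inj (real_complex R)) h.
Qed.

(** Expectations are at most 1 in modulus, so fourth powers are below squares, which sum to D times
    the purity. *)
Lemma sum_expect4_le : \sum_a y a ^+ 4 <= D.
Proof.
apply: (@le_trans _ _ (\sum_a y a ^+ 2)).
  apply: ler_sum => a _; have h := pauli_expect_bound Hrho a.
  have h1 : y a ^+ 2 <= 1 by rewrite -real_normK ?num_real // exprn_ile1.
  have -> : y a ^+ 4 = y a ^+ 2 * y a ^+ 2 by rewrite -exprD.
  by rewrite -[leRHS]mulr1 ler_wpM2l // sqr_ge0.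
by rewrite sum_expect_sqr -[leRHS]mulr1 ler_wpM2l ?purity_le1 // ltW // dim_gt0.
Qed.

End OverlapBounds.

Section PureOverlap.
Variable R : realType.
Local Notation C := R[i].
Variable n : nat.
Local Notation d := (2 ^ n)%N.
Local Notation Mat := 'M[C]_d.
Local Notation P := (@pauli_vec R n).
Local Notation chi := (@symp_sign n R).
Local Notation D := (d%:R : R).
Local Notation "x %:RC" := (real_complex R x) (at level 2, format "x %:RC").
Variables (rho : Mat) (Hrho : density rho).
Local Notation y a := (complex.Re (\tr (P a *m rho))).
Variables (phi : 'cV[C]_d) (Hphi : pure_state phi).
Let f := projector phi.
Local Notation fR a := (complex.Re (\tr (P a *m f))).
Let Hf : density f := projector_density Hphi.
Local Notation ov := (pauli_overlap phi).
Local Notation x := (D^-1 * \sum_a fR a ^+ 4).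

Lemma pauli_overlapE (sigma : Mat) : density sigma -> forall a, ov sigma a = fR a * complex.Re (\tr (P a *m sigma)) - (a == 0)%:R.
Proof.
move=> Hs a; rewrite /pauli_overlap mulrBl; congr (_ - _).
by case: eqP => [->|_]; rewrite ?mul0r // pauli_vec0 mul1mx; case: Hs => _ [-> _]; rewrite mulr1.
Qed.

Lemma stab_purity_gt0 : 0 < x.
Proof.
rewrite mulr_gt0 ?invr_gt0 ?dim_gt0 // (bigD1 0) //= (expect0 Hf) expr1n.
by rewrite ltr_wpDr // sumr_ge0 // => a _; rewrite (exprM _ 2 2) sqr_ge0.
Qed.

Lemma stab_purity_le1 : x <= 1.
Proof. by rewrite mulrC ler_pdivrMr ?dim_gt0 // mul1r sum_expect4_le. Qed.

(** Cauchy-Schwarz in the form of a weighted inequality of means, with weight s the square root of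
    the stabilizer purity: both halves of the bound then equal at most s / 2. *)
Lemma sum_overlap_le : D^-1 * \sum_a ov rho a ^+ 2 <= Num.sqrt x.
Proof.
have x0 := stab_purity_gt0; set s := Num.sqrt x.
have s0 : 0 < s by rewrite sqrtr_gt0.
have ss : s * s = x by rewrite -expr2 sqr_sqrtr // ltW.
have d0 : 0 < D := dim_gt0 R n.
have i0 : 0 <= D^-1 by rewrite invr_ge0 ltW.
apply: (@le_trans _ _ (D^-1 * \sum_a (s^-1 * fR a ^+ 4 + s * y a ^+ 4) / 2)).
  apply: ler_wpM2l => //; apply: ler_sum => a _.
  have h1 : ov rho a ^+ 2 <= (fR a * y a) ^+ 2.
    rewrite (pauli_overlapE Hrho); case: eqP => [->|_]; last by rewrite subr0.
    by rewrite (expect0 Hf) (expect0 Hrho) mulr1 subrr expr0n expr1n ler01.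
  apply: le_trans h1 _.
  have : 0 <= s^-1 * (fR a ^+ 2 - s * y a ^+ 2) ^+ 2 by rewrite mulr_ge0 ?invr_ge0 ?sqr_ge0 // ltW.
  have -> : s^-1 * (fR a ^+ 2 - s * y a ^+ 2) ^+ 2 = s^-1 * fR a ^+ 4 + s * y a ^+ 4 - 2 * (fR a * y a) ^+ 2.
    by field; rewrite gt_eqF.
  lra.
rewrite -mulr_suml big_split /= -!mulr_sumr.
have -> : D^-1 * ((s^-1 * (\sum_a fR a ^+ 4) + s * \sum_a y a ^+ 4) / 2) =
   (s^-1 * x + s * (D^-1 * \sum_a y a ^+ 4)) / 2 by ring.
rewrite -{1}ss mulKf ?gt_eqF //.
have h : D^-1 * \sum_a y a ^+ 4 <= 1 by rewrite mulrC ler_pdivrMr // mul1r sum_expect4_le.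
have h2 : s * (D^-1 * \sum_a y a ^+ 4) <= s * 1 by rewrite ler_wpM2l // ltW.
lra.
Qed.

Lemma pure_overlap_sum : D^-1 * \sum_a ov f a ^+ 2 = x - D^-1.
Proof.
rewrite -[X in _ - X]mulr1 -mulrBr; congr (_ * _).
rewrite (bigD1 0) //= [in RHS](bigD1 0) //= !(pauli_overlapE Hf) eqxx !(expect0 Hf) mulr1 subrr expr0n expr1n /=.
rewrite add0r [1 + _]addrC addrK; apply: eq_bigr => a /negbTE ha.
by rewrite (pauli_overlapE Hf) ha subr0 -expr2 -exprM.
Qed.

Lemma sum_chi_pure a : \sum_b chi a b * fR b ^+ 2 = D * fR a ^+ 2.
Proof.
have h := sum_chi_ff (@projector_rank1 R n phi) a.
have e : (\sum_b chi a b * fR b ^+ 2)%:RC = (D * fR a ^+ 2)%:RC.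
  have hM (s z : R) : (s * z ^+ 2)%:RC = s%:RC * z%:RC ^+ 2 by rewrite rmorphM rmorphXn.
  have hchi b : (chi a b)%:RC = symp_sign C a b by rewrite /symp_sign rmorphXn rmorphN1.
  have hD : D%:RC = d%:R by rewrite rmorph_nat.
  rewrite hM hD -(pauli_expect_real Hf) -h rmorph_sum; apply: eq_bigr => b _.
  by apply: etrans (hM _ _) _; rewrite hchi -(pauli_expect_real Hf).
exact: (fmorph_inj (real_complex R)) e.
Qed.

Let trf : complex.Re (\tr (f *m f)) = 1.
Proof.
have := rank1_mul (@projector_rank1 R n phi) 1%:M.
by rewrite mulmx1 mul1mx (tr_projector Hphi) scale1r => ->; rewrite (tr_projector Hphi).
Qed.

(** Self-duality of the squared spectrum collapses the inner sum, so the correlation is again the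
    stabilizer purity up to terms in 1/D from the label 0. *)
Lemma pure_overlap_corr : (D * D)^-1 * \sum_b \sum_a chi a b * ov f b * ov f a = x - 2 / D + (D * D)^-1.
Proof.
have d0 := dim_gt0 R n.
have f2 : \sum_a fR a ^+ 2 = D.
  by rewrite (sum_expect_sqr Hf) trf mulr1.
have ovE a : ov f a = fR a ^+ 2 - (a == 0)%:R by rewrite (pauli_overlapE Hf) expr2.
have sdel (h : vec n -> R) : \sum_a h a * (a == 0)%:R = h 0.
  rewrite (bigD1 0) //= eqxx mulr1 big1 ?addr0 // => a /negbTE ->; exact: mulr0.
have E b : \sum_a chi a b * ov f b * ov f a = ov f b * (D * fR b ^+ 2 - 1).
  transitivity (ov f b * (\sum_a chi b a * fR a ^+ 2 - \sum_a chi b a * (a == 0)%:R)).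
    by rewrite mulrBr !mulr_sumr -sumrB; apply: eq_bigr => a _; rewrite (ovE a) (chiC _ a b); ring.
  by rewrite sum_chi_pure sdel chiv0.
rewrite (eq_bigr _ (fun b _ => E b)).
have -> : \sum_b ov f b * (D * fR b ^+ 2 - 1) = D * (\sum_a fR a ^+ 4) - 2 * D + 1.
  transitivity (\sum_b (D * fR b ^+ 4 - fR b ^+ 2 - (D * fR b ^+ 2 - 1) * (b == 0)%:R)).
    by apply: eq_bigr => b _; rewrite ovE (exprM _ 2 2); ring.
  rewrite !sumrB -mulr_sumr f2 sdel (expect0 Hf) expr1n; ring.
by field; rewrite gt_eqF.
Qed.

End PureOverlap.

(** * Stabilizer purity and entropy *)

Section StabilizerEntropy.
Variable R : realType.
Variable n : nat.
Variable phi : 'cV[R[i]]_(2 ^ n).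
Hypothesis Hphi : pure_state phi.
Local Notation x := ((2 ^ n)%:R^-1 * \sum_a complex.Re (\tr (pauli_vec R a *m projector phi)) ^+ 4).

Lemma M2E : M2 phi = - log2 x.
Proof.
rewrite /M2 (reindex (@enc n)) /=; last exact: onW_bij (enc_bij n).
by congr (- log2 (_ * _)); apply: eq_bigr => a _; rewrite pauli_enc expect_tr.
Qed.

Lemma powR2_log2 (z : R) : 0 < z -> 2 `^ log2 z = z.
Proof.
move=> z0; have l2 : ln (2 : R) != 0 by rewrite gt_eqF // ln_gt0 // ltr1n.
by rewrite /powR pnatr_eq0 /= /log2 mulrC mulrCA mulfV // mulr1 lnK.
Qed.

Lemma powR_M2 : 2 `^ (1 - M2 phi) = 2 * x.
Proof.
by rewrite M2E opprK powRD ?pnatr_eq0 ?implybT // powRr1 // powR2_log2 // stab_purity_gt0.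
Qed.

Lemma powR_M2_half : 2 `^ (1 - M2 phi / 2) = 2 * Num.sqrt x.
Proof.
have x0 : 0 < x by exact: stab_purity_gt0.
rewrite M2E mulNr opprK powRD ?pnatr_eq0 ?implybT // powRr1 // powRrM powR2_log2 //.
by rewrite powR12_sqrt // ltW.
Qed.

End StabilizerEntropy.

(** The maximum over rho is expressed by a bound for every density operator, and Q is any preimage
    of the observable; [meas_channel_inv] shows that it is (d + 1) O. *)
Theorem theorem6 (R : realType) (n k l : nat) (hn : (1 <= n)%N) (hk : (k <= n)%N)
  (m : nat) (S : 'I_m -> 'M[R[i]]_(2 ^ n)) (HS : clifford_transversal S)
  (phi : 'cV[R[i]]_(2 ^ n)) (Hphi : pure_state phi)
  (Q : 'M[R[i]]_(2 ^ n)) (HQ : meas_channel S k l Q = Ophi phi) :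
  let d : R := (2 ^ n)%:R in
  let gamma : R := 3 / 4 in
  (forall rho : 'M[R[i]]_(2 ^ n), density rho ->
     Vstar_rho S k l (Ophi phi) Q rho
       <= 2 `^ (1 - M2 phi / 2) * gamma ^+ (k * l) + 6 / d) /\
  (- (6 / d) < Vstar_rho S k l (Ophi phi) Q (projector phi)
                 - 2 `^ (1 - M2 phi) * gamma ^+ (k * l)
   /\ Vstar_rho S k l (Ophi phi) Q (projector phi)
                 - 2 `^ (1 - M2 phi) * gamma ^+ (k * l) < 4 / d).
Proof.
move=> d gamma.
pose c := coefs_exist R hn hk.
have d2 : 2 <= d by rewrite ler_nat -{1}(expn1 2) leq_exp2l.
have g0 : 0 <= gamma ^+ k by rewrite exprn_ge0 // /gamma; lra.
have g1 : gamma ^+ k <= 1 by rewrite exprn_ile1 // /gamma; lra.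
have a0 := rate_triv_ge0 c; have aa := rate_triv_le c; have ag := rate_std_le c; have gap := rate_triv_gap c.
have b0 : 0 <= rate_triv c ^+ l by rewrite exprn_ge0.
have b1 : rate_triv c ^+ l <= rate_std c ^+ l by rewrite lerXn2r // nnegrE; lra.
have b2 : rate_std c ^+ l <= gamma ^+ (k * l) by rewrite exprM lerXn2r // nnegrE; lra.
have b4 : 0 <= gamma ^+ (k * l) by rewrite exprM exprn_ge0.
have b3 : gamma ^+ (k * l) <= 1 by rewrite exprM exprn_ile1.
split=> [rho Hrho|].
  rewrite (Vstar_value hk HS c Hphi Hrho HQ) (powR_M2_half Hphi).
  have hp := sum_overlap_le Hrho Hphi.
  apply: (@le_trans _ _ (2 * (d^-1 * \sum_a pauli_overlap phi rho a ^+ 2) * gamma ^+ (k * l) + 6 / d)); last first.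
    by rewrite lerD2r; apply: ler_wpM2r => //; apply: ler_wpM2l.
  apply: variance_upper => //; last exact: purity_le1.
  - lra.
  - exact: chi_corr_le.
  - exact: fidelity_ge0.
  - exact: (fidelity_sqr_le Hrho Hphi).
  - exact: fidelity2_le.
  - exact: purity_ge0.
have Hf := projector_density Hphi.
have ff : projector phi *m projector phi = projector phi.
  have := rank1_mul (@projector_rank1 R n phi) 1%:M.
  by rewrite mulmx1 mul1mx (tr_projector Hphi) scale1r.
rewrite (Vstar_value hk HS c Hphi Hf HQ) (powR_M2 Hphi) !ff (tr_projector Hphi).
rewrite (pure_overlap_sum Hphi) (pure_overlap_corr Hphi).
apply: variance_pure => //.
- lra.
- lra.
- rewrite exprM; apply: pow_gap => //; lra.
- exact: ltW (stab_purity_gt0 Hphi).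
- exact: stab_purity_le1 Hphi.
Qed.
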